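(* Let $X=V(F_1,\ldots,F_m,G)\subseteq\mathbb{A}_\kappa^{\ell_1+\cdots+\ell_m+m+2}$ be the fiber defined in the context, with associated $\lambda_1,\ldots,\lambda_m,\mu\in\kappa^\times$, index sets $I_{\alpha_1},\ldots,I_{\alpha_s}$ and loci $D$, $C_{\alpha_i}$ as defined there. (1) If $\ell_\alpha=2k_\alpha$ for all $\alpha\in\{1,\ldots,m\}$ and $(-1)^{k_1+\cdots+k_m}+\mu=0$, then $X$ is locally at the origin $D$ isomorphic to a hypersurface singularity of type $A_1$. (2) If $C_{\alpha_i}=\bigcup_{\alpha,\beta\in I_{\alpha_i},\,\alpha\neq\beta} C_{\alpha,\beta}$ is contained in $\operatorname{Sing}(X)$, then $X$ is locally at $C_{\alpha_i}$ isomorphic to a cylinder over an intersection of compatible $A_1$-hypersurface singularities centered at $V(\mathbf z^{(\beta)}\mid\beta\in I_{\alpha_i})$, where $C_{\alpha_i}$ corresponds to the locus $\mathcal{Y}_{n-2}$ of that intersection of compatible $A_1$-hypersurface singularities, for $n:=|I_{\alpha_i}|$.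
   Context: **The star cluster algebra.** Let $K$ be a field of any characteristic, $m\geq 1$, and $\ell_1,\ldots,\ell_m$ positive integers. The star-shaped quiver $\mathcal{Q}_\star$ has vertices $0$ and $i^{(\alpha)}$ ($1\le\alpha\le m$, $1\le i\le \ell_\alpha$), all mutable, and arrows $1^{(\alpha)}\to 0$ and $(i+1)^{(\alpha)}\to i^{(\alpha)}$ for $1\le i<\ell_\alpha$. The quiver $\mathcal{Q}_\star^{\mathrm{prin}}$ is obtained by adding, for each mutable vertex $k$, a frozen vertex $k_c$ and one arrow $k_c\to k$. The cluster algebra with principal coefficients $\mathcal{A}_\star^{\mathrm{prin}} := \mathcal{A}(\mathcal{Q}_\star^{\mathrm{prin}})$ (over $K$, coefficient variables invertible) is, since the quiver is acyclic, $$\mathcal{A}_\star^{\mathrm{prin}} \cong K_{\mathbf c}[\mathbf x,\mathbf y,u,v]/\langle g, f_i^{(\alpha)} \mid 1\le\alpha\le m,\ 1\le i\le\ell_\alpha\rangle,$$ where $\mathbf c=(c_0, c_i^{(\alpha)})$, $\mathbf x=(x_i^{(\alpha)})$, $\mathbf y=(y_i^{(\alpha)})$ ($1\le\alpha\le m$, $1\le i\le \ell_\alpha$), $u$, $v$ are independent variables, $K_{\mathbf c}:=K[\mathbf c^{\pm1}]$, $g = uv-c_0\prod_{\alpha=1}^m x_1^{(\alpha)}-1$, $f_i^{(\alpha)}=x_i^{(\alpha)}y_i^{(\alpha)}-x_{i-1}^{(\alpha)}-c_i^{(\alpha)}x_{i+1}^{(\alpha)}$ for $i<\ell_\alpha$,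 $f_{\ell_\alpha}^{(\alpha)}=x_{\ell_\alpha}^{(\alpha)}y_{\ell_\alpha}^{(\alpha)}-x_{\ell_\alpha-1}^{(\alpha)}-c_{\ell_\alpha}^{(\alpha)}$, with the convention $x_0^{(\alpha)}:=u$. **The fiber $X$.** Let $\phi\colon\operatorname{Spec}(\mathcal{A}_\star^{\mathrm{prin}})\to S:=\operatorname{Spec}(K_{\mathbf c})$ be the structure morphism, $\eta\in S$ a closed point, $\kappa=\kappa(\eta)$ the residue field of $\mathcal{O}_{S,\eta}$, and $X:=\phi^{-1}(\eta)$. It is embedded as $$X=V(F_1,\ldots,F_m,G)\subseteq \mathbb{A}_\kappa^{\ell_1+\cdots+\ell_m+m+2}$$ with coordinates $z_1^{(\alpha)},\ldots,z_{\ell_\alpha+1}^{(\alpha)}$ ($1\le \alpha\le m$), $u$, $w$, where $$F_\alpha = P_{\ell_\alpha+1}(z_1^{(\alpha)},\ldots,z_{\ell_\alpha+1}^{(\alpha)})-\lambda_\alpha u,\qquad G = uw-\prod_{\alpha=1}^m P_{\ell_\alpha}(z_1^{(\alpha)},\ldots,z_{\ell_\alpha}^{(\alpha)})-\mu.$$ Here $P_n$ are the continuant polynomials: $P_0=1$, $P_1(z_1)=z_1$, $P_n(z_1,\ldots,z_n)=z_nP_{n-1}(z_1,\ldots,z_{n-1})-P_{n-2}(z_1,\ldots,z_{n-2})$ for $n\ge2$; and $\lambda_\alpha,\mu\in\kappa^\times$ are the images in $\kappa$ of $(\rho_1^{(\alpha)})^{-1}$ and $c_0^{-1}\big(\prod_{\alpha=1}^m\rho_2^{(\alpha)}\big)^{-1}$,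 where $\rho_{\ell_\alpha+1}^{(\alpha)}:=1$, $\rho_{\ell_\alpha}^{(\alpha)}:=c_{\ell_\alpha}^{(\alpha)}$, $\rho_i^{(\alpha)}:=c_i^{(\alpha)}\rho_{i+2}^{(\alpha)}$ for $i<\ell_\alpha$. $\operatorname{Sing}(X)$ is the locus of points at which $X$ is not regular. **Compatibility and the partition.** For $\alpha,\beta\in\{1,\ldots,m\}$, $(\ell_\alpha,\lambda_\alpha)$ and $(\ell_\beta,\lambda_\beta)$ are *compatible* if $\alpha=\beta$, or if both $\ell_\alpha=2k_\alpha-1$ and $\ell_\beta=2k_\beta-1$ are odd ($k_\alpha,k_\beta\in\mathbb{Z}_+$) and $\lambda_\alpha(-1)^{k_\alpha}=\lambda_\beta(-1)^{k_\beta}$. Let $I_\alpha:=\{\beta\in\{1,\ldots,m\}\mid(\ell_\alpha,\lambda_\alpha)\text{ and }(\ell_\beta,\lambda_\beta)\text{ are compatible}\}$ and $\sigma(I_\alpha):=\min I_\alpha$. Let $\alpha_1,\ldots,\alpha_s$ be the distinct values $\sigma(I_\alpha)$ over all $\alpha$ with $|I_\alpha|\ge2$. **The loci.** $D$ is the origin of $\mathbb{A}_\kappa^{\ell_1+\cdots+\ell_m+m+2}$. With $\mathbf z^{(\alpha)}:=(z_1^{(\alpha)},\ldots,z_{\ell_\alpha+1}^{(\alpha)})$, for $\alpha\ne\beta$ in $I_{\alpha_i}$ (and $\ell_\alpha=2k_\alpha-1$) set $$C_{\alpha,\beta}:=V(\mathbf z^{(\alpha)},\mathbf z^{(\beta)},u-\xi_u,w-\xi_w)\cap\bigcap_{\gamma\ne\alpha,\beta}V(P_{\ell_\gamma+1}(z_1^{(\gamma)},\ldots,z_{\ell_\gamma+1}^{(\gamma)})-\xi_\gamma),$$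 with $\xi_u:=(-1)^{k_\alpha}\lambda_\alpha^{-1}$, $\xi_w:=(-1)^{k_\alpha}\lambda_\alpha\mu$, $\xi_\gamma:=(-1)^{k_\alpha}\lambda_\gamma\lambda_\alpha^{-1}$, and $C_{\alpha_i}:=\bigcup_{\alpha,\beta\in I_{\alpha_i},\,\alpha\ne\beta}C_{\alpha,\beta}$. **Singularity types.** A hypersurface singularity of dimension $n$ is *of type $A_1$* if it is an isolated singularity at which the variety is locally given by $x_0^2+x_1x_2+\cdots+x_{n-1}x_n=0$ (if $n$ is even), resp. $x_0x_1+\cdots+x_{n-1}x_n=0$ (if $n$ is odd), after possibly passing to the completion at the singular point. An *intersection of ($n\ge2$) compatible $A_1$-hypersurface singularities centered at $V(\mathbf t^{(a)}\mid a\in\{1,\ldots,n\})$* is a singularity of the form $$\mathcal{X}^{(n)}=V(g_a(\mathbf t^{(a)})-g_b(\mathbf t^{(b)})\mid a,b\in\{1,\ldots,n\})\subset\mathbb{A}_\kappa^{2(q_1+\cdots+q_n)},$$ where $q_a\ge1$, $\mathbf t^{(a)}=(t_1^{(a)},\ldots,t_{2q_a}^{(a)})$ and $g_a(\mathbf t^{(a)})=\sum_{i=1}^{q_a}t_{2i-1}^{(a)}t_{2i}^{(a)}$. For $j\in\{0,\ldots,n-2\}$, $\mathcal{Y}_j:=\bigcup_{a_1<\cdots<a_{n-j}}\big(V(\mathbf t^{(a_1)},\ldots,\mathbf t^{(a_{n-j})})\cap\mathcal{X}^{(n)}\big)$; in particular $\mathcal{Y}_{n-2}=\bigcup_{a_1<a_2}\big(V(\mathbf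 t^{(a_1)},\mathbf t^{(a_2)})\cap\mathcal{X}^{(n)}\big)$. A singularity $Z\subset\mathbb{A}_\kappa^N$ that is locally isomorphic to $Y\times\mathbb{A}_\kappa^{N-M}$ for a singularity $Y\subset\mathbb{A}_\kappa^M$ is called a *cylinder over $Y$*. *)

(* Defs.v *)
From HB Require Import structures.
From mathcomp Require Import all_boot all_algebra.
From mathcomp Require Import generic_quotient boolp.
From mathcomp Require Import ring.

Set Implicit Arguments.
Unset Strict Implicit.
Unset Printing Implicit Defensive.

Import GRing.Theory.
Local Open Scope ring_scope.
Local Open Scope quotient_scope.

Section Ideals.
Variable R : comPzRingType.
Implicit Types (E S J : R -> Prop) (p : R -> Prop).

Definition ideal_gen E (x : R) : Prop :=
  exists n (a g : 'I_n -> R), (forall i, E (g i)) /\ x = \sum_i a i * g i.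

Definition is_ideal J : Prop :=
  [/\ J 0, (forall x y, J x -> J y -> J (x + y)) & (forall a x, J x -> J (a * x))].

Definition is_prime p : Prop :=
  [/\ is_ideal p, ~ p 1 & forall x y, p (x * y) -> p x \/ p y].

Definition ideal_pow J (k : nat) : R -> Prop :=
  ideal_gen (fun x => exists s : 'I_k -> R, (forall i, J (s i)) /\ x = \prod_i s i).

Inductive monoid_gen S : R -> Prop :=
| Monoid1 : monoid_gen S 1
| MonoidM s t : S s -> monoid_gen S t -> monoid_gen S (s * t).

Lemma ideal_gen_sub E x : E x -> ideal_gen E x.
Proof.
move=> Ex; exists 1%N, (fun=> 1), (fun=> x); split=> //.
by rewrite big_ord1 mul1r.
Qed.

Lemma ideal_gen_ideal E : is_ideal (ideal_gen E).
Proof.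
split.
- by exists 0%N, (fun=> 0), (fun=> 0); split; [case | rewrite big_ord0].
- move=> _ _ [n [a [g [Eg ->]]]] [n' [a' [g' [Eg' ->]]]].
  exists (n + n')%N.
  exists (fun i => match split i with inl j => a j | inr j => a' j end).
  exists (fun i => match split i with inl j => g j | inr j => g' j end).
  split; first by move=> i; case: (split i).
  by rewrite big_split_ord /=; congr (_ + _); apply: eq_bigr => i _;
     [rewrite -/(unsplit (inl i)) | rewrite -/(unsplit (inr i))]; rewrite unsplitK.
- move=> b _ [n [a [g [Eg ->]]]]; exists n, (fun i => b * a i), g; split=> //.
  by rewrite mulr_sumr; apply: eq_bigr => i _; rewrite mulrA.
Qed.

Lemma monoid_genM S s t : monoid_gen S s -> monoid_gen S t -> monoid_gen S (s * t).
Proof.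
move=> Ms Mt; elim: Ms => [|a b Sa _ IH]; first by rewrite mul1r.
by rewrite -mulrA; constructor.
Qed.

End Ideals.

(* The ring of fractions of R/(E) whose denominators are the products of
   elements of S. *)
Section Localization.
Variables (R : comPzRingType) (E S : R -> Prop).

Definition den := {s : R | `[< monoid_gen S s >]}.

Lemma denP (s : den) : monoid_gen S (sval s).
Proof. by apply/asboolP; case: s. Qed.

Definition mkden s (Ms : monoid_gen S s) : den := exist _ s (asboolT Ms).
Definition den1 : den := mkden (Monoid1 S).
Definition denM (s t : den) : den := mkden (monoid_genM (denP s) (denP t)).

Definition loc_rel (x y : R * den) : bool :=
  `[< exists2 t, monoid_gen S t
      & ideal_gen E (t * (x.1 * sval y.2 - y.1 * sval x.2)) >].

Lemma loc_refl : reflexive loc_rel.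
Proof.
move=> x; apply/asboolP; exists 1; first by constructor.
by rewrite subrr mulr0; case: (ideal_gen_ideal E).
Qed.

Lemma loc_symi x y : loc_rel x y -> loc_rel y x.
Proof.
move=> /asboolP[t Mt Et]; apply/asboolP; exists t => //.
case: (ideal_gen_ideal E) => _ _ /(_ (-1) _ Et).
by rewrite mulN1r -mulrN opprB.
Qed.

Lemma loc_sym : symmetric loc_rel.
Proof. by move=> x y; apply/idP/idP; apply: loc_symi. Qed.

Lemma loc_trans : transitive loc_rel.
Proof.
move=> y x z /asboolP[t Mt Et] /asboolP[r Mr Er]; apply/asboolP.
exists (t * r * sval y.2); first by apply: monoid_genM (denP _); apply: monoid_genM.
case: (ideal_gen_ideal E) => _ ED EM.
have := ED _ _ (EM (r * sval z.2) _ Et) (EM (t * sval x.2) _ Er).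
congr (ideal_gen E _); ring.
Qed.

Canonical loc_equiv := EquivRel loc_rel loc_refl loc_sym loc_trans.

Definition loc := {eq_quot loc_rel}.
HB.instance Definition _ : EqQuotient _ loc_rel loc := EqQuotient.on loc.
HB.instance Definition _ := Choice.on loc.

Definition frac (a : R) (s : den) : loc := \pi_loc (a, s).

Lemma fracP a s b t :
  frac a s = frac b t <->
  exists2 r, monoid_gen S r & ideal_gen E (r * (a * sval t - b * sval s)).
Proof.
split=> [/eqP|H]; first by rewrite /frac eqmodE => /asboolP.
by apply/eqP; rewrite /frac eqmodE; apply/asboolP.
Qed.

Lemma frac_surj (x : loc) : exists a s, x = frac a s.
Proof. by exists (repr x).1, (repr x).2; rewrite /frac -surjective_pairing reprK. Qed.

Definition loc_add (x y : loc) : loc :=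
  frac ((repr x).1 * sval (repr y).2 + (repr y).1 * sval (repr x).2)
       (denM (repr x).2 (repr y).2).
Definition loc_mul (x y : loc) : loc :=
  frac ((repr x).1 * (repr y).1) (denM (repr x).2 (repr y).2).
Definition loc_opp (x : loc) : loc := frac (- (repr x).1) (repr x).2.

Lemma repr_frac a s :
  exists2 r, monoid_gen S r
    & ideal_gen E (r * ((repr (frac a s)).1 * sval s - a * sval (repr (frac a s)).2)).
Proof. by apply/fracP; rewrite /frac -surjective_pairing reprK. Qed.

Lemma loc_addE a s b t :
  loc_add (frac a s) (frac b t) = frac (a * sval t + b * sval s) (denM s t).
Proof.
rewrite /loc_add; apply/fracP => /=.
have [r Mr Er] := repr_frac a s; have [r' Mr' Er'] := repr_frac b t.
move: Er Er'; set x := repr (frac a s); set y := repr (frac b t) => Er Er'.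
exists (r * r'); first exact: monoid_genM.
case: (ideal_gen_ideal E) => _ ED EM.
have := ED _ _ (EM (r' * sval t * sval y.2) _ Er) (EM (r * sval s * sval x.2) _ Er').
congr (ideal_gen E _); ring.
Qed.

Lemma loc_mulE a s b t :
  loc_mul (frac a s) (frac b t) = frac (a * b) (denM s t).
Proof.
rewrite /loc_mul; apply/fracP => /=.
have [r Mr Er] := repr_frac a s; have [r' Mr' Er'] := repr_frac b t.
move: Er Er'; set x := repr (frac a s); set y := repr (frac b t) => Er Er'.
exists (r * r'); first exact: monoid_genM.
case: (ideal_gen_ideal E) => _ ED EM.
have := ED _ _ (EM (r' * y.1 * sval t) _ Er) (EM (r * a * sval x.2) _ Er').
congr (ideal_gen E _); ring.
Qed.

Lemma loc_oppE a s : loc_opp (frac a s) = frac (- a) s.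
Proof.
rewrite /loc_opp; apply/fracP => /=.
have [r Mr Er] := repr_frac a s; exists r => //.
case: (ideal_gen_ideal E) => _ _ /(_ (-1) _ Er).
congr (ideal_gen E _); ring.
Qed.

Lemma frac_eq a s b t : a * sval t = b * sval s -> frac a s = frac b t.
Proof.
move=> H; apply/fracP; exists 1; first by constructor.
by rewrite H subrr mulr0; case: (ideal_gen_ideal E).
Qed.

Lemma loc_addA : associative loc_add.
Proof.
move=> x y z; have [[a [s ->]] [b [t ->]]] := (frac_surj x, frac_surj y).
have [c [r ->]] := frac_surj z; rewrite !loc_addE; apply: frac_eq => /=; ring.
Qed.

Lemma loc_addC : commutative loc_add.
Proof.
move=> x y; have [[a [s ->]] [b [t ->]]] := (frac_surj x, frac_surj y).
rewrite !loc_addE; apply: frac_eq => /=; ring.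
Qed.

Lemma loc_add0 : left_id (frac 0 den1) loc_add.
Proof.
move=> x; have [a [s ->]] := frac_surj x.
rewrite !loc_addE; apply: frac_eq => /=; ring.
Qed.

Lemma loc_addN : left_inverse (frac 0 den1) loc_opp loc_add.
Proof.
move=> x; have [a [s ->]] := frac_surj x.
rewrite loc_oppE !loc_addE; apply: frac_eq => /=; ring.
Qed.

HB.instance Definition _ :=
  GRing.isZmodule.Build loc loc_addA loc_addC loc_add0 loc_addN.

Lemma loc_mulA : associative loc_mul.
Proof.
move=> x y z; have [[a [s ->]] [b [t ->]]] := (frac_surj x, frac_surj y).
have [c [r ->]] := frac_surj z; rewrite !loc_mulE; apply: frac_eq => /=; ring.
Qed.

Lemma loc_mulC : commutative loc_mul.
Proof.
move=> x y; have [[a [s ->]] [b [t ->]]] := (frac_surj x, frac_surj y).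
rewrite !loc_mulE; apply: frac_eq => /=; ring.
Qed.

Lemma loc_mul1 : left_id (frac 1 den1) loc_mul.
Proof.
move=> x; have [a [s ->]] := frac_surj x.
rewrite !loc_mulE; apply: frac_eq => /=; ring.
Qed.

Lemma loc_mulD : left_distributive loc_mul +%R.
Proof.
move=> x y z; have [[a [s ->]] [b [t ->]]] := (frac_surj x, frac_surj y).
have [c [r ->]] := frac_surj z.
rewrite [LHS]/loc_mul -/(loc_mul _ _) /GRing.add /= loc_addE !loc_mulE loc_addE.
apply: frac_eq => /=; ring.
Qed.

HB.instance Definition _ :=
  GRing.Zmodule_isComPzRing.Build loc loc_mulA loc_mulC loc_mul1 loc_mulD.

Lemma frac0 : frac 0 den1 = 0. Proof. by []. Qed.

Lemma frac1 : frac 1 den1 = 1. Proof. by []. Qed.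

Lemma fracD a s b t : frac a s + frac b t = frac (a * sval t + b * sval s) (denM s t).
Proof. exact: loc_addE. Qed.

Lemma fracM a s b t : frac a s * frac b t = frac (a * b) (denM s t).
Proof. exact: loc_mulE. Qed.

Lemma fracN a s : - frac a s = frac (- a) s.
Proof. exact: loc_oppE. Qed.

Definition to_loc (a : R) : loc := frac a den1.

Lemma to_loc_is_zmod_morphism : zmod_morphism to_loc.
Proof. by move=> a b; rewrite fracN fracD; apply: frac_eq => /=; ring. Qed.

Lemma to_loc_is_monoid_morphism : monoid_morphism to_loc.
Proof. by split=> // a b; rewrite fracM; apply: frac_eq => /=; ring. Qed.

HB.instance Definition _ :=
  GRing.isZmodMorphism.Build R loc to_loc to_loc_is_zmod_morphism.
HB.instance Definition _ :=
  GRing.isMonoidMorphism.Build R loc to_loc to_loc_is_monoid_morphism.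

(* The extension p * loc. *)
Definition extension (p : R -> Prop) (x : loc) : Prop :=
  exists a s, p a /\ x = frac a s.

End Localization.

Definition quot (R : comPzRingType) (E : R -> Prop) : comPzRingType :=
  loc E (fun=> False).

(* Used for R local only, where the nonunits form the maximal ideal. *)
Definition nonunit (R : comPzRingType) (x : R) : Prop := ~ exists y, x * y = 1.

(* The inverse limit of the R/m^k, with m the nonunits. *)
Section Completion.
Variable R : comPzRingType.

Definition trunc (k : nat) : comPzRingType := quot (ideal_pow (@nonunit R) k).
Definition to_trunc (k : nat) : {rmorphism R -> trunc k} := @to_loc R _ _.

Definition compatible_seq (f : forall k, trunc k) : Prop :=
  forall k, exists r, f k = to_trunc k r /\ f k.+1 = to_trunc k.+1 r.

Definition completion := {f : forall k, trunc k | `[< compatible_seq f >]}.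
HB.instance Definition _ := Choice.on completion.

Lemma completionP (x : completion) : compatible_seq (val x).
Proof. by apply/asboolP; case: x. Qed.

Definition mkcompl f (cf : compatible_seq f) : completion := exist _ f (asboolT cf).

Lemma compl_const (r : R) : compatible_seq (fun k => to_trunc k r).
Proof. by move=> k; exists r. Qed.
Lemma compl_addP (x y : completion) : compatible_seq (fun k => val x k + val y k).
Proof.
move=> k; have [r [-> ->]] := completionP x k; have [s [-> ->]] := completionP y k.
by exists (r + s); rewrite !rmorphD.
Qed.
Lemma compl_mulP (x y : completion) : compatible_seq (fun k => val x k * val y k).
Proof.
move=> k; have [r [-> ->]] := completionP x k; have [s [-> ->]] := completionP y k.
by exists (r * s); rewrite !rmorphM.
Qed.
Lemma compl_oppP (x : completion) : compatible_seq (fun k => - val x k).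
Proof.
by move=> k; have [r [-> ->]] := completionP x k; exists (- r); rewrite !rmorphN.
Qed.

Definition to_completion (r : R) : completion := mkcompl (compl_const r).
Definition compl_add x y : completion := mkcompl (compl_addP x y).
Definition compl_mul x y : completion := mkcompl (compl_mulP x y).
Definition compl_opp x : completion := mkcompl (compl_oppP x).

Lemma compl_ext (x y : completion) : (forall k, val x k = val y k) -> x = y.
Proof. by move=> H; apply: val_inj; apply: functional_extensionality_dep. Qed.

Lemma compl_addA : associative compl_add.
Proof. by move=> x y z; apply: compl_ext => k /=; rewrite addrA. Qed.
Lemma compl_addC : commutative compl_add.
Proof. by move=> x y; apply: compl_ext => k /=; rewrite addrC. Qed.
Lemma compl_add0 : left_id (to_completion 0) compl_add.
Proof. by move=> x; apply: compl_ext => k /=; rewrite rmorph0 add0r. Qed.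
Lemma compl_addN : left_inverse (to_completion 0) compl_opp compl_add.
Proof. by move=> x; apply: compl_ext => k /=; rewrite rmorph0 addNr. Qed.

HB.instance Definition _ :=
  GRing.isZmodule.Build completion compl_addA compl_addC compl_add0 compl_addN.

Lemma compl_mulA : associative compl_mul.
Proof. by move=> x y z; apply: compl_ext => k /=; rewrite mulrA. Qed.
Lemma compl_mulC : commutative compl_mul.
Proof. by move=> x y; apply: compl_ext => k /=; rewrite mulrC. Qed.
Lemma compl_mul1 : left_id (to_completion 1) compl_mul.
Proof. by move=> x; apply: compl_ext => k /=; rewrite rmorph1 mul1r. Qed.
Lemma compl_mulD : left_distributive compl_mul +%R.
Proof. by move=> x y z; apply: compl_ext => k /=; rewrite mulrDl. Qed.

HB.instance Definition _ := GRing.Zmodule_isComPzRing.Build completion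
  compl_mulA compl_mulC compl_mul1 compl_mulD.

End Completion.

Section Regularity.
Variable R : comPzRingType.

Definition prime_chain (d : nat) (c : nat -> R -> Prop) : Prop :=
  (forall i, (i <= d)%N -> is_prime (c i)) /\
  (forall i, (i < d)%N ->
     (forall x, c i x -> c i.+1 x) /\ exists2 x, c i.+1 x & ~ c i x).

Definition krull_dim (d : nat) : Prop :=
  (exists c, prime_chain d c) /\ (forall c, ~ prime_chain d.+1 c).

(* For a noetherian local ring: the maximal ideal is generated by dim R
   elements. *)
Definition regular_local : Prop :=
  exists d, krull_dim d /\ exists g : 'I_d -> R,
    forall x, nonunit x <-> ideal_gen (fun y => exists i, y = g i) x.

End Regularity.

From mathcomp Require Import mpoly.

(* The polynomial ring k[X_t | t in T]. *)
Notation polyring k T := {mpoly k[#|{: T}|]}.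

Definition var (k : fieldType) (T : finType) (t : T) : polyring k T :=
  'X_(enum_rank t).
Arguments var k {T} t.

(* A closed subscheme of A^T is given by a set E of equations; its points are
   the prime ideals of the polynomial ring containing E. *)
Definition locus (k : fieldType) (T : finType) := (polyring k T -> Prop) -> Prop.

Definition Vpts (k : fieldType) (T : finType) (E : polyring k T -> Prop) : locus k T :=
  fun p => is_prime p /\ forall f, E f -> p f.

Definition origin (k : fieldType) (T : finType) (f : polyring k T) : Prop :=
  f.@[fun _ => 0] = 0.

Section LocalRings.
Variables (k : fieldType) (T : finType).
Implicit Types E p : polyring k T -> Prop.

Definition local_ring E p : comPzRingType := loc E (fun f => ~ p f).

(* The local rings are noetherian since V(E) is of finite type over k. *)
Definition Sing E p : Prop := Vpts E p /\ ~ regular_local (local_ring E p).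

Definition isolated_singularity E p : Prop :=
  Sing E p /\
  exists2 h, ~ p h & forall q, Sing E q -> ~ q h -> forall f, q f <-> p f.

End LocalRings.

(* A k-isomorphism between the basic open neighborhoods D(h) of p in V(E) and
   D(h') of p' in V(E') taking p to p'. *)
Record local_iso (k : fieldType) (T T' : finType)
    (E : polyring k T -> Prop) (p : polyring k T -> Prop)
    (E' : polyring k T' -> Prop) (p' : polyring k T' -> Prop) := LocalIso {
  src : polyring k T;
  tgt : polyring k T';
  comorph : {rmorphism loc E (eq src) -> loc E' (eq tgt)};
  src_mem : Vpts E p /\ ~ p src;
  tgt_mem : Vpts E' p' /\ ~ p' tgt;
  comorph_bij : bijective comorph;
  comorph_const : forall a : k, comorph (to_loc _ _ a%:MP) = to_loc _ _ a%:MP;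
  comorph_point : forall x, extension p x <-> extension p' (comorph x)
}.

(* L and L' correspond to each other within these neighborhoods. *)
Definition loci_correspond (k : fieldType) (T T' : finType)
    (E p : polyring k T -> Prop) (E' p' : polyring k T' -> Prop)
    (e : local_iso E p E' p') (L : locus k T) (L' : locus k T') : Prop :=
  forall r r', Vpts E r -> ~ r (src e) -> Vpts E' r' -> ~ r' (tgt e) ->
    (forall x, extension r x <-> extension r' (comorph e x)) -> (L r <-> L' r').

Definition formally_iso (k : fieldType) (T T' : finType)
    (E p : polyring k T -> Prop) (E' p' : polyring k T' -> Prop) : Prop :=
  exists phi : {rmorphism completion (local_ring E p) ->
                          completion (local_ring E' p')},
    bijective phi /\
    forall a : k, phi (to_completion (to_loc _ _ a%:MP : local_ring E p)) =
                  to_completion (to_loc _ _ a%:MP : local_ring E' p').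

Section A1.
Variables (k : fieldType) (n : nat).

Definition A1_var (i : nat) : polyring k 'I_n.+1 := var k (inord i).

Definition A1_poly : polyring k 'I_n.+1 :=
  if odd n then \sum_(i < n.+1./2) A1_var i.*2 * A1_var i.*2.+1
  else A1_var 0 ^+ 2 + \sum_(i < n./2) A1_var i.*2.+1 * A1_var i.*2.+2.

End A1.

Definition A1_singularity (k : fieldType) (T : finType)
    (E p : polyring k T -> Prop) : Prop :=
  isolated_singularity E p /\ exists n : nat,
    inhabited (local_iso E p (eq (A1_poly k n)) (@origin k _)) \/
    formally_iso E p (eq (A1_poly k n)) (@origin k _).

(* V(E) x A^d and L x A^d, the latter as the preimage of L under the
   projection. *)
Section Cylinder.
Variables (k : fieldType) (T : finType) (d : nat).

Definition pullback (f : polyring k T) : polyring k (T + 'I_d)%type :=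
  mmap (@mpolyC _ k) (fun i => var k (inl (enum_val i))) f.

Definition cylinder (E : polyring k T -> Prop) (f : polyring k (T + 'I_d)%type) :
  Prop := exists2 g, E g & f = pullback g.

Definition cylinder_locus (L : locus k T) : locus k (T + 'I_d)%type :=
  fun p => L (fun f => p (pullback f)).

End Cylinder.

(* The blocks are indexed by a finite type A; the indices (i, false) and
   (i, true), i < q_a, stand for 2i+1 and 2i+2 in t^(a)_1, ..., t^(a)_{2q_a}. *)
Section CompatibleA1.
Variables (k : fieldType) (A : finType) (q : A -> nat).

Definition cA1_coord := {a : A & ('I_(q a) * bool)%type}.

Definition tvar (a : A) (s : 'I_(q a) * bool) : polyring k cA1_coord :=
  var k (existT _ a s : cA1_coord).

Definition gA1 (a : A) : polyring k cA1_coord :=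
  \sum_(i < q a) tvar (i, false) * tvar (i, true).

Definition cA1_eqs (f : polyring k cA1_coord) : Prop :=
  exists a b, f = gA1 a - gA1 b.

Definition tblock (a : A) (f : polyring k cA1_coord) : Prop :=
  exists s, f = @tvar a s.

Definition cA1_Y (j : nat) : locus k cA1_coord := fun p =>
  Vpts cA1_eqs p /\ exists2 B : {set A}, #|B| = (#|A| - j)%N
    & Vpts (fun f => exists2 a, a \in B & tblock a f) p.

End CompatibleA1.

(* continuant z n = P_n(z_1, ..., z_n) *)
Fixpoint continuant (R : nzRingType) (z : nat -> R) (n : nat) : R :=
  match n with
  | 0 => 1
  | n1.+1 => match n1 with
             | 0 => z 1%N
             | n2.+1 => z n * continuant z n1 - continuant z n2
             end
  end.

(* A closed point of Spec K[c^{+-1}], given by its residue field and the values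
   c_0 = pt_c0 and c_i^(a) = pt_c a i, 1 <= i <= l a, there; by pt_gen the ring
   morphism from K[c^{+-1}] to the residue field is surjective. *)
Record closed_point (K : fieldType) (m : nat) (l : 'I_m -> nat) := ClosedPoint {
  residue : fieldType;
  pt_emb : {rmorphism K -> residue};
  pt_c0 : residue;
  pt_c : 'I_m -> nat -> residue;
  pt_c0_neq0 : pt_c0 != 0;
  pt_c_neq0 : forall a i, (1 <= i <= l a)%N -> pt_c a i != 0;
  pt_gen : forall S : residue -> Prop,
    (forall x, S (pt_emb x)) -> S pt_c0 -> S pt_c0^-1 ->
    (forall a i, (1 <= i <= l a)%N -> S (pt_c a i) /\ S (pt_c a i)^-1) ->
    (forall x y, S x -> S y -> S (x + y)) ->
    (forall x y, S x -> S y -> S (x * y)) ->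
    forall x, S x
}.

Section Fiber.
Variables (K : fieldType) (m : nat) (l : 'I_m -> nat) (eta : closed_point K l).
Local Notation kappa := (residue eta).

(* rev_rho a j is the value of rho_i^(a) for i = l a + 1 - j. *)
Fixpoint rev_rho (a : 'I_m) (j : nat) : kappa :=
  match j with
  | 0 => 1
  | j1.+1 => match j1 with
             | 0 => pt_c eta a (l a)
             | j2.+1 => pt_c eta a ((l a).+1 - j) * rev_rho a j2
             end
  end.

Definition rho (a : 'I_m) (i : nat) : kappa := rev_rho a ((l a).+1 - i).

Definition lambda (a : 'I_m) : kappa := (rho a 1)^-1.
Definition mu : kappa := (pt_c0 eta)^-1 * (\prod_(a < m) rho a 2)^-1.

(* The coordinates z_1^(a), ..., z_{l a + 1}^(a), u, w. *)
Definition star_coord := ({a : 'I_m & 'I_(l a).+1} + bool)%type.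

Local Notation P := (polyring kappa star_coord).

Definition zvar (a : 'I_m) (i : nat) : P :=
  var kappa (inl (existT _ a (inord i.-1)) : star_coord).
Definition uvar : P := var kappa (inr false : star_coord).
Definition wvar : P := var kappa (inr true : star_coord).

Definition Feq (a : 'I_m) : P := continuant (zvar a) (l a).+1 - (lambda a)%:MP * uvar.
Definition Geq : P := uvar * wvar - \prod_(a < m) continuant (zvar a) (l a) - mu%:MP.

Definition X (f : P) : Prop := (exists a, f = Feq a) \/ f = Geq.

(* k_a, for l a = 2 k_a - 1. *)
Definition halfk (a : 'I_m) : nat := (l a).+1./2.

Definition compatible (a b : 'I_m) : bool :=
  (a == b) || [&& odd (l a), odd (l b)
                & lambda a * (-1) ^+ halfk a == lambda b * (-1) ^+ halfk b].

Definition Iset (a : 'I_m) : {set 'I_m} := [set b | compatible a b].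

Definition sigma (a : 'I_m) : 'I_m := [arg min_(b < a in Iset a) (b : nat)].

(* {alpha_1, ..., alpha_s} *)
Definition alphas : {set 'I_m} := [set sigma a | a : 'I_m & (2 <= #|Iset a|)%N].

Definition zblock (a : 'I_m) (f : P) : Prop :=
  exists2 i, (1 <= i <= (l a).+1)%N & f = zvar a i.

Definition C_eqs (a b : 'I_m) (f : P) : Prop :=
  let e := (-1) ^+ halfk a : kappa in
  zblock a f \/ zblock b f \/
  f = uvar - (e * (lambda a)^-1)%:MP \/
  f = wvar - (e * lambda a * mu)%:MP \/
  exists2 c, (c != a) && (c != b)
    & f = continuant (zvar c) (l c).+1 - (e * lambda c * (lambda a)^-1)%:MP.

Definition Cpair (a b : 'I_m) : locus kappa star_coord := Vpts (C_eqs a b).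

Definition Cunion (ai : 'I_m) : locus kappa star_coord := fun p =>
  exists a b, [/\ a \in Iset ai, b \in Iset ai, a != b & Cpair a b p].

End Fiber.

Arguments cylinder {k T} d E f.
Arguments cylinder_locus {k T} d L _.
Arguments Cunion {K m l} eta ai _.
Arguments Cpair {K m l} eta a b _.
Arguments C_eqs {K m l} eta a b f.
Arguments X {K m l} eta f.
Arguments zvar {K m l} eta a i.
Arguments zblock {K m l} eta a f.
Arguments cA1_eqs k {A} q f.
Arguments tblock k {A} q a f.
Arguments cA1_Y k {A} q j p.
Arguments origin k T f : clear implicits.

(* Main.v *)
(* The continuants satisfy (-1)^k P_2k = 1 + sum_(j < k) a_j b_j with
   a_j = z_(2j+2) and b_j = (-1)^(j+1) P_(2j+1); (a, b) are coordinates wherever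
   the P_2j, j < k, are invertible, in particular near z = 0.

   If all l_a are even, F_a = 0 is solved for z_1^(a), and Euler's identity for
   continuants turns G = 0 into u w' = 1 - prod_a (1 + g_a), where g_a is a split
   quadratic form in the remaining z^(a).  The right-hand side telescopes into
   - sum_a g_a prod_(b < a) (1 + g_b); absorbing the units into the coordinates,
   X is near the origin a split quadratic cone.  The cone is singular exactly at
   its vertex since prime ideals in polynomial rings have regular local rings and
   the equation of the cone lies in the square of the maximal ideal of the vertex.

   Near a point of C, u is invertible, so G = 0 is solved for w.  For a compatible
   block F_a = 0 reads 1 + g_a = c u with c independent of a, while the
   continuant of an incompatible block is smooth at the point, so one coordinate of
   that block is eliminated; what remains is g_a = g_b.

   Isomorphisms are described by natural bijections on points with values in
   arbitrary nonzero rings. *)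

Require Import Defs.
From HB Require Import structures.
From mathcomp Require Import all_boot all_algebra.
From mathcomp Require Import generic_quotient boolp ring.
From mathcomp Require Import mpoly.
Import GRing.Theory.
Local Open Scope ring_scope.
Set Implicit Arguments.
Unset Strict Implicit.
Unset Printing Implicit Defensive.

(** On points a chart is a pair of rational substitutions, so that being mutually inverse is a ring
    identity; the isomorphism of localizations is obtained by evaluating at the universal points,
    and loci cut out by coordinates are compared after reducing the universal point modulo a prime.

    What shapes the second claim is that a chart is needed around every point of C, non-closed ones
    included, while only two compatible blocks are known to vanish there. A further compatible block
    may lie where some P_2j is zero, outside the domain of (a, b). The way out is that P_2q has no
    critical point except z = 0: at a nonzero block some partial derivative is invertible, P_2q
    itself becomes a coordinate, and a split form is made to take the value (-1)^q P_2q - 1 by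
    solving for the partner of an invertible slot. Both kinds of chart give the same normal form, so
    they can be mixed block by block.

    The first claim needs no such choice, but P_l of the shifted block has to be a unit as well,
    because it is the slope of F_a in z_1. *)

Local Notation frac := Defs.frac.
(** * Localizations and points *)

Section Invertible.
Variable S : comPzRingType.
Implicit Types x y : S.

Definition invertible x := exists y, x * y = 1.

(** Total, with value 0 at non-invertible elements, so that a chart is a plain function on all
    tuples and invertibility is a side condition. *)
Definition cinv x : S :=
  if pselect (invertible x) is left H then sval (cid H) else 0.

Lemma mulrcV x : invertible x -> x * cinv x = 1.
Proof. by move=> H; rewrite /cinv; case: pselect => // H'; case: cid. Qed.

Lemma mulVcr x : invertible x -> cinv x * x = 1.
Proof. by rewrite mulrC; apply: mulrcV. Qed.

Lemma mulcI x : invertible x -> injective ( *%R x).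
Proof. by move=> /mulVcr Hx y z E; rewrite -[y]mul1r -[z]mul1r -Hx -!mulrA E. Qed.

Lemma cinv_uniq x y : x * y = 1 -> cinv x = y.
Proof.
move=> H; have Ix : invertible x by exists y.
by apply: (mulcI Ix); rewrite mulrcV.
Qed.

Lemma invertible1 : invertible 1. Proof. by exists 1; rewrite mulr1. Qed.

Lemma invertibleM x y : invertible (x * y) <-> invertible x /\ invertible y.
Proof.
split=> [[z H]|[[a Ha] [b Hb]]].
  by split; [exists (y * z); rewrite mulrA | exists (x * z); rewrite mulrCA mulrA].
by exists (a * b); rewrite mulrACA Ha Hb mulr1.
Qed.

Lemma invertible_sign n : invertible ((-1) ^+ n).
Proof. by exists ((-1) ^+ n); rewrite -expr2 sqrr_sign. Qed.

Lemma invertible_prod (I : Type) (r : seq I) (P : pred I) (F : I -> S) :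
  (forall i, P i -> invertible (F i)) -> invertible (\prod_(i <- r | P i) F i).
Proof.
move=> H; apply: big_ind => //; first exact: invertible1.
by move=> x y Hx Hy; apply/invertibleM.
Qed.

Lemma invertible_prodP (I : finType) (F : I -> S) :
  invertible (\prod_i F i) <-> forall i, invertible (F i).
Proof.
split=> [H i|H]; last exact: invertible_prod.
by move: H; rewrite (bigD1 i) //= => /invertibleM[].
Qed.

End Invertible.

Section InvertibleMorph.
Variables (R S : comPzRingType) (f : {rmorphism R -> S}).

Lemma invertible_morph x : invertible x -> invertible (f x).
Proof. by case=> y H; exists (f y); rewrite -rmorphM H rmorph1. Qed.

Lemma cinv_morph x : invertible x -> f (cinv x) = cinv (f x).
Proof. by move=> H; rewrite (@cinv_uniq _ (f x) (f (cinv x))) // -rmorphM mulrcV // rmorph1. Qed.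

End InvertibleMorph.

Section LocUniversal.
Variables (R : comPzRingType) (E D : R -> Prop).

Lemma ideal_gen_min (J : R -> Prop) :
  is_ideal J -> (forall x, E x -> J x) -> forall x, ideal_gen E x -> J x.
Proof.
move=> [J0 JD JM] EJ _ [n [a [g [Eg ->]]]].
by apply: big_ind => // i _; apply/JM/EJ.
Qed.

Lemma monoid_gen_sub s : D s -> monoid_gen D s.
Proof. by move=> Ds; rewrite -[s]mulr1; constructor=> //; constructor. Qed.

Lemma monoid_gen_invertible (S : comPzRingType) (f : {rmorphism R -> S}) :
  (forall s, D s -> invertible (f s)) ->
  forall s, monoid_gen D s -> invertible (f s).
Proof.
move=> H s; elim=> [|a b Da _ IH]; first by rewrite rmorph1; apply: invertible1.
by rewrite rmorphM; apply/invertibleM; split=> //; apply: H.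
Qed.

Lemma to_loc_inv s (Ms : monoid_gen D s) :
  to_loc E D s * frac E 1 (mkden Ms) = 1.
Proof. by rewrite fracM -frac1; apply: frac_eq => /=; ring. Qed.

Lemma to_loc_invertible s : monoid_gen D s -> invertible (to_loc E D s).
Proof. by move=> Ms; exists (frac E 1 (mkden Ms)); apply: to_loc_inv. Qed.

Lemma frac_mul_den a (s : den D) : frac E a s * to_loc E D (sval s) = to_loc E D a.
Proof. by rewrite fracM; apply: frac_eq => /=; ring. Qed.

Lemma to_loc_eq0 a :
  to_loc E D a = 0 <-> exists2 s, monoid_gen D s & ideal_gen E (s * a).
Proof.
rewrite -frac0 fracP /=; split=> -[s Ms]; rewrite ?mul0r ?subr0 ?mulr1;
  by exists s => //; rewrite mul0r subr0 mulr1.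
Qed.

Lemma to_loc0 a : E a -> to_loc E D a = 0.
Proof.
move=> Ea; apply/to_loc_eq0; exists 1; first by constructor.
by rewrite mul1r; apply: ideal_gen_sub.
Qed.

Lemma loc_morph_ext (S : comPzRingType) (F G : {rmorphism loc E D -> S}) :
  (forall a, F (to_loc E D a) = G (to_loc E D a)) -> F =1 G.
Proof.
move=> H x; have [a [s ->]] := frac_surj x.
have Ms := denP s.
have Is := invertible_morph F (to_loc_invertible Ms).
apply: (mulcI Is); rewrite mulrC -rmorphM frac_mul_den {1}H.
by rewrite H mulrC -rmorphM frac_mul_den.
Qed.

(** Universal property of the localized quotient. The lift divides the images of the two components
    of a chosen representative, and [repr_frac] shows that the choice does not matter. *)
Lemma loc_lift (S : comPzRingType) (f : {rmorphism R -> S}) :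
  (forall x, E x -> f x = 0) -> (forall s, D s -> invertible (f s)) ->
  exists F : {rmorphism loc E D -> S}, forall a, F (to_loc E D a) = f a.
Proof.
move=> fE fD; have fM := monoid_gen_invertible fD.
have fI x : ideal_gen E x -> f x = 0.
  apply: (@ideal_gen_min (fun x => f x = 0)) => //; split=> [|a b Ha Hb|a b Hb].
  - exact: rmorph0.
  - by rewrite rmorphD Ha Hb addr0.
  - by rewrite rmorphM Hb mulr0.
pose F (x : loc E D) : S := f (repr x).1 * cinv (f (sval (repr x).2)).
have FE a s : F (frac E a s) = f a * cinv (f (sval s)).
  have [r Mr /fI] := repr_frac E a s; rewrite rmorphM rmorphB !rmorphM /F.
  set y := repr _ => H.
  have : f r * (f y.1 * f (sval s) - f a * f (sval y.2)) = f r * 0 by rewrite mulr0.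
  move=> /(mulcI (fM _ Mr))/eqP; rewrite subr_eq0 => /eqP e.
  apply: (mulcI (fM _ (denP s))); apply: (mulcI (fM _ (denP y.2))).
  have e1 := mulrcV (fM _ (denP s)); have e2 := mulrcV (fM _ (denP y.2)).
  transitivity (f y.1 * f (sval s) * (f (sval y.2) * cinv (f (sval y.2)))); first by ring.
  by rewrite e e2 -e1; ring.
have FB : zmod_morphism F.
  move=> x y; have [a [s ->]] := frac_surj x; have [b [t ->]] := frac_surj y.
  rewrite fracN fracD !FE /=.
  have e1 := mulrcV (fM _ (denP s)); have e2 := mulrcV (fM _ (denP t)).
  rewrite rmorphM (@cinv_uniq _ _ (cinv (f (sval s)) * cinv (f (sval t)))); last first.
    by rewrite mulrACA e1 e2 mulr1.
  rewrite rmorphD !rmorphM rmorphN -[X in X - _]mulr1 -{1}e2.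
  by rewrite -[X in _ - X]mulr1 -{1}e1; ring.
have FM : monoid_morphism F.
  split; first by rewrite -frac1 FE /= rmorph1 mul1r (@cinv_uniq _ _ 1) ?mulr1.
  move=> x y; have [a [s ->]] := frac_surj x; have [b [t ->]] := frac_surj y.
  rewrite fracM !FE /= !rmorphM.
  have e1 := mulrcV (fM _ (denP s)); have e2 := mulrcV (fM _ (denP t)).
  rewrite (@cinv_uniq _ _ (cinv (f (sval s)) * cinv (f (sval t)))).
    by rewrite mulrACA.
  by rewrite mulrACA e1 e2 mulr1.
pose aF := GRing.isZmodMorphism.Build _ _ F FB.
pose mF := GRing.isMonoidMorphism.Build _ _ F FM.
pose FF : {rmorphism loc E D -> S} := HB.pack F aF mF.
exists FF => a; rewrite /FF /= FE /= rmorph1 (@cinv_uniq _ _ 1) ?mulr1 //.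
Qed.

End LocUniversal.

Section NzOf.
Variables (R : comPzRingType) (R1 : (1 : R) != 0).
(** Nontriviality of a localization is a fact proved from a prime, not part of its type; it is
    attached here to the unchanged carrier so that the localization can serve as a ring of
    values. *)
Definition to_nz : comNzRingType :=
  HB.pack_for comNzRingType R (GRing.PzSemiRing_isNonZero.Build R R1).
End NzOf.

Section Ev.
Variables (k : fieldType) (T : finType).

Section Def.
Variables (S : comNzRingType) (i : {rmorphism k -> S}) (x : T -> S).

Definition ev (f : polyring k T) : S := mmap i (fun j => x (enum_val j)) f.

Lemma ev_is_zmod_morphism : zmod_morphism ev. Proof. exact: rmorphB. Qed.

Lemma ev_is_monoid_morphism : monoid_morphism ev.
Proof. by split=> [|f g]; [exact: rmorph1 | exact: rmorphM]. Qed.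

HB.instance Definition _ :=
  GRing.isZmodMorphism.Build (polyring k T) S ev ev_is_zmod_morphism.
HB.instance Definition _ :=
  GRing.isMonoidMorphism.Build (polyring k T) S ev ev_is_monoid_morphism.

Lemma evC a : ev a%:MP = i a. Proof. exact: mmapC. Qed.

Lemma ev_var t : ev (var k t) = x t.
Proof. by rewrite /ev /var mmapX mmap1U enum_rankK. Qed.

End Def.

Lemma poly_morphE (S : comNzRingType) (g : {rmorphism polyring k T -> S})
    (i : {rmorphism k -> S}) :
  (forall a, g a%:MP = i a) -> forall f, g f = ev i (fun t => g (var k t)) f.
Proof.
move=> gi f; rewrite {1}[f]mpolyE rmorph_sum /= /ev /mmap; apply: eq_bigr => m _.
rewrite -mul_mpolyC rmorphM gi; congr (_ * _).
rewrite mpolyXE_id rmorph_prod /mmap1; apply: eq_bigr => j _.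
by rewrite rmorphXn /var enum_valK.
Qed.

Lemma ev_morph (S S' : comNzRingType) (f : {rmorphism S -> S'})
    (i : {rmorphism k -> S}) (i' : {rmorphism k -> S'}) (x : T -> S) p :
  (forall a, i' a = f (i a)) -> f (ev i x p) = ev i' (fun t => f (x t)) p.
Proof.
move=> fi.
have := @poly_morphE S' (f \o ev i x)%FUN i' _ p; rewrite /= => ->.
  by congr (ev _ _ p); apply: functional_extensionality_dep => t; rewrite ev_var.
by move=> a; rewrite evC fi.
Qed.

End Ev.

(** * Primes of a localization *)

Section PrimeLoc.
Variables (R : comPzRingType) (E D p : R -> Prop).
Hypotheses (pp : is_prime p) (Ep : forall f, E f -> p f)
  (Dp : forall s, D s -> ~ p s).

Lemma monoid_gen_notin s : monoid_gen D s -> ~ p s.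
Proof.
case: pp => _ p1 pM; elim=> // a b Da _ IH.
by case/pM => //; apply: Dp.
Qed.

Lemma ideal_gen_in x : ideal_gen E x -> p x.
Proof. by apply: ideal_gen_min => //; case: pp. Qed.

(** Denominators, and the factor killing a difference of fractions, lie outside p, and primality
    cancels them. *)
Lemma extension_frac a s : extension p (frac E a s : loc E D) <-> p a.
Proof.
case: (pp) => -[p0 pD pMl] p1 pM; split=> [|pa]; last by exists a, s.
case=> b [t [pb /fracP[r Mr /ideal_gen_in]]].
case/pM => [/(monoid_gen_notin Mr)//|H].
have : p (a * sval t).
  by have := pD _ _ H (pMl (sval s) _ pb); congr (p _); ring.
by case/pM => // /(monoid_gen_notin (denP t)).
Qed.

Lemma extension_to_loc a : extension p (to_loc E D a) <-> p a.
Proof. exact: extension_frac. Qed.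

Lemma extension_prime : is_prime (extension p : loc E D -> Prop).
Proof.
case: (pp) => -[p0 pD pMl] p1 pM; split; first split.
- by rewrite -frac0 extension_frac.
- move=> x y; have [a [s ->]] := frac_surj x; have [b [t ->]] := frac_surj y.
  rewrite fracD !extension_frac => pa pb.
  by apply: pD; rewrite mulrC; apply: pMl.
- move=> x y; have [a [s ->]] := frac_surj x; have [b [t ->]] := frac_surj y.
  by rewrite fracM !extension_frac => /pMl.
- by rewrite -frac1 extension_frac.
move=> x y; have [a [s ->]] := frac_surj x; have [b [t ->]] := frac_surj y.
by rewrite fracM !extension_frac => /pM.
Qed.

Lemma loc_neq0 : (1 : loc E D) != 0.
Proof.
apply/eqP => /esym; rewrite -frac1 => H.
have : extension p (frac E 1 (den1 D) : loc E D) by rewrite -H -frac0 extension_frac; case: pp => -[].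
by rewrite extension_frac; case: pp.
Qed.

End PrimeLoc.

Lemma is_prime_invertible (R : comPzRingType) (p : R -> Prop) x :
  is_prime p -> invertible x -> ~ p x.
Proof. by case=> -[_ _ pM] p1 _ [y H] px; apply: p1; rewrite -H mulrC; apply: pM. Qed.

Lemma is_prime_preim (R S : comPzRingType) (f : {rmorphism R -> S}) (p : S -> Prop) :
  is_prime p -> is_prime (fun x => p (f x)).
Proof.
case=> -[p0 pD pM] p1 pI; split; first split.
- by rewrite rmorph0.
- by move=> x y; rewrite rmorphD; apply: pD.
- by move=> x y; rewrite rmorphM; apply: pM.
- by rewrite rmorph1.
by move=> x y; rewrite rmorphM; apply: pI.
Qed.

Section ConstMorph.
Variables (k : fieldType) (T : finType) (E D : polyring k T -> Prop).
Definition loc_const (a : k) : loc E D := to_loc E D a%:MP.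

Lemma loc_const_is_zmod_morphism : zmod_morphism loc_const.
Proof. by move=> a b; rewrite /loc_const !rmorphB. Qed.

Lemma loc_const_is_monoid_morphism : monoid_morphism loc_const.
Proof. by split=> [|a b]; rewrite /loc_const ?rmorph1 ?rmorphM. Qed.

HB.instance Definition _ :=
  GRing.isZmodMorphism.Build k (loc E D) loc_const loc_const_is_zmod_morphism.
HB.instance Definition _ :=
  GRing.isMonoidMorphism.Build k (loc E D) loc_const loc_const_is_monoid_morphism.

Lemma loc_morph_ext_var (S : comNzRingType) (F G : {rmorphism loc E D -> S})
    (i : {rmorphism k -> S}) :
  (forall a, F (loc_const a) = i a) -> (forall a, G (loc_const a) = i a) ->
  (forall t, F (to_loc E D (var k t)) = G (to_loc E D (var k t))) -> F =1 G.
Proof.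
move=> HF HG H; apply: loc_morph_ext => a.
have /= -> := @poly_morphE k T S (F \o to_loc E D)%FUN i HF a.
have /= -> := @poly_morphE k T S (G \o to_loc E D)%FUN i HG a.
by congr (ev _ _ a); apply: functional_extensionality_dep => t; apply: H.
Qed.

End ConstMorph.

(** * Functors of points and isomorphisms of basic open sets *)

Section FunctorOfPoints.
Variable k : fieldType.

Definition functor (T : finType) :=
  forall S : comNzRingType, {rmorphism k -> S} -> (T -> S) -> Prop.

Definition points (T : finType) (E : polyring k T -> Prop) h : functor T :=
  fun S i x => (forall f, E f -> ev i x f = 0) /\ invertible (ev i x h).

(** Naturality is asked of [fw] only: the inverse of a natural bijection is natural. *)
Record functor_iso (T T' : finType) (P : functor T) (P' : functor T') := FunctorIso {
  fw : forall S : comNzRingType, {rmorphism k -> S} -> (T -> S) -> T' -> S;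
  bw : forall S : comNzRingType, {rmorphism k -> S} -> (T' -> S) -> T -> S;
  fw_pt : forall S i x, P S i x -> P' S i (fw i x);
  bw_pt : forall S i x, P' S i x -> P S i (bw i x);
  fwK : forall S i x, P S i x -> bw i (fw i x) = x;
  bwK : forall S i x, P' S i x -> fw i (bw i x) = x;
  fw_nat : forall (S S' : comNzRingType) (f : {rmorphism S -> S'})
    (i : {rmorphism k -> S}) (i' : {rmorphism k -> S'}) x,
    (forall a, i' a = f (i a)) -> P S i x ->
    fw i' (fun t => f (x t)) = fun t => f (fw i x t)
}.

Lemma points_morph (T : finType) (E : polyring k T -> Prop) h
   (S S' : comNzRingType) (f : {rmorphism S -> S'})
    (i : {rmorphism k -> S}) (i' : {rmorphism k -> S'}) x :
    (forall a, i' a = f (i a)) -> points E h i x -> points E h i' (fun t => f (x t)).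
Proof.
move=> fi [H0 H1]; split=> [g Eg|]; rewrite -(ev_morph _ _ fi).
  by rewrite H0 // rmorph0.
exact: invertible_morph.
Qed.

Section PointsLoc.
Variables (T : finType) (E : polyring k T -> Prop) (h : polyring k T).
Hypothesis B1 : (1 : loc E (eq h)) != 0.

Definition nz_const : {rmorphism k -> to_nz B1} :=
  (@loc_const k T E (eq h) : {rmorphism k -> loc E (eq h)}).
Definition nz_loc : {rmorphism polyring k T -> to_nz B1} :=
  (@to_loc _ E (eq h) : {rmorphism _ -> loc E (eq h)}).

(** The universal point: the classes of the variables in the coordinate ring of the open set D(h) of
    V(E). *)
Lemma points_loc : points E h nz_const (fun t => nz_loc (var k t)).
Proof.
have H f : ev nz_const (fun t => nz_loc (var k t)) f = nz_loc f.
  by rewrite -(@poly_morphE _ _ _ nz_loc).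
split=> [f Ef|]; rewrite H; first exact: to_loc0.
by apply: to_loc_invertible; apply: monoid_gen_sub.
Qed.

End PointsLoc.

Lemma monoid_gen_False (R : comPzRingType) (s : R) : monoid_gen (fun=> False) s -> s = 1.
Proof. by case. Qed.

Lemma quot_eq0 (R : comPzRingType) (p : R -> Prop) a :
  is_prime p -> (to_loc p (fun=> False) a = 0 <-> p a).
Proof.
move=> pp; rewrite to_loc_eq0; split=> [[s /monoid_gen_False-> ]|pa].
  by rewrite mul1r; apply: ideal_gen_in.
by exists 1; [constructor | rewrite mul1r; apply: ideal_gen_sub].
Qed.

Section LocalIso.
Variables (T T' : finType) (E : polyring k T -> Prop) (E' : polyring k T' -> Prop).
Variables (h : polyring k T) (h' : polyring k T').
Variable F : functor_iso (points E h) (points E' h').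

Section ComorphInverse.
Variables (B1 : (1 : loc E (eq h)) != 0) (B1' : (1 : loc E' (eq h')) != 0).
Local Notation B := (to_nz B1).
Local Notation B' := (to_nz B1').
Local Notation iB := (nz_const B1).
Local Notation iB' := (nz_const B1').
Local Notation xB := (fun t => nz_loc B1 (var k t)).
Local Notation xB' := (fun t => nz_loc B1' (var k t)).
Variables (psi : {rmorphism loc E' (eq h') -> B}) (phi : {rmorphism loc E (eq h) -> B'}).
Hypothesis psiE : forall a, psi (to_loc E' (eq h') a) = ev iB (fw F iB xB) a.
Hypothesis phiE : forall a, phi (to_loc E (eq h) a) = ev iB' (bw F iB' xB') a.

Lemma comorph_fwE t : psi (to_loc E' (eq h') (var k t)) = fw F iB xB t.
Proof. by rewrite psiE ev_var. Qed.

Lemma comorph_psi_const a : psi (loc_const E' (eq h') a) = iB a.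
Proof. by rewrite /loc_const psiE evC. Qed.

Lemma comorph_phi_const a : phi (loc_const E (eq h) a) = iB' a.
Proof. by rewrite /loc_const phiE evC. Qed.

Lemma comorph_psiK : cancel psi phi.
Proof.
pose phi' : {rmorphism B -> B'} := phi; pose psi' : {rmorphism B' -> B} := psi.
have H := @loc_morph_ext_var k T' E' (eq h') B' (phi' \o psi')%FUN idfun iB'.
apply: H => [a|//|t] /=.
  by rewrite /psi' comorph_psi_const /phi' comorph_phi_const.
rewrite /psi' comorph_fwE.
have ii a : iB' a = phi' (iB a) by rewrite -comorph_phi_const.
(* Naturality moves phi inside [fw], where it turns one universal point into [bw] of the other. *)
have := fw_nat F ii (points_loc B1) => /(congr1 (fun f => f t)) <-.
have -> : (fun t => phi' (xB t)) = bw F iB' xB'.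
  by apply: functional_extensionality_dep => s; rewrite [LHS]phiE ev_var.
by rewrite bwK //; apply: points_loc.
Qed.

Lemma comorph_phiK : cancel phi psi.
Proof.
pose phi' : {rmorphism B -> B'} := phi; pose psi' : {rmorphism B' -> B} := psi.
have H := @loc_morph_ext_var k T E (eq h) B (psi' \o phi')%FUN idfun iB.
apply: H => [a|//|t] /=.
  by rewrite /phi' comorph_phi_const /psi' comorph_psi_const.
rewrite /phi' phiE ev_var.
have ii a : iB a = psi' (iB' a) by rewrite -comorph_psi_const.
have Pb := bw_pt F (points_loc B1').
have Pb' := points_morph ii Pb.
(* Only [fw] commutes with ring morphisms by assumption, so [bw] after [fw] is inserted before psi
   is moved across. *)
have e1 : (fun t => psi' (bw F iB' xB' t)) = bw F iB (fw F iB (fun t => psi' (bw F iB' xB' t))).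
  by rewrite fwK.
apply: (etrans (congr1 (fun f => f t) e1)).
rewrite (fw_nat F ii Pb) bwK; last exact: points_loc.
have -> : (fun t => psi' (xB' t)) = fw F iB xB.
  by apply: functional_extensionality_dep => s; rewrite [LHS]comorph_fwE.
exact: (congr1 (fun f => f t) (fwK F (points_loc B1))).
Qed.

End ComorphInverse.

(* Yoneda: the isomorphism of the coordinate rings is read off their universal points. *)
Theorem functor_iso_local_iso p : Vpts E p -> ~ p h ->
  exists p' (e : local_iso E p E' p'), [/\ src e = h, tgt e = h' &
    forall (U : T -> Prop) (U' : T' -> Prop),
    (forall (S : comNzRingType) (i : {rmorphism k -> S}) x, points E h i x ->
       (forall t, U t -> x t = 0) <-> (forall t, U' t -> fw F i x t = 0)) ->
    forall r r', Vpts E r -> ~ r (src e) -> Vpts E' r' -> ~ r' (tgt e) ->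
    (forall x, extension r x <-> extension r' (comorph e x)) ->
    (forall t, U t -> r (var k t)) <-> (forall t, U' t -> r' (var k t))].
Proof.
move=> [pp Ep] ph.
have neq (q : polyring k T -> Prop) : ~ q h -> forall s, h = s -> ~ q s by move=> H s <-.
have Dp := neq p ph.
have B1 := loc_neq0 pp Ep Dp.
have [P1 P2] := fw_pt F (points_loc B1).
have [|psi psiE] := loc_lift P1 (D := eq h'); first by move=> _ <-.
(* A trivial target ring would force 1 = 0 in the source, through psi. *)
have B1' : (1 : loc E' (eq h')) != 0.
  apply/eqP => H; case/eqP: (B1).
  rewrite -[LHS](rmorph1 psi) H; exact: rmorph0.
have [Q1 Q2] := bw_pt F (points_loc B1').
have [|phi phiE] := loc_lift Q1 (D := eq h); first by move=> _ <-.
pose phi0 : {rmorphism loc E (eq h) -> loc E' (eq h')} := phi.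
pose psi0 : {rmorphism loc E' (eq h') -> loc E (eq h)} := psi.
have phiK : cancel phi0 psi0 := comorph_phiK psiE phiE.
have psiK : cancel psi0 phi0 := comorph_psiK psiE phiE.
have xp := extension_prime pp Ep Dp.
pose p' f := extension p (psi0 (to_loc E' (eq h') f)).
have pp' : is_prime p' by exact: (is_prime_preim (psi0 \o to_loc E' (eq h'))%FUN xp).
have Ep' f : E' f -> p' f.
  by move=> /(to_loc0 (eq h')) H; rewrite /p' H rmorph0; case: xp => -[].
have ph' : ~ p' h'.
  apply: (is_prime_invertible (p := extension p : loc E (eq h) -> Prop)) => //.
  exact/invertible_morph/to_loc_invertible/monoid_gen_sub.
have Dp' s : h' = s -> ~ p' s by move=> <-.
have pt x : extension p x <-> extension p' (phi0 x).
  have [b [t e]] := frac_surj (phi0 x).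
  rewrite e (extension_frac pp' Ep' Dp') -[x]phiK e /p' -(frac_mul_den E' b t) rmorphM.
  case: (xp) => -[_ _ xM] x1 xI; split; first by rewrite mulrC; apply: xM.
  case/xI => // H; case: (is_prime_invertible xp _ H).
  exact/invertible_morph/to_loc_invertible/denP.
have cst a : phi0 (to_loc _ _ a%:MP) = to_loc _ _ a%:MP.
  exact: (comorph_phi_const phiE a).
pose e := @LocalIso k T T' E p E' p' h h' phi0 (conj (conj pp Ep) ph)
  (conj (conj pp' Ep') ph') (Bijective phiK psiK) cst pt.
exists p', e; split=> // U U' HU r r' [pr Er] rh [pr' Er'] rh' rr'.
have xr := extension_prime pr Er (neq r rh).
(* The hypothesis on U and U' is applied to the universal point reduced modulo r: there a coordinate
   vanishes exactly when its variable lies in r, and a coordinate of its image exactly when the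
   corresponding variable lies in r'. *)
have Q3 := @loc_neq0 _ _ (fun=> False) _ xr (fun=> id) (fun=> False_ind _).
pose f : {rmorphism to_nz B1 -> to_nz Q3} := 
  (@to_loc (loc E (eq h)) _ _ : {rmorphism loc E (eq h) -> quot (extension r)}).
pose i : {rmorphism k -> to_nz Q3} := (f \o nz_const B1)%FUN.
have ii a : i a = f (nz_const B1 a) by [].
have := HU _ _ _ (points_morph ii (points_loc B1)).
rewrite (fw_nat F ii (points_loc B1)) => {}HU.
have f0 x : f x = 0 <-> extension r x by apply: quot_eq0.
have fU t : f (nz_loc B1 (var k t)) = 0 <-> r (var k t).
  by rewrite f0 (extension_to_loc pr Er (neq r rh)).
have fU' t : f (fw F (nz_const B1) (fun t => nz_loc B1 (var k t)) t) = 0 <-> r' (var k t).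
  have neq' s : h' = s -> ~ r' s by move=> <-.
  rewrite f0 -(comorph_fwE psiE) rr' -[comorph e _]/(phi0 (psi0 _)) psiK.
  by rewrite (extension_to_loc pr' Er' neq').
by split=> [H t Ut|H t Ut]; [apply/fU'; apply HU => // s Us; apply/fU; apply: H |
  apply/fU; apply HU => // s Us; apply/fU'; apply: H].
Qed.

End LocalIso.
End FunctorOfPoints.

(** * Dimension of polynomial rings *)

Section FieldOf.
Variables (R : comPzRingType) (R1 : (1 : R) != 0).
Hypothesis RV : forall x : R, x != 0 -> invertible x.

Let RN := to_nz R1.

Lemma field_of_mulVf (x : RN) : x != 0 -> (cinv x : RN) * x = 1.
Proof. by move=> /RV; apply: mulVcr. Qed.

Lemma field_of_inv0 : cinv (0 : RN) = 0.
Proof.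
rewrite /cinv; case: pselect => // H; exfalso.
by case: H => y; rewrite mul0r => /esym/eqP; rewrite (negPf R1).
Qed.

Definition field_of : fieldType :=
  HB.pack_for fieldType RN (GRing.ComNzRing_isField.Build RN field_of_mulVf field_of_inv0).

End FieldOf.

(** The residue field of q. Membership in a prime becomes an equation in a field, so that a prime
    can be handled as a field-valued point. *)
Lemma prime_field_point (R : comPzRingType) (q : R -> Prop) :
  is_prime q -> exists (L : fieldType) (g : {rmorphism R -> L}), forall f, g f = 0 <-> q f.
Proof.
move=> pq; pose D f := ~ q f.
have L1 : (1 : loc q D) != 0 by apply: loc_neq0 pq _ _.
have LV (x : loc q D) : x != 0 -> invertible x.
  have [a [s ->]] := frac_surj x => nz.
  have qa : ~ q a.
    move=> qa; case/eqP: nz; rewrite -frac0; apply/fracP; exists 1; first by constructor.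
    rewrite /= mul1r mul0r subr0 mulr1; exact: ideal_gen_sub.
  exists (frac q (sval s) (mkden (monoid_gen_sub (D := D) qa))).
  by rewrite fracM -frac1; apply: frac_eq => /=; ring.
pose g : {rmorphism R -> field_of L1 LV} := (@to_loc R q D : {rmorphism R -> loc q D}).
exists (field_of L1 LV), g => f; rewrite [g f]/(to_loc q D f) to_loc_eq0.
split=> [[s Ms /(ideal_gen_in pq (fun _ => id))]|qf].
  by case: (pq) => _ _ pM /pM[] // /(monoid_gen_notin pq (fun _ => id) Ms).
by exists 1; [constructor | rewrite mul1r; apply: ideal_gen_sub].
Qed.

(** * Algebraic independence of variables modulo a prime *)

Section Restriction.
Variables (k : fieldType) (T : finType).
Local Notation P := (polyring k T).
Implicit Types (J V : {set T}) (f : P).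

(** The subring k[x_t | t in V] is represented by a retraction of the whole ring: [restr V f = f]
    says that f involves no variable outside V, and no change of ring is needed. *)
Definition restr V (f : P) : P :=
  ev (@mpolyC #|{: T}| k) (fun t => if t \in V then var k t else 0) f.

Lemma restr_is_zmod_morphism V : zmod_morphism (restr V).
Proof. exact: rmorphB. Qed.

Lemma restr_is_monoid_morphism V : monoid_morphism (restr V).
Proof. by split=> [|f g]; [exact: rmorph1 | exact: rmorphM]. Qed.

HB.instance Definition _ V :=
  GRing.isZmodMorphism.Build P P (restr V) (restr_is_zmod_morphism V).
HB.instance Definition _ V :=
  GRing.isMonoidMorphism.Build P P (restr V) (restr_is_monoid_morphism V).

Lemma restrC V a : restr V a%:MP = a%:MP. Proof. exact: evC. Qed.

Lemma restr_var V t : restr V (var k t) = if t \in V then var k t else 0.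
Proof. exact: ev_var. Qed.

Lemma poly_morph_ext (S : comNzRingType) (g1 g2 : {rmorphism P -> S})
    (i : {rmorphism k -> S}) :
  (forall a, g1 a%:MP = i a) -> (forall a, g2 a%:MP = i a) ->
  (forall t, g1 (var k t) = g2 (var k t)) -> g1 =1 g2.
Proof.
move=> H1 H2 H f; rewrite (poly_morphE H1) (poly_morphE H2).
by congr (ev _ _ f); apply: functional_extensionality_dep.
Qed.

Lemma restrT f : restr setT f = f.
Proof.
apply: (@poly_morph_ext P (restr setT) idfun (@mpolyC #|{: T}| k)) => //.
- exact: restrC.
- by move=> t; rewrite [LHS]restr_var inE.
Qed.

Lemma restr_restr V V' f : V \subset V' -> restr V' (restr V f) = restr V f.
Proof.
move=> /subsetP sV.
apply: (@poly_morph_ext P (restr V' \o restr V)%FUN (restr V) (@mpolyC #|{: T}| k)).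
- by move=> a; rewrite /= !restrC.
- by move=> a; rewrite /= !restrC.
- move=> t; rewrite /= !restr_var; case: ifP => [/sV tV'|_]; last exact: rmorph0.
  by rewrite restr_var tV'.
Qed.

Lemma restr_sub V V' f : V \subset V' -> restr V f = f -> restr V' f = f.
Proof. by move=> sV <-; apply: restr_restr. Qed.

Lemma restr0 f : exists a : k, restr set0 f = a%:MP.
Proof.
exists (f.@[fun=> 0]).
apply: (@poly_morph_ext P (restr set0) (@mpolyC #|{: T}| k \o meval (fun=> 0))%FUN
  (@mpolyC #|{: T}| k)) => [a|a|t] /=; first by rewrite restrC.
- by rewrite mevalC.
- by rewrite restr_var inE /var mevalXU.
Qed.

End Restriction.

Section Independent.
Variables (k : fieldType) (T : finType).
Local Notation P := (polyring k T).
Implicit Types (J V : {set T}) (f : P) (q : P -> Prop).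

(** Algebraic independence of the classes of the variables in J modulo q. *)
Definition indep q J := forall f, restr J f = f -> q f -> f = 0.

Lemma indep0 q : is_prime q -> indep q set0.
Proof.
move=> pq f; have [a ->] := restr0 f => <- qa.
have [->|a0] := eqVneq a 0; first by rewrite mpolyC0.
case: (is_prime_invertible pq _ qa).
by exists (a^-1)%:MP; rewrite -mpolyCM divff // mpolyC1.
Qed.

(** Some of the variables form a transcendence basis of the residue field of q, so independent sets
    of variables already compute its transcendence degree. The default [set0] is independent for
    every prime. *)
Definition trdeg q := #|[arg max_(J > set0 | `[< indep q J >]) #|J|]|.

Lemma trdeg_exists q : is_prime q ->
  exists2 J, indep q J & #|J| = trdeg q /\ forall J', indep q J' -> (#|J'| <= #|J|)%N.
Proof.
rewrite /trdeg => pq; case: arg_maxnP => [|J /asboolP iJ max].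
  by apply/asboolP; apply: indep0.
by exists J => //; split=> // J' iJ'; apply: max; apply/asboolP.
Qed.

Lemma indep_dep q J y : indep q J -> y \notin J ->
    (forall J', indep q J' -> (#|J'| <= #|J|)%N) ->
  exists f, [/\ restr (y |: J) f = f, q f & f != 0].
Proof.
move=> iJ yJ max.
have : ~ indep q (y |: J) by move=> /max; rewrite cardsU1 yJ ltnn.
move=> /existsNP[f /not_implyP[fJ /not_implyP[qf /eqP nf]]].
by exists f.
Qed.

(* The coefficients of f as a polynomial in the variable y, the variables outside
   of V and y being set to 0. *)
Definition as_poly V y (f : P) : {poly P} :=
  ev (polyC \o @mpolyC #|{: T}| k)%FUN
    (fun t => if t \in V then (var k t)%:P else if t == y then 'X else 0) f.

Lemma as_poly_is_zmod_morphism V y : zmod_morphism (as_poly V y).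
Proof. exact: rmorphB. Qed.

Lemma as_poly_is_monoid_morphism V y : monoid_morphism (as_poly V y).
Proof. by split=> [|f g]; [exact: rmorph1 | exact: rmorphM]. Qed.

HB.instance Definition _ V y :=
  GRing.isZmodMorphism.Build P {poly P} (as_poly V y) (as_poly_is_zmod_morphism V y).
HB.instance Definition _ V y :=
  GRing.isMonoidMorphism.Build P {poly P} (as_poly V y) (as_poly_is_monoid_morphism V y).

Lemma as_polyC V y a : as_poly V y a%:MP = (a%:MP)%:P. Proof. exact: evC. Qed.

Lemma as_poly_var V y t : as_poly V y (var k t) =
  if t \in V then (var k t)%:P else if t == y then 'X else 0.
Proof. exact: ev_var. Qed.

Lemma as_poly_restr V y f : map_poly (restr V) (as_poly V y f) = as_poly V y f.
Proof.
apply: (@poly_morph_ext k T {poly P} (map_poly (restr V) \o as_poly V y)%FUN (as_poly V y)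
  (polyC \o @mpolyC #|{: T}| k)%FUN) => [a|a|t] /=; rewrite ?as_polyC //.
  by rewrite map_polyC /= restrC.
rewrite as_poly_var; case: ifP => tV; first by rewrite map_polyC /= restr_var tV.
by case: ifP => _; rewrite ?map_polyX ?rmorph0.
Qed.

Lemma as_polyK V y f : restr (y |: V) f = f -> (as_poly V y f).[var k y] = f.
Proof.
move=> <-.
apply: (@poly_morph_ext k T P
   (horner_eval (var k y) \o (as_poly V y \o restr (y |: V)))%FUN (restr (y |: V))
  (@mpolyC #|{: T}| k)) => [a|a|t] /=; rewrite ?restrC //.
  by rewrite as_polyC /horner_eval hornerC.
rewrite restr_var in_setU1; case: (eqVneq t y) => [->|ty] /=.
  by rewrite as_poly_var eqxx /horner_eval; case: ifP; rewrite ?hornerC ?hornerX.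
case: ifP => tV; last by rewrite rmorph0 /horner_eval horner0.
by rewrite as_poly_var tV /horner_eval hornerC.
Qed.

End Independent.

Section FracSubfield.
Variables (k : fieldType) (T : finType) (L : fieldType).
Local Notation P := (polyring k T).
Variables (g : {rmorphism P -> L}) (J : {set T}).

(* The field of fractions, inside L, of the image of k[x_t | t in J]. *)
Definition frac_pred : {pred L} := fun z =>
  `[< exists a b, [/\ restr J a = a, restr J b = b, g b != 0 & z = g a / g b] >].

Lemma frac_pred_divring_closed : divring_closed frac_pred.
Proof.
split.
- apply/asboolP; exists 1, 1; rewrite !rmorph1; split=> //; first exact: oner_neq0.
  by rewrite divr1.
- move=> x y /asboolP[a [b [Ha Hb b0 ->]]] /asboolP[c [d [Hc Hd d0 ->]]].
  apply/asboolP; exists (a * d - c * b), (b * d).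
  rewrite !rmorphB /= !rmorphM /= Ha Hb Hc Hd mulf_neq0 //; split=> //.
  by rewrite -[in LHS]mulNr addf_div // mulNr.
- move=> x y /asboolP[a [b [Ha Hb b0 ->]]] /asboolP[c [d [Hc Hd d0 ->]]].
  apply/asboolP; have [c0|c0] := eqVneq (g c) 0.
    exists 0, 1; rewrite !rmorph0 !rmorph1 oner_neq0; split=> //.
    by rewrite c0 mul0r invr0 mulr0 mul0r.
  exists (a * d), (b * c); rewrite !rmorphM /= Ha Hb Hc Hd mulf_neq0 //; split=> //.
  by rewrite invf_div mulf_div.
Qed.

HB.instance Definition _ := GRing.isDivringClosed.Build L frac_pred frac_pred_divring_closed.

(** Packaged as a field of its own so that [algebraicOver], with its closure under sums and
    products, applies to it. *)
Record frac_subfield := FracSubfield {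
  frac_val :> L; _ : frac_val \in frac_pred }.

HB.instance Definition _ := [isSub for frac_val].
HB.instance Definition _ := [Choice of frac_subfield by <:].
HB.instance Definition _ := [SubChoice_isSubIntegralDomain of frac_subfield by <:].
HB.instance Definition _ := [SubIntegralDomain_isSubField of frac_subfield by <:].

(** Since z is nonzero, powers of X can be divided out of an annihilating polynomial until its
    constant term is nonzero; clearing denominators preserves this. *)
Lemma frac_algebraic_clear z : z != 0 -> algebraicOver (val : frac_subfield -> L) z ->
  exists n (a : nat -> P), [/\ forall i, restr J (a i) = a i, g (a 0%N) != 0 &
    \sum_(i < n.+1) g (a i) * z ^+ i = 0].
Proof.
move=> z0 [p p0 pz].
have [q [q0 qz]] : exists q : {poly frac_subfield}, q`_0 != 0 /\ root (map_poly val q) z.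
  have [n [q Hq e]] := multiplicity_XsubC p 0.
  rewrite p0 /= in Hq; exists q; split; first by rewrite -horner_coef0.
  move: pz; rewrite e polyC0 subr0 rmorphM rmorphXn [X in _ * X ^+ _]map_polyX.
  by rewrite rootM => /orP[//|]; rewrite rootE hornerXn expf_eq0 (negPf z0) andbF.
have /choice[ab Hab] i : exists ab : P * P, [/\ restr J ab.1 = ab.1, restr J ab.2 = ab.2,
    g ab.2 != 0 & val (q`_i) = g ab.1 / g ab.2].
  by have /asboolP[a [b H]] := valP (q`_i); exists (a, b).
pose n := (size q).-1.
(* The common denominator is the product of all the denominators, and the i-th one cancels. *)
pose c i := (ab i).1 * \prod_(j < n.+1 | j != i :> nat) (ab j).2.
exists n, c; split=> [i||].
- rewrite /c rmorphM rmorph_prod /=; have [-> _ _ _] := Hab i; congr (_ * _).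
  by apply: eq_bigr => j _; have [] := Hab j.
- rewrite /c rmorphM rmorph_prod mulf_neq0 //.
    have [_ _ H e] := Hab 0%N; apply: contraNneq q0 => a0; apply/eqP/val_inj.
    by rewrite [LHS]e a0 mul0r [RHS](rmorph0 (val : {rmorphism frac_subfield -> L})).
  by apply/prodf_neq0 => j _; have [] := Hab j.
have sq : size q = n.+1.
  by rewrite /n prednK // lt0n size_poly_eq0; apply: contraNneq q0 => ->; rewrite coef0.
move/rootP: qz; rewrite horner_coef size_map_poly sq.
move=> /(congr1 ( *%R (\prod_(j < n.+1) g (ab j).2))); rewrite mulr0 big_distrr => e.
rewrite -[RHS]e.
apply: eq_bigr => i _; rewrite coef_map.
have [_ _ H /= vE] := Hab i; rewrite /= vE (bigD1 i) //= /c rmorphM rmorph_prod /=.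
by field.
Qed.

Lemma algebraicOver_eval : 
  (forall t, algebraicOver (val : frac_subfield -> L) (g (var k t))) ->
  forall f, algebraicOver (val : frac_subfield -> L) (g f).
Proof.
move=> H f.
have alg_id (a : L) : a \in frac_pred -> algebraicOver (val : frac_subfield -> L) a.
  by move=> Ha; have := algebraic_id (val : {rmorphism frac_subfield -> L}) (FracSubfield Ha).
rewrite [f]mpolyE rmorph_sum; apply: big_ind => [||m _].
- exact: algebraic0.
- by move=> x y; apply: algebraic_add.
rewrite -mul_mpolyC rmorphM; apply: algebraic_mul.
  apply: alg_id; apply/asboolP; exists (f@_m)%:MP, 1.
  by rewrite restrC !rmorph1 oner_neq0 divr1.
rewrite mpolyXE_id rmorph_prod; apply: big_ind => [||i _].
- exact: algebraic1.
- by move=> x y; apply: algebraic_mul.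
elim: (m i) => [|e IH]; first by rewrite expr0 rmorph1; apply: algebraic1.
rewrite exprS rmorphM; apply: algebraic_mul => //.
by have := H (enum_val i); rewrite /var enum_valK.
Qed.

End FracSubfield.

(** * Strict decrease of the transcendence degree along chains of primes *)

Section Chains.
Variables (k : fieldType) (T : finType).
Local Notation P := (polyring k T).
Implicit Types (J V : {set T}) (f : P) (q : P -> Prop).

(* A relation for the class of f over k(x_t | t in J), divided by a power of f so that its
   constant term is nonzero, exhibits that constant term as a multiple of f modulo q. *)
Lemma indep_algebraic q J f : is_prime q -> indep q J ->
  (forall J', indep q J' -> (#|J'| <= #|J|)%N) -> ~ q f ->
  exists a b, [/\ restr J a = a, ~ q a & q (a - f * b)].
Proof.
move=> pq iJ max qf; have [L [g split_form]] := prime_field_point pq.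
have alg t : algebraicOver (val : frac_subfield g J -> L) (g (var k t)).
  have alg_id (a : P) : restr J a = a ->
      exists2 x : frac_subfield g J, val x = g a & True.
    move=> Ha; have H : g a \in frac_pred g J.
      by apply/asboolP; exists a, 1; rewrite !rmorph1 oner_neq0 divr1.
    by exists (FracSubfield H).
  case: (boolP (t \in J)) => tJ.
    have [|x <- _] := alg_id (var k t); first by rewrite restr_var tJ.
    exact: algebraic_id.
  (* By maximality of J the variable t satisfies a relation over k[x_j | j in J]; its leading
     coefficient survives in L because J is independent. *)
  have [h [hJ qh h0]] := indep_dep iJ tJ max.
  have hE := as_polyK hJ; set H := as_poly J t h in hE.
  have Hi i : restr J H`_i = H`_i by rewrite /H -[in RHS](as_poly_restr J t h) coef_map.
  have /choice[c Hc] i : exists x : frac_subfield g J, val x = g H`_i.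
    by have [x e _] := alg_id _ (Hi i); exists x.
  exists (\poly_(i < size H) c i).
    have Hl : lead_coef H != 0.
      by rewrite lead_coef_eq0; apply: contraNneq h0 => H0; rewrite -hE H0 horner0.
    apply: contraNneq Hl => /polyP/(_ (size H).-1).
    rewrite coef_poly coef0 prednK ?leqnn; last first.
      by rewrite lt0n size_poly_eq0; apply: contraNneq h0 => H0; rewrite -hE H0 horner0.
    move=> c0; apply/eqP/iJ; first by rewrite lead_coefE Hi.
    by apply/split_form; rewrite lead_coefE -Hc c0 raddf0.
  have -> : map_poly val (\poly_(i < size H) c i) = map_poly g H.
    apply/polyP => i; rewrite !coef_map coef_poly /=.
    by case: ltnP => Hs; rewrite ?Hc // nth_default // !raddf0.
  by rewrite rootE horner_map hE; apply/eqP/split_form.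
have gf0 : g f != 0 by apply/eqP => /split_form.
have [n [a [aJ a0 e]]] := frac_algebraic_clear gf0 (algebraicOver_eval alg f).
exists (a 0%N), (- \sum_(i < n) a i.+1 * f ^+ i); split=> //.
  by move=> /split_form; apply/eqP.
apply/split_form; rewrite -[RHS]e big_ord_recl expr0 mulr1 rmorphB; congr (_ + _).
rewrite -rmorphN mulrN opprK rmorphM rmorph_sum big_distrr /=.
by apply: eq_bigr => i _; rewrite rmorphM rmorphXn exprS mulrCA.
Qed.

(** If the degrees agreed, a basis J' for q' would also be maximal independent for q. An element of
    q' outside q would then have a multiple congruent modulo q to some a outside q involving only
    J'; but such an a lies in q', hence is 0. *)
Lemma trdeg_lt q q' : is_prime q -> is_prime q' ->
  (forall f, q f -> q' f) -> (exists2 f, q' f & ~ q f) -> (trdeg q' < trdeg q)%N.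
Proof.
move=> pq pq' sub [f q'f qf].
have [J' iJ' [<- _]] := trdeg_exists pq'; have [J iJ [<- max]] := trdeg_exists pq.
have iqJ' : indep q J' by move=> h hJ /sub; apply: iJ'.
have := max _ iqJ'; rewrite leq_eqVlt => /orP[/eqP e|//]; exfalso.
have [|a [b [aJ qa qab]]] := indep_algebraic pq iqJ' _ qf.
  by move=> J2 /max; rewrite e.
apply: qa; have -> : a = 0; last by case: pq => -[].
apply: iJ' => //; case: (pq') => -[_ pD pM] _ _.
by rewrite -[a](subrK (f * b)); apply: pD; [apply: sub | rewrite mulrC; apply: pM].
Qed.

Lemma trdeg_leq q q' : is_prime q -> is_prime q' ->
  (forall f, q f -> q' f) -> (trdeg q' <= trdeg q)%N.
Proof.
move=> pq pq' sub; have [J' iJ' [<- _]] := trdeg_exists pq'.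
have [J iJ [<- max]] := trdeg_exists pq.
by apply: max => h hJ /sub; apply: iJ'.
Qed.

Lemma trdeg_max q : is_prime q -> (trdeg q <= #|T|)%N.
Proof. by move=> pq; have [J _ [<- _]] := trdeg_exists pq; apply: max_card. Qed.

Lemma trdeg_neq0 q f : is_prime q -> q f -> f != 0 -> (trdeg q < #|T|)%N.
Proof.
move=> pq qf f0; have [J iJ [<- _]] := trdeg_exists pq.
rewrite ltn_neqAle max_card andbT; apply: contraNN f0 => /eqP cJ.
apply/eqP/iJ => //; have -> : J = setT; last exact: restrT.
by apply/eqP; rewrite eqEcard subsetT cardsT cJ leqnn.
Qed.

Lemma prime_chain_trdeg d (c : nat -> P -> Prop) :
  prime_chain d c -> (d + trdeg (c d) <= trdeg (c 0%N))%N.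
Proof.
elim: d c => [|d IH] c [pc sc] //.
have := IH (fun i => c i.+1).
have lt : (trdeg (c 1%N) < trdeg (c 0%N))%N.
  by have [//|s e] := sc 0%N; apply: trdeg_lt => //; apply: pc.
have H : prime_chain d (fun i => c i.+1) by split=> i Hi; [apply: pc | apply: sc].
by move=> /(_ H)/leq_ltn_trans/(_ lt).
Qed.

End Chains.

(** * A chain of primes of full length below a given prime *)

Section MaximalChain.
Variables (k : fieldType) (T : finType).
Local Notation P := (polyring k T).
Variables (q : P -> Prop) (L : fieldType) (g : {rmorphism P -> L}).
Hypothesis split_form : forall f, g f = 0 <-> q f.

Let cst : {rmorphism k -> {mpoly L[#|T|]}} :=
  (@mpolyC #|T| L \o (g \o @mpolyC #|T| k))%FUN.

(* The kernel of this morphism is the extension of the contraction of q to k[x_t | t in V]. *)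
Definition generic_point (V : {set T}) : P -> {mpoly L[#|T|]} :=
  ev cst (fun t => if t \in V then (g (var k t))%:MP else 'X_(enum_rank t)).

Lemma generic_point_is_zmod_morphism V : zmod_morphism (generic_point V).
Proof. exact: rmorphB. Qed.

Lemma generic_point_is_monoid_morphism V : monoid_morphism (generic_point V).
Proof. by split=> [|f f']; [exact: rmorph1 | exact: rmorphM]. Qed.

HB.instance Definition _ V := GRing.isZmodMorphism.Build P {mpoly L[#|T|]}
  (generic_point V) (generic_point_is_zmod_morphism V).
HB.instance Definition _ V := GRing.isMonoidMorphism.Build P {mpoly L[#|T|]}
  (generic_point V) (generic_point_is_monoid_morphism V).

Lemma generic_pointC V a : generic_point V a%:MP = (g a%:MP)%:MP. Proof. exact: evC. Qed.

Lemma generic_point_var V t : generic_point V (var k t) =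
  if t \in V then (g (var k t))%:MP else 'X_(enum_rank t).
Proof. exact: ev_var. Qed.

Lemma generic_point_prime V : is_prime (fun f => generic_point V f = 0).
Proof.
apply: (@is_prime_preim _ _ (generic_point V) (fun x => x = 0)); split; first split=> //.
- by move=> x y -> ->; rewrite addr0.
- by move=> a x ->; rewrite mulr0.
- by apply/eqP; apply: oner_neq0.
by move=> x y /eqP; rewrite mulf_eq0 => /orP[/eqP|/eqP]; [left | right].
Qed.

Lemma generic_point_sub (V V' : {set T}) f : V \subset V' ->
  generic_point V f = 0 -> generic_point V' f = 0.
Proof.
move=> /subsetP sV.
pose s : {rmorphism {mpoly L[#|T|]} -> {mpoly L[#|T|]}} :=
  ev (@mpolyC #|T| L)
    (fun t => if t \in V' then (g (var k t))%:MP else 'X_(enum_rank t)).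
have -> : generic_point V' f = s (generic_point V f); last by move=> ->; rewrite rmorph0.
apply: (@poly_morph_ext k T _ (generic_point V') (s \o generic_point V)%FUN cst).
- exact: generic_pointC.
- by move=> a; rewrite /= generic_pointC /s /= evC.
move=> t; rewrite /= !generic_point_var /s /=; case: (boolP (t \in V)) => tV.
  by rewrite (sV _ tV) evC.
by rewrite -[X in ev _ _ X]/(var L t) ev_var.
Qed.

Lemma generic_point_restr V f : restr V f = f -> generic_point V f = (g f)%:MP.
Proof.
move=> <-; apply: (@poly_morph_ext k T _ (generic_point V \o restr V)%FUN
  (@mpolyC #|T| L \o (g \o restr V))%FUN cst) => [a|a|t] /=.
- by rewrite restrC generic_pointC.
- by rewrite restrC.
- rewrite restr_var; case: ifP => tV; last by rewrite !rmorph0.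
  by rewrite generic_point_var tV.
Qed.

(** The variable y stays free under [generic_point V], so vanishing is read off coefficient by
    coefficient in y; each coefficient then lies in q and involves only J. *)
Lemma generic_point_indep (J V : {set T}) y f : indep q J -> J \subset V -> y \notin V ->
  restr (y |: J) f = f -> generic_point V f = 0 -> f = 0.
Proof.
move=> iJ sJ yV fJ f0.
(* Keeps y as the polynomial variable and sets the other free variables to 0. *)
pose s : {rmorphism {mpoly L[#|T|]} -> {poly L}} :=
  ev (@polyC L) (fun t => if t == y then 'X else 0).
have e : map_poly g (as_poly J y f) = s (generic_point V f).
  rewrite -fJ; apply: (@poly_morph_ext k T _
    (map_poly g \o (as_poly J y \o restr (y |: J)))%FUN
    (s \o (generic_point V \o restr (y |: J)))%FUN (@polyC L \o (g \o @mpolyC #|T| k))%FUN)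
     => [a|a|t] /=; rewrite ?restrC ?restr_var.
  - by rewrite as_polyC map_polyC.
  - by rewrite generic_pointC /s /= evC.
  have yJ : y \notin J by apply: contra yV => /(subsetP sJ).
  rewrite in_setU1; case: (eqVneq t y) => [->|ty] /=.
    rewrite as_poly_var generic_point_var (negPf yV) (negPf yJ) eqxx map_polyX.
    by rewrite /s /= -[X in ev _ _ X]/(var L y) ev_var eqxx.
  case: ifP => tJ; last by rewrite !rmorph0.
  by rewrite as_poly_var generic_point_var tJ (subsetP sJ _ tJ) map_polyC /s /= evC.
rewrite f0 rmorph0 in e.
rewrite -(as_polyK fJ); have -> : as_poly J y f = 0; last by rewrite horner0.
apply/polyP => i; rewrite coef0; apply: iJ.
  by rewrite -[in RHS](as_poly_restr J y f) coef_map.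
by apply/split_form; have := congr1 (fun h : {poly L} => h`_i) e; rewrite coef_map coef0.
Qed.

(** The variables outside a transcendence basis J are replaced one at a time by their classes in L,
    and the kernels form the chain. A step is strict because the algebraic relation of the new
    variable over J lies in the new kernel but not in the previous one. *)
Lemma maximal_chain : is_prime q ->
  exists c, prime_chain (#|T| - trdeg q) c /\ forall i f, c i f -> q f.
Proof.
move=> pq; have [J iJ [<- max]] := trdeg_exists pq.
pose s := enum (~: J); pose V i := J :|: [set t in take i s].
have sz : size s = (#|T| - #|J|)%N by rewrite -cardE cardsCs setCK.
rewrite -sz; exists (fun i f => generic_point (V i) f = 0); split; last first.
  move=> i f /(generic_point_sub (subsetT _)).
  by rewrite generic_point_restr ?restrT // => /eqP; rewrite mpolyC_eq0 => /eqP/split_form.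
split=> [i _|i lt_is]; first exact: generic_point_prime.
have y0 : T by case: (s) lt_is.
pose y := nth y0 s i; have ys : y \in s by rewrite mem_nth.
have VS : V i.+1 = y |: V i.
  apply/setP => t; rewrite /V (take_nth y0) // -/y !inE mem_rcons inE.
  by rewrite orbA [(_ \in J) || _]orbC -orbA.
have yJ : y \notin J by move: ys; rewrite mem_enum inE.
have yV : y \notin V i.
  rewrite !inE negb_or yJ /= in_take // index_uniq // ?ltnn //; exact: enum_uniq.
split=> [f|]; first by rewrite VS; apply/generic_point_sub/subsetUr.
have [f [fJ qf f0]] := indep_dep iJ yJ max; exists f.
  have sJ : y |: J \subset V i.+1 by rewrite VS; apply/setUS/subsetUl.
  rewrite (generic_point_restr (restr_sub sJ fJ)).
  by apply/eqP; rewrite mpolyC_eq0; apply/eqP/split_form.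
by move=> /(generic_point_indep iJ (subsetUl _ _) yV fJ)/eqP; apply/negP.
Qed.

End MaximalChain.

(** * Generators of a prime up to localization *)

Section Generators.
Variables (k : fieldType) (T : finType).
Local Notation P := (polyring k T).
Variable q : P -> Prop.
Hypothesis pq : is_prime q.

Let qD f f' : q f -> q f' -> q (f + f'). Proof. by case: pq => -[_ H _] _ _; apply: H. Qed.
Let qM f f' : q f' -> q (f * f'). Proof. by case: pq => -[_ _ H] _ _; apply: H. Qed.
Let qI f f' : q (f * f') -> q f \/ q f'. Proof. by case: pq => _ _; apply. Qed.
Let q0 : q 0. Proof. by case: pq => -[]. Qed.
Let q1 : ~ q 1. Proof. by case: pq. Qed.
Let qB f f' : q f -> q f' -> q (f - f').
Proof. by move=> Hf Hf'; apply: qD => //; rewrite -mulN1r; apply: qM. Qed.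

Lemma prime_expr f n : ~ q f -> ~ q (f ^+ n).
Proof. by move=> Hf; elim: n => [|n IH]; rewrite ?expr0 // exprS => /qI[]. Qed.

Lemma prime_prod (I : Type) (r : seq I) (F : I -> P) :
  (forall i, ~ q (F i)) -> ~ q (\prod_(i <- r) F i).
Proof. by move=> H; apply: (big_ind (fun x => ~ q x)) => // x y Hx Hy /qI[]. Qed.

(* A minimal polynomial of y over k(x_t | t in V) modulo q, and pseudo-division by it. *)
Lemma minimal_relation (V : {set T}) y F :
  map_poly (restr V) F = F -> q F.[var k y] -> (exists i, ~ q F`_i) ->
  exists G : {poly P}, [/\ q G.[var k y], ~ q (lead_coef G) &
    forall f, restr (y |: V) f = f -> q f ->
    exists s A (R : {poly P}), [/\ ~ q s, s * f = A * G.[var k y] + R.[var k y] &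
      forall i, restr V R`_i = R`_i /\ q R`_i]].
Proof.
move=> FV qF nF.
pose good n := `[< exists G : {poly P}, [/\ map_poly (restr V) G = G,
  q G.[var k y], (exists i, ~ q G`_i) & size G = n] >].
have exg : exists n, good n by exists (size F); apply/asboolP; exists F.
case: (ex_minnP exg) => n /asboolP[G [GV qG nG sG]] minn.
have lG : ~ q (lead_coef G).
  move=> ql; have [i qi] := nG.
  have G0 : G != 0 by apply/eqP => G0; apply: qi; rewrite G0 coef0.
  (* If the leading coefficient were in q, dropping the leading term would leave a shorter relation
     that still has a coefficient outside q. *)
  pose G' := \poly_(j < n.-1) G`_j.
  have n0 : (0 < n)%N by rewrite -sG size_poly_gt0.
  have G'E j : G'`_j = if j == n.-1 then 0 else G`_j.
    rewrite coef_poly; case: ltngtP => // Hj.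
    by rewrite nth_default // sG -(prednK n0).
  have GE : G = G' + (lead_coef G)%:P * 'X^(n.-1).
    apply/polyP => j; rewrite coefD G'E coefCM coefXn lead_coefE sG.
    by case: (j =P n.-1) => [->|_]; rewrite ?mulr1 ?add0r // mulr0 addr0.
  have : good (size G').
    apply/asboolP; exists G'; split=> //.
    - apply/polyP => j; rewrite coef_map /= G'E; case: ifP => _; first exact: rmorph0.
      by rewrite -[in RHS]GV coef_map.
    - have -> : G'.[var k y] = G.[var k y] - ((lead_coef G)%:P * 'X^(n.-1)).[var k y].
        by rewrite {1}GE hornerD addrK.
      by apply: qB => //; rewrite hornerCM mulrC; apply: qM.
    exists i; rewrite G'E; case: eqP => // e; case: qi.
    by move: ql; rewrite lead_coefE sG -e.
  move=> /minn; rewrite leqNgt => /negP; apply.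
  by rewrite -[X in (_ < X)%N](prednK n0) ltnS size_poly.
exists G; split=> // f fV qf.
have fE := as_polyK fV; have FfV := as_poly_restr V y f.
set F' := as_poly V y f in fE FfV.
have G0 : G != 0 by apply/eqP => G0; apply: lG; rewrite G0 lead_coef0.
(* Pseudo-division takes place over the whole ring. Applying [restr V] to quotient and remainder
   brings their coefficients back to k[x_t | t in V] and keeps the identity, since F' and G are
   fixed by it. *)
pose e := scalp F' G; pose A := map_poly (restr V) (F' %/ G).
pose R := map_poly (restr V) (F' %% G).
have lV : restr V (lead_coef G) = lead_coef G by rewrite lead_coefE -(coef_map (restr V)) GV.
have E1 : lead_coef G ^+ e *: F' = A * G + R.
  rewrite -[in RHS]GV -rmorphM -rmorphD -Pdiv.Idomain.divp_eq.
  apply/polyP => j; rewrite [in RHS]coef_map !coefZ.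
  apply/esym/(etrans (rmorphM (restr V) _ _)).
  by rewrite (rmorphXn (restr V)) /= lV -(coef_map (restr V)) FfV.
have E2 : lead_coef G ^+ e * f = A.[var k y] * G.[var k y] + R.[var k y].
  by have := congr1 (fun h : {poly P} => h.[var k y]) E1; rewrite hornerZ hornerD hornerM fE.
have RV : map_poly (restr V) R = R.
  by apply/polyP => i; rewrite !coef_map /=; apply: restr_restr.
exists (lead_coef G ^+ e), A.[var k y], R; split=> // [|i]; first exact: prime_expr.
split; first by rewrite -(coef_map (restr V)) RV.
have qR : q R.[var k y].
  have -> : R.[var k y] = lead_coef G ^+ e * f - A.[var k y] * G.[var k y].
    by rewrite E2 addrC addKr.
  exact: qB (qM _ qf) (qM _ qG).
(* A coefficient of the remainder outside q would make R a relation shorter than the minimal one. *)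
apply: contrapT => nq.
have : good (size R) by apply/asboolP; exists R; split=> //; exists i.
move=> /minn; rewrite -sG leqNgt => /negP; apply.
by apply: leq_ltn_trans (size_poly _ _) _; rewrite ltn_modp.
Qed.

(** One generator is added per variable outside a transcendence basis: a minimal relation of that
    variable over the earlier ones. Pseudo-division by it leaves a remainder whose coefficients lie
    in q and involve fewer variables, so the induction applies up to a factor outside q. *)
Lemma prime_generators : exists gs : seq P, [/\ size gs = (#|T| - trdeg q)%N,
  (forall x, x \in gs -> q x) &
  forall f, q f -> exists2 s, ~ q s & ideal_gen (fun x => x \in gs) (s * f)].
Proof.
have [J iJ [<- max]] := trdeg_exists pq.
pose s := enum (~: J); pose V i := J :|: [set t in take i s].
have sz : size s = (#|T| - #|J|)%N by rewrite -cardE cardsCs setCK.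
rewrite -sz.
suff H i : (i <= size s)%N -> exists gs : seq P, [/\ size gs = i,
  (forall x, x \in gs -> q x) &
  forall f, restr (V i) f = f -> q f ->
    exists2 s, ~ q s & ideal_gen (fun x => x \in gs) (s * f)].
  have [gs [H1 H2 H3]] := H _ (leqnn _); exists gs; split=> // f; apply: H3.
  apply: restr_sub (restrT f); apply/subsetP => t _.
  by rewrite !inE take_size mem_enum inE orbN.
elim: i => [_|i IH lt_is].
  exists [::]; split=> // f; have -> : V 0%N = J by apply/setP => t; rewrite !inE take0 orbF.
  move=> fJ qf; exists 1 => //; rewrite (iJ f) // mulr0; by case: (ideal_gen_ideal (fun x => x \in ([::] : seq P))).
have [gs [sgs qgs gen]] := IH (ltnW lt_is).
have y0 : T by case: (s) lt_is.
pose y := nth y0 s i; have ys : y \in s by rewrite mem_nth.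
have VS : V i.+1 = y |: V i.
  apply/setP => t; rewrite /V (take_nth y0) // -/y !inE mem_rcons inE.
  by rewrite orbA [(_ \in J) || _]orbC -orbA.
have yJ : y \notin J by move: ys; rewrite mem_enum inE.
have [f [fJ qf f0]] := indep_dep iJ yJ max.
have fE := as_polyK fJ.
have HJ j : restr J (as_poly J y f)`_j = (as_poly J y f)`_j.
  by rewrite -[in RHS](as_poly_restr J y f) coef_map.
have [|||G [qG lG HG]] := @minimal_relation (V i) y (as_poly J y f).
- apply/polyP => j; rewrite coef_map /=; apply: restr_sub (HJ j); exact: subsetUl.
- by rewrite fE.
- exists (size (as_poly J y f)).-1; rewrite -lead_coefE => ql; case/eqP: f0.
  rewrite -fE; have -> : as_poly J y f = 0; last by rewrite horner0.
  by apply/eqP; rewrite -lead_coef_eq0; apply/eqP/iJ => //; rewrite lead_coefE HJ.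
exists (rcons gs G.[var k y]); split=> [|x|f'].
- by rewrite size_rcons sgs.
- by rewrite mem_rcons inE => /orP[/eqP->|/qgs].
rewrite VS => f'V qf'; have [r [A [R [nr e HR]]]] := HG _ f'V qf'.
have /choice[c Hc] j : exists c, ~ q c /\ ideal_gen (fun x => x \in gs) (c * R`_j).
  by have [RV qR] := HR j; have [c] := gen _ RV qR; exists c.
(* c j takes care of the j-th coefficient of the remainder, and r comes from the pseudo-division. *)
exists (\prod_(j <- iota 0 (size R)) c j * r).
  by case/qI => //; apply: prime_prod => j; case: (Hc j).
set I := ideal_gen _; have [I0 ID IM] : is_ideal I := ideal_gen_ideal _.
rewrite -mulrA e mulrDr; apply: (ID).
  by rewrite mulrA; apply/IM/ideal_gen_sub; rewrite mem_rcons inE eqxx.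
rewrite (horner_coef R) mulr_sumr.
apply: (big_ind I) => // j _.
rewrite (big_rem (nat_of_ord j)) /=; last by rewrite mem_iota add0n ltn_ord.
rewrite mulrA mulrC; apply: (IM); rewrite -mulrA mulrCA; apply: IM.
apply: ideal_gen_min (Hc j).2; first exact: ideal_gen_ideal.
by move=> x xg; apply: ideal_gen_sub; rewrite mem_rcons inE xg orbT.
Qed.

End Generators.

(** * Regularity of the local rings of affine space *)

Section LocalRing.
Variables (k : fieldType) (T : finType).
Local Notation P := (polyring k T).
Variables (E p : P -> Prop).
Hypotheses (pp : is_prime p) (Ep : forall f, E f -> p f).
Local Notation LR := (local_ring E p).

Lemma nonunit_frac a s : nonunit (frac E a s : LR) <-> p a.
Proof.
split=> [nu|pa [y e]]; last first.
  apply: (is_prime_invertible (extension_prime pp Ep (fun _ => id))).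
    by exists y; exact: e.
  by exists a, s.
apply: contrapT => npa; apply: nu.
exists (frac E (sval s) (mkden (monoid_gen_sub (D := fun f => ~ p f) npa))).
by rewrite fracM -frac1; apply: frac_eq => /=; ring.
Qed.

(** Fractions differ from their numerators by units, so inclusions that are strict in the local ring
    remain strict after contraction. *)
Lemma contract_chain n (c : nat -> LR -> Prop) : prime_chain n c ->
  [/\ prime_chain n (fun i a => c i (to_loc E _ a)),
      forall i a, (i <= n)%N -> E a -> c i (to_loc E _ a) &
      forall i a, (i <= n)%N -> c i (to_loc E _ a) -> p a].
Proof.
move=> [pc sc]; split.
- split=> [i Hi|i Hi]; first exact: (is_prime_preim (@to_loc P E (fun f => ~ p f)) (pc i Hi)).
  have [sub [x cx ncx]] := sc i Hi; split=> [a|]; first exact: sub.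
  have [a [s e]] := frac_surj x; exists a.
    rewrite -(frac_mul_den E a s) -e mulrC.
    by have [[_ _ cM] _ _] := pc _ Hi; apply: cM.
  move=> ca; apply: ncx; rewrite e.
  have [_ _ cI] := pc i (ltnW Hi); move: ca; rewrite -(frac_mul_den E a s) => /cI[//|cs].
  case: (is_prime_invertible (pc i (ltnW Hi)) _ cs).
  exact: to_loc_invertible (denP s).
- move=> i a Hi Ea; rewrite (to_loc0 _ Ea).
  by have [[c0 _ _] _ _] := pc _ Hi.
- move=> i a Hi ca; apply: contrapT => npa.
  case: (is_prime_invertible (pc i Hi) _ ca).
  exact/to_loc_invertible/monoid_gen_sub.
Qed.

End LocalRing.

Lemma ideal_gen_morph (R S : comPzRingType) (f : {rmorphism R -> S})
    (E : R -> Prop) (E' : S -> Prop) x :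
  (forall y, E y -> E' (f y)) -> ideal_gen E x -> ideal_gen E' (f x).
Proof.
move=> H [n [a [g [Eg ->]]]]; exists n, (fun i => f (a i)), (fun i => f (g i)).
split=> [i|]; first exact: H.
by rewrite rmorph_sum; apply: eq_bigr => i _; rewrite rmorphM.
Qed.

Lemma ideal_gen_fam (R : comPzRingType) d (g : 'I_d -> R) x :
  ideal_gen (fun y => exists i, y = g i) x -> exists b, x = \sum_i b i * g i.
Proof.
apply: (@ideal_gen_min R (fun y => exists i, y = g i)
  (fun x => exists b, x = \sum_i b i * g i)) => [|_ [i ->]].
  split=> [|_ _ [b ->] [c ->]|a _ [b ->]].
  - by exists (fun=> 0); rewrite big1 // => i _; rewrite mul0r.
  - exists (fun i => b i + c i); rewrite -big_split.
    by apply: eq_bigr => i _; rewrite mulrDl.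
  - by exists (fun i => a * b i); rewrite mulr_sumr; apply: eq_bigr => i _; rewrite mulrA.
exists (fun j => if j == i then 1 else 0); rewrite (bigD1 i) //= eqxx mul1r.
by rewrite big1 ?addr0 // => j /negPf->; rewrite mul0r.
Qed.

Section Regularity.
Variables (k : fieldType) (T : finType).
Local Notation P := (polyring k T).

(** The codimension |T| - trdeg q is attained by an explicit chain, bounds every chain because the
    transcendence degree drops strictly at each step, and is also the number of generators of q
    after localization. *)
Theorem regular_affine q : is_prime q ->
  regular_local (local_ring (fun _ : P => False) q).
Proof.
move=> pq; set E := fun _ : P => False.
have Eq f : E f -> q f by [].
exists (#|T| - trdeg q)%N; split; first split.
- have [L [g split_form]] := prime_field_point pq.
  have [c [[pc sc] cq]] := maximal_chain split_form pq.
  exists (fun i => extension (c i)).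
  have cD i s : ~ q s -> ~ c i s by move=> H /cq.
  have cE i s : E s -> c i s by [].
  have cF j a t (Hj : (j <= #|T| - trdeg q)%N) := extension_frac (pc j Hj) (@cE j) (@cD j) a t.
  split=> [i Hi|i Hi]; first exact: extension_prime (pc i Hi) (cE i) (cD i).
  have [sub [x cx ncx]] := sc i Hi; split=> [y|].
    have [a [s ->]] := frac_surj y.
    by move=> /(cF _ _ _ (ltnW Hi)) H; apply/(cF _ _ _ Hi)/sub.
  exists (to_loc E _ x); first exact/(cF _ _ _ Hi).
  by move=> /(cF _ _ _ (ltnW Hi)).
- move=> c chain; have [ch _ sub] := contract_chain chain.
  have := prime_chain_trdeg ch; have [pc _] := ch.
  have H1 := trdeg_max (pc 0%N isT).
  have H2 := trdeg_leq (pc _ (leqnn _)) pq (fun f => sub _ f (leqnn _)).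
  have H3 := trdeg_max pq.
  move=> H; have := leq_trans H H1; rewrite leqNgt => /negP; apply.
  by rewrite addSn ltnS -{1}(subnK H3) leq_add2l.
have [gs [sgs qgs gen]] := prime_generators pq.
exists (fun i => to_loc E _ (nth 0 gs i)) => x.
have [a [s ->]] := frac_surj x; rewrite (nonunit_frac pq Eq).
split=> [qa|].
  have [r nr /(@ideal_gen_morph _ _ (@to_loc P E (fun f => ~ q f)) _
    (fun y => exists i : 'I_(#|T| - trdeg q), y = to_loc E _ (nth 0 gs i)))] := gen a qa.
  case=> [y yg|n [b [g [Hg e]]]].
    have lt : (index y gs < #|T| - trdeg q)%N by rewrite -sgs index_mem.
    by exists (Ordinal lt); rewrite nth_index.
  have [rV rK] := to_loc_invertible E (monoid_gen_sub (D := fun f => ~ q f) nr).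
  have [sV sK] := to_loc_invertible E (denP s).
  have -> : frac E a s = (rV * sV) * to_loc E _ (r * a).
    rewrite rmorphM /= -(frac_mul_den E a s).
    transitivity ((to_loc E (fun f => ~ q f) r * rV) * (to_loc E _ (sval s) * sV) * frac E a s).
      by rewrite rK sK !mul1r.
    by ring.
  rewrite e; have [_ _ IM] := ideal_gen_ideal (fun y : local_ring E q =>
    exists i : 'I_(#|T| - trdeg q), y = to_loc E _ (nth 0 gs i)).
  by apply: IM; exists n, b, g.
move=> H; rewrite -(extension_frac pq Eq (fun _ => id)); move: H.
apply: ideal_gen_min => [|_ [i ->]].
  by have [] := extension_prime pq Eq (fun _ => id).
rewrite (extension_to_loc pq Eq (fun _ => id)).
by apply/qgs/mem_nth; rewrite sgs.
Qed.

End Regularity.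

(** * Hypersurfaces of order two at the origin *)

Section NotRegular.
Variables (k : fieldType) (T : finType).
Local Notation P := (polyring k T).
Implicit Types f a : P.

Lemma origin_prime : is_prime (@origin k T).
Proof.
split; first split.
- exact: meval0.
- by move=> x y; rewrite /origin mevalD => -> ->; rewrite addr0.
- by move=> a x; rewrite /origin mevalM => ->; rewrite mulr0.
- by rewrite /origin meval1 => /eqP; rewrite oner_eq0.
by move=> x y /eqP; rewrite /origin mevalM mulf_eq0 => /orP[]/eqP; [left|right].
Qed.

Definition grad0 f (t : 'I_#|T|) : k := (f^`M(t)).@[fun=> 0].

(* f lies in the square of the maximal ideal of the origin. *)
Definition order2 f := origin k T f /\ forall t, grad0 f t = 0.

Lemma order2_ideal : is_ideal order2.
Proof.
split.
- by split=> [|t]; rewrite /grad0 /origin ?mderiv0 meval0.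
- move=> x y [x0 x1] [y0 y1]; split=> [|t]; rewrite /grad0 /origin ?mderivD mevalD.
    by rewrite x0 y0 addr0.
  by rewrite [X in X + _]x1 [X in _ + X]y1 addr0.
- move=> a x [x0 x1]; split=> [|t]; rewrite /grad0 /origin ?mderivM ?mevalD !mevalM.
    by rewrite x0 mulr0.
  by rewrite x0 [X in _ + _ * X]x1 !mulr0 addr0.
Qed.

Variables (f : P).
Hypotheses (f0 : f != 0) (f2 : order2 f).
Local Notation LR := (local_ring (eq f) (@origin k T)).

Let fE g : f = g -> origin k T g. Proof. by move=> <-; case: f2. Qed.

(** The gradient at the origin of a local function vanishing there, by the quotient rule. It is a
    relation because the fraction is not unique; the value is, since f has order two. *)
Definition has_grad (x : LR) (v : 'I_#|T| -> k) :=
  exists a s, [/\ x = frac (eq f) a s, origin k T a & forall t, v t = grad0 a t / (sval s).@[fun=> 0]].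

Lemma den_origin (s : den (fun g => ~ origin k T g)) : (sval s).@[fun=> 0] != 0.
Proof.
apply/eqP => s0.
exact: (monoid_gen_notin origin_prime (fun _ => id) (denP s)).
Qed.

Lemma has_grad_uniq x v w : has_grad x v -> has_grad x w -> v =1 w.
Proof.
move=> [a [s [-> a0 va]]] [b [t [/fracP[r Mr e] b0 wb]]] i.
have r0 : r.@[fun=> 0] != 0 := den_origin (mkden Mr).
have [_ H] : order2 (r * (a * sval t - b * sval s)).
  by apply: ideal_gen_min e; [exact: order2_ideal | move=> _ <-].
move: (H i); rewrite /grad0 mderivM mderivB !mderivM !(mevalD, mevalM, mevalN, mevalB).
rewrite a0 b0 !mul0r !addr0 subr0 mulr0 add0r => /eqP.
rewrite mulf_eq0 (negPf r0) subr_eq0 => /eqP e'.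
rewrite va wb; apply/eqP; rewrite eqr_div ?den_origin //; exact/eqP.
Qed.

Lemma has_gradD x y v w : has_grad x v -> has_grad y w ->
  has_grad (x + y) (fun t => v t + w t).
Proof.
move=> [a [s [-> a0 va]]] [b [t [-> b0 wb]]].
exists (a * sval t + b * sval s), (denM s t); split; first by rewrite fracD.
  by rewrite /origin mevalD !mevalM a0 b0 !mul0r addr0.
move=> i; rewrite va wb /grad0 /= mderivD !mderivM !(mevalD, mevalM) a0 b0 !mul0r !addr0.
by rewrite addf_div ?den_origin.
Qed.

Lemma has_gradM x y w : has_grad y w -> exists c, has_grad (x * y) (fun t => c * w t).
Proof.
have [a [s ->]] := frac_surj x; move=> [b [t [-> b0 wb]]].
exists (a.@[fun=> 0] / (sval s).@[fun=> 0]), (a * b), (denM s t); split.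
- by rewrite fracM.
- by rewrite /origin mevalM b0 mulr0.
by move=> i; rewrite wb /grad0 /= mderivM !(mevalD, mevalM) b0 mulr0 add0r mulf_div.
Qed.

(** Primes containing the nonzero f form chains of length d less than the number N of variables. If
    d elements generated the maximal ideal, the gradients of the N variables, a basis of k^N, would
    lie in the span of the d gradients of the generators. *)
Theorem not_regular_hypersurface : ~ regular_local LR.
Proof.
move=> [d [[[c chain] _] [g gen]]].
have [[pc _] Ec _] := contract_chain chain.
have lt : (d < #|T|)%N.
  have [ch Ec' _] := contract_chain chain.
  have := prime_chain_trdeg ch.
  have := trdeg_neq0 (pc 0%N isT) (Ec' 0%N f isT erefl) f0 => H H'.
  by apply: leq_ltn_trans H; apply: leq_trans H'; apply: leq_addr.
have /choice[v Hv] i : exists v, has_grad (g i) v.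
  have : nonunit (g i) by apply/gen/ideal_gen_sub; exists i.
  have [a [s ->]] := frac_surj (g i); rewrite (nonunit_frac origin_prime fE) => a0.
  by exists (fun t => grad0 a t / (sval s).@[fun=> 0]), a, s.
have /choice[b Hb] (t : 'I_#|T|) : exists b : 'I_d -> k,
    forall u, (t == u)%:R = \sum_i b i * v i u.
  have Xt : has_grad (to_loc (eq f) _ 'X_t) (fun u => (t == u)%:R).
    exists 'X_t, (den1 _); split=> //; first by rewrite /origin mevalXU.
    move=> u; rewrite /= meval1 divr1 /grad0 mderivX mnm1E.
    case: eqP => [->|_]; last by rewrite scale0r meval0.
    have -> : (U_(u) - U_(u))%MM = 0%MM :> 'X_{1..#|T|}.
      by apply/mnmP => i; rewrite mnmBE subnn mnm0E.
    by rewrite scale1r mpolyX0 meval1.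
  have : nonunit (to_loc (eq f) (fun f => ~ origin k T f) 'X_t).
    by apply/(nonunit_frac origin_prime fE); rewrite /origin mevalXU.
  move=> /gen/ideal_gen_fam[c' e].
  have /choice[b Hb] i : exists b, has_grad (c' i * g i) (fun u => b * v i u).
    exact: has_gradM.
  exists b => u.
  have H0 : has_grad 0 (fun=> 0).
    by exists 0, (den1 _); split; [|exact: meval0|move=> i; rewrite /grad0 mderiv0 meval0 mul0r].
  have : has_grad (\sum_i c' i * g i) (fun u => \sum_i b i * v i u).
    elim: (index_enum _) => [|i r IH].
      have -> : (fun u => \sum_(i <- [::]) b i * v i u) = (fun=> 0).
        by apply: functional_extensionality_dep => u'; rewrite big_nil.
      by rewrite big_nil.
    have -> : (fun u => \sum_(j <- i :: r) b j * v j u) =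
        (fun u => b i * v i u + \sum_(j <- r) b j * v j u).
      by apply: functional_extensionality_dep => u'; rewrite big_cons.
    by rewrite big_cons; apply: has_gradD.
  rewrite -e => /(has_grad_uniq Xt); apply.
have : (\rank (1%:M : 'M[k]_#|T|) <= d)%N.
  have -> : 1%:M = (\matrix_(t < #|T|, i < d) b t i) *m (\matrix_(i < d, u < #|T|) v i u) :> 'M[k]_#|T|.
    by apply/matrixP => t u; rewrite !mxE Hb; apply: eq_bigr => i _; rewrite !mxE.
  by apply: leq_trans (mulmx_max_rank _ _) _.
by rewrite mxrank1 leqNgt lt.
Qed.

End NotRegular.

(** * Local isomorphisms and split quadratic cones *)

Lemma inverse_morph (R S : comPzRingType) (phi : {rmorphism R -> S}) psi :
  cancel phi psi -> cancel psi phi ->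
  exists psi' : {rmorphism S -> R}, psi' =1 psi.
Proof.
move=> K K'.
have pB : zmod_morphism psi by move=> x y; apply: (can_inj K); rewrite rmorphB !K'.
have pM : monoid_morphism psi.
  by split=> [|x y]; apply: (can_inj K); rewrite ?rmorph1 ?rmorphM !K'.
pose psi' : {rmorphism S -> R} := HB.pack psi
  (GRing.isZmodMorphism.Build _ _ psi pB) (GRing.isMonoidMorphism.Build _ _ psi pM).
by exists psi'.
Qed.

Lemma regular_local_iso (R S : comPzRingType) (phi : {rmorphism R -> S}) :
  bijective phi -> regular_local R -> regular_local S.
Proof.
case=> psi0 K0 K0'; have [psi pE] := inverse_morph K0 K0'.
have K : cancel phi psi by move=> x; rewrite pE K0.
have K' : cancel psi phi by move=> x; rewrite pE K0'.
have nuE x : nonunit (psi x) <-> nonunit x.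
  split=> nu [y e]; apply: nu.
    by exists (psi y); rewrite -rmorphM e rmorph1.
  by exists (phi y); rewrite -[x]K' -rmorphM e rmorph1.
have chain (A B : comPzRingType) (f : {rmorphism A -> B}) (g : {rmorphism B -> A}) n c :
    cancel f g -> prime_chain n c -> prime_chain n (fun i x => c i (g x)).
  move=> fK [pc sc]; split=> i Hi; first exact: is_prime_preim (pc i Hi).
  have [sub [x cx ncx]] := sc i Hi; split=> [y|]; first exact: sub.
  by exists (f x); rewrite fK.
case=> d [[[c Hc] nc] [g gen]]; exists d; split; first split.
- by exists (fun i x => c i (psi x)); apply: chain K Hc.
- by move=> c' /(chain _ _ psi phi _ _ K'); apply: nc.
exists (fun i => phi (g i)) => x; rewrite -nuE gen; split=> H.
  rewrite -[x]K'; apply: ideal_gen_morph H => _ [i ->]; by exists i.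
by apply: ideal_gen_morph H => _ [i ->]; exists i; rewrite K.
Qed.

Section LocalRingIso.
Variables (k : fieldType).

Lemma loc_to_local_ring (T : finType) (E p : polyring k T -> Prop) h : ~ p h ->
  exists j : {rmorphism loc E (eq h) -> local_ring E p},
  forall a, j (to_loc E _ a) = to_loc E _ a.
Proof.
move=> ph; apply: (loc_lift (f := @to_loc _ E (fun f => ~ p f))) => [x|_ <-].
  exact: to_loc0.
exact/to_loc_invertible/monoid_gen_sub.
Qed.

(** An element outside p goes to a fraction whose numerator lies outside p', hence to a unit of the
    local ring, and the universal property applies. *)
Lemma local_ring_morph (T T' : finType) (E p : polyring k T -> Prop)
    (E' p' : polyring k T' -> Prop) h h'
    (phi : {rmorphism loc E (eq h) -> loc E' (eq h')})
    (j' : {rmorphism loc E' (eq h') -> local_ring E' p'}) :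
  Vpts E p -> ~ p h -> Vpts E' p' -> ~ p' h' ->
  (forall x, extension p x <-> extension p' (phi x)) ->
  (forall a, j' (to_loc E' _ a) = to_loc E' _ a) ->
  exists Phi : {rmorphism local_ring E p -> local_ring E' p'},
    forall a, Phi (to_loc E _ a) = j' (phi (to_loc E _ a)).
Proof.
move=> [pp Ep] ph [pp' Ep'] ph' H j'E.
have neq s : h = s -> ~ p s by move=> <-.
have neq' s : h' = s -> ~ p' s by move=> <-.
have [||Phi PhiE] := @loc_lift _ E (fun f => ~ p f) _ (j' \o (phi \o to_loc E (eq h)))%FUN.
- by move=> x Ex; rewrite /= (to_loc0 _ Ex) !rmorph0.
- move=> s ps /=; have [b [t e]] := frac_surj (phi (to_loc E (eq h) s)).
  have pb : ~ p' b.
    rewrite -(extension_frac pp' Ep' neq' b t) -e -H.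
    by rewrite (extension_to_loc pp Ep neq).
  have : invertible (j' (to_loc E' (eq h') b)).
    by rewrite j'E; apply/to_loc_invertible/monoid_gen_sub.
  by rewrite -(frac_mul_den E' b t) -e rmorphM => /invertibleM[].
by exists Phi => a; rewrite PhiE.
Qed.

Theorem local_iso_regular (T T' : finType) (E p : polyring k T -> Prop)
    (E' p' : polyring k T' -> Prop) : local_iso E p E' p' ->
  (regular_local (local_ring E p) <-> regular_local (local_ring E' p')).
Proof.
case=> h h' phi [Vp ph] [Vp' ph'] [psi0 K0 K0'] _ pt.
have [psi psiE] := inverse_morph K0 K0'.
have K : cancel phi psi by move=> x; rewrite psiE K0.
have K' : cancel psi phi by move=> x; rewrite psiE K0'.
have pt' x : extension p' x <-> extension p (psi x) by rewrite pt K'.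
have [j jE] := @loc_to_local_ring _ E p h ph.
have [j' jE'] := @loc_to_local_ring _ E' p' h' ph'.
have [Phi PhiE] := local_ring_morph Vp ph Vp' ph' pt jE'.
have [Psi PsiE] := local_ring_morph Vp' ph' Vp ph pt' jE.
have Phij x : Phi (j x) = j' (phi x).
  apply: (loc_morph_ext (F := (Phi \o j)%FUN) (G := (j' \o phi)%FUN)) => a /=.
  rewrite jE; exact: PhiE.
have Psij x : Psi (j' x) = j (psi x).
  apply: (loc_morph_ext (F := (Psi \o j')%FUN) (G := (j \o psi)%FUN)) => a /=.
  rewrite jE'; exact: PsiE.
have KK : cancel Phi Psi.
  apply: (loc_morph_ext (F := (Psi \o Phi)%FUN) (G := idfun)) => a /=.
  rewrite PhiE Psij K; exact: jE.
have KK' : cancel Psi Phi.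
  apply: (loc_morph_ext (F := (Phi \o Psi)%FUN) (G := idfun)) => a /=.
  rewrite PsiE Phij K'; exact: jE'.
by split; [apply: (regular_local_iso (Bijective KK KK')) |
  apply: (regular_local_iso (Bijective KK' KK))].
Qed.

End LocalRingIso.

Section FunctorIsoComp.
Variables (k : fieldType) (T1 T2 T3 : finType).
Variables (P1 : functor k T1) (P2 : functor k T2) (P3 : functor k T3).

Definition functor_iso_comp (F : functor_iso P1 P2) (G : functor_iso P2 P3) :
  functor_iso P1 P3.
Proof.
refine (@FunctorIso k T1 T3 P1 P3 (fun S i x => fw G i (fw F i x))
  (fun S i x => bw F i (bw G i x)) _ _ _ _ _).
- by move=> S i x H; exact: (fw_pt G (fw_pt F H)).
- by move=> S i x H; exact: (bw_pt F (bw_pt G H)).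
- by move=> S i x H; rewrite (fwK G (fw_pt F H)) (fwK F H).
- by move=> S i x H; rewrite (bwK F (bw_pt G H)) (bwK G H).
- move=> S S' f i i' x Hi H.
  by rewrite (fw_nat F Hi H) (fw_nat G Hi (fw_pt F H)).
Defined.

End FunctorIsoComp.

(** * Regular and singular points of the split quadratic cone *)

Section Quadric.
Variables (k : fieldType) (I : finType).
Local Notation T := (I * bool)%type.

Definition quadric : polyring k T := \sum_i var k (i, false) * var k (i, true).

Lemma ev_quadric (S : comNzRingType) (i : {rmorphism k -> S}) x :
  ev i x quadric = \sum_j x (j, false) * x (j, true).
Proof.
by rewrite rmorph_sum; apply: eq_bigr => j _; rewrite rmorphM /= !ev_var.
Qed.

Definition flip (t : T) : T := (t.1, ~~ t.2).

Section Chart.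
Variable t0 : T.
(** Where the coordinate t0 is invertible, the equation of the cone is solved for its partner
    [flip t0], and the remaining coordinates are free. *)
Definition chart_coord := {t : T | t != flip t0}.

Definition chart_fw (S : comNzRingType) (i : {rmorphism k -> S}) (x : T -> S) (t : chart_coord) : S :=
  x (val t).

Definition chart_ext (S : comNzRingType) (x : chart_coord -> S) (t : T) : S :=
  oapp x 0 (insub t).

Definition chart_bw (S : comNzRingType) (i : {rmorphism k -> S}) (x : chart_coord -> S) (t : T) : S :=
  if t == flip t0 then
    - (cinv (chart_ext x t0) * \sum_(j | j != t0.1) chart_ext x (j, false) * chart_ext x (j, true))
  else chart_ext x t.

Lemma flip_neq t : t != flip t.
Proof. by case: t => i []; rewrite xpair_eqE /= eqxx. Qed.

Lemma chart_ext_fw (S : comNzRingType) (i : {rmorphism k -> S}) (x : T -> S) t :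
  t != flip t0 -> chart_ext (chart_fw i x) t = x t.
Proof. by move=> H; rewrite /chart_ext insubT. Qed.

Lemma sum_flip (S : comNzRingType) (x : T -> S) :
  \sum_j x (j, false) * x (j, true) =
  x t0 * x (flip t0) + \sum_(j | j != t0.1) x (j, false) * x (j, true).
Proof.
rewrite (bigD1 t0.1) //=; congr (_ + _); rewrite /flip.
by case: (t0) => j []; rewrite //= mulrC.
Qed.

Definition quadric_chart :
  functor_iso (points (eq quadric) (var k t0))
    (points (fun=> False) (var k (Sub t0 (flip_neq t0) : chart_coord))).
Proof.
refine (@FunctorIso k T _ _ _ chart_fw chart_bw _ _ _ _ _).
- by move=> S i x [_ H]; split=> //; rewrite ev_var; rewrite ev_var in H.
- move=> S i x [_]; rewrite ev_var => H.
  have e0 : chart_ext x t0 = x (Sub t0 (flip_neq t0)).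
    by rewrite /chart_ext (insubT (fun t => t != flip t0) (flip_neq t0)).
  have c0 : chart_bw i x t0 = chart_ext x t0 by rewrite /chart_bw (negPf (flip_neq t0)).
  split=> [_ <-|]; last by rewrite ev_var c0 e0.
  rewrite ev_quadric sum_flip c0 /chart_bw eqxx mulrN mulrA mulrcV ?e0 // mul1r.
  apply/eqP; rewrite addrC subr_eq0; apply/eqP; apply: eq_bigr => j jt.
  by rewrite !xpair_eqE (negPf jt).
- move=> S i x [/(_ _ erefl)]; rewrite ev_quadric sum_flip ev_var => e H.
  apply: functional_extensionality_dep => t; rewrite /chart_bw.
  case: eqP => [->|/eqP tt]; last exact: chart_ext_fw.
  rewrite chart_ext_fw ?flip_neq //; apply: (mulcI H).
  rewrite mulrN mulrA mulrcV // mul1r.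
  move/eqP: e; rewrite addr_eq0 => /eqP->; congr (- _); apply: eq_bigr => j jt.
  by rewrite !chart_ext_fw // xpair_eqE (negPf jt).
- move=> S i x _; apply: functional_extensionality_dep => t.
  rewrite /chart_fw /chart_bw (negPf (valP t)) /chart_ext valK //.
- by [].
Defined.

End Chart.

Lemma quadric_regular q : Vpts (eq quadric) q -> (exists t, ~ q (var k t)) ->
  regular_local (local_ring (eq quadric) q).
Proof.
move=> Vq [t qt]; have [q' [e _]] := functor_iso_local_iso (quadric_chart t) Vq qt.
apply/(local_iso_regular e)/regular_affine.
by have [[]] := tgt_mem e.
Qed.

Lemma quadric_order2 : order2 quadric.
Proof.
rewrite /quadric; apply: (big_ind (@order2 k T)) => [||i _].
- by have [] := @order2_ideal k T.
- by have [] := @order2_ideal k T.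
split=> [|t]; rewrite /origin /grad0 ?mderivM ?mevalD !mevalM /var !mevalXU ?mulr0 ?mul0r ?addr0 //.
Qed.

Lemma quadric_neq0 : (0 < #|I|)%N -> quadric != 0.
Proof.
case/card_gt0P => i _; apply/eqP => /(congr1 (ev (idfun : {rmorphism k -> k}) (fun t => (t.1 == i)%:R))).
rewrite rmorph0 ev_quadric (bigD1 i) //= eqxx mulr1 big1 => [/eqP|j /negPf ->].
  by rewrite addr0 oner_eq0.
by rewrite mul0r.
Qed.

Lemma quadric_not_regular : (0 < #|I|)%N ->
  ~ regular_local (local_ring (eq quadric) (@origin k T)).
Proof. by move=> I0; apply: not_regular_hypersurface (quadric_neq0 I0) quadric_order2. Qed.

End Quadric.

(** Modulo such a prime every polynomial is congruent to its constant term, and nonzero constants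
    are units. *)
Lemma prime_all_vars (k : fieldType) (T : finType) (p : polyring k T -> Prop) :
  is_prime p -> (forall t, p (var k t)) -> p = @origin k T.
Proof.
move=> pp H; apply: functional_extensionality_dep => f; apply: propext.
have [L [g gp]] := prime_field_point pp.
have -> : p f <-> g f = 0 by rewrite gp.
have -> : g f = g (f.@[fun=> 0])%:MP.
  pose i : {rmorphism k -> L} := (g \o @mpolyC #|T| k)%FUN.
  apply: (@poly_morph_ext k T L g (i \o meval (fun=> 0))%FUN i) => [//|a|t] /=.
    by rewrite mevalC.
  by rewrite /var mevalXU rmorph0; apply/gp/H.
split=> [/eqP|->]; last by rewrite mpolyC0 rmorph0.
by rewrite -[g _]/((g \o @mpolyC #|T| k)%FUN _) fmorph_eq0 => /eqP.
Qed.

Section SplitCone.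
Variables (k : fieldType) (T : finType) (I : finType).
Variables (E : polyring k T -> Prop) (h : polyring k T) (h' : polyring k (I * bool)).
Variable F : functor_iso (points E h) (points (eq (quadric k I)) h').
Hypothesis I0 : (0 < #|I|)%N.
Hypothesis F0 : forall (S : comNzRingType) (i : {rmorphism k -> S}) x, points E h i x ->
  (forall t, x t = 0) <-> (forall t, fw F i x t = 0).
Hypotheses (V0 : Vpts E (@origin k T)) (h0 : ~ origin k T h).

(** The prime supplied by [functor_iso_local_iso] contains every variable, which determines it. *)
Lemma origin_local_iso (T' : finType) (E' : polyring k T' -> Prop) g
    (G : functor_iso (points E h) (points E' g)) :
  (forall (S : comNzRingType) (i : {rmorphism k -> S}) x, points E h i x ->
  (forall t, x t = 0) <-> (forall t, fw G i x t = 0)) ->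
  inhabited (local_iso E (@origin k T) E' (@origin k T')).
Proof.
move=> G0; have [p' [e [_ _ L]]] := functor_iso_local_iso G V0 h0.
have [Vs ns] := src_mem e; have [[pp' Ep'] nt] := tgt_mem e.
have := L (fun=> True) (fun=> True) _ _ _ Vs ns (conj pp' Ep') nt (@comorph_point _ _ _ _ _ _ _ e).
case=> [S i x /G0[H1 H2]|H _]; first by split=> H t _; [apply: H1 | apply: H2] => t'; apply: H.
have {}H : forall t, p' (var k t).
  by move=> t; apply: H => // u _; rewrite /origin /var mevalXU.
by rewrite -(prime_all_vars pp' H); constructor.
Qed.

(** A point of D(h) other than the origin has, through F, some nonzero coordinate on the cone, and
    the cone is regular there. *)
Theorem split_cone_isolated : isolated_singularity E (@origin k T).
Proof.
have [e] := origin_local_iso F0.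
split; first split=> //.
  by move/(local_iso_regular e)/(quadric_not_regular I0).
exists h => // q [Vq nreg] qh f; suff -> : q = @origin k T by [].
have [q' [e' [_ _ L]]] := functor_iso_local_iso F Vq qh.
have [_ ns] := src_mem e'; have [Vq' nt] := tgt_mem e'.
apply: prime_all_vars; first by case: Vq.
have [//|_ H t] := L (fun=> True) (fun=> True) _ _ _ Vq ns Vq' nt (@comorph_point _ _ _ _ _ _ _ e').
  move=> S i x /F0[H1 H2].
  by split=> H t _; [apply: H1 | apply: H2] => t'; apply: H.
apply: H => // u _; apply: contrapT => nu; apply: nreg.
by apply/(local_iso_regular e')/(quadric_regular Vq'); exists u.
Qed.

End SplitCone.

Section Reindex.
Variables (k : fieldType) (T T' : finType) (th : T -> T') (th' : T' -> T).
Hypotheses (thK : cancel th th') (th'K : cancel th' th).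
Variables (g : polyring k T) (g' : polyring k T').
Hypothesis gg' : forall (S : comNzRingType) (i : {rmorphism k -> S}) x,
  ev i (fun t => x (th t)) g = ev i x g'.
Variable h : polyring k T.

Definition rename_poly : polyring k T' :=
  ev (@mpolyC #|{: T'}| k) (fun t => var k (th t)) h.

Lemma ev_rename (S : comNzRingType) (i : {rmorphism k -> S}) (x : T' -> S) :
  ev i x rename_poly = ev i (fun t => x (th t)) h.
Proof.
rewrite (@ev_morph k T _ S (ev i x) (@mpolyC #|{: T'}| k) i) => [|a]; last by rewrite /= evC.
by congr (ev _ _ h); apply: functional_extensionality_dep => t; rewrite /= ev_var.
Qed.

Lemma rename_cancel (A : Type) (x : T -> A) : (fun t => x (th' (th t))) = x.
Proof. by apply: functional_extensionality_dep => t; rewrite thK. Qed.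

Definition reindex_iso : functor_iso (points (eq g) h) (points (eq g') rename_poly).
Proof.
refine (@FunctorIso k T T' _ _ (fun S i x t => x (th' t)) (fun S i x t => x (th t)) _ _ _ _ _).
- move=> S i x [/(_ _ erefl) H1 H2].
  by split=> [_ <-|]; rewrite ?ev_rename -?gg' rename_cancel.
- move=> S i x [/(_ _ erefl) H1]; rewrite ev_rename => H2.
  by split=> [_ <-|//]; rewrite gg'.
- by move=> S i x _; apply: rename_cancel.
- by move=> S i x _; apply: functional_extensionality_dep => t; rewrite th'K.
- by [].
Defined.

End Reindex.

Section A1.
Variables (k : fieldType) (I : finType).
Hypothesis I0 : (0 < #|I|)%N.
(** The dimension of the cone in 2|I| coordinates. It is odd, which selects the branch of [A1_poly]
    without a square. *)
Let n := (#|I|.*2).-1.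

Let nE : n.+1 = #|I|.*2.
Proof. by rewrite /n prednK // double_gt0. Qed.

Definition A1_index (t : I * bool) : 'I_n.+1 := inord ((enum_rank t.1).*2 + t.2)%N.

Lemma A1_indexE t : A1_index t = ((enum_rank t.1).*2 + t.2)%N :> nat.
Proof.
rewrite inordK // nE; have := ltn_ord (enum_rank t.1); rewrite -leq_double doubleS.
by case: t.2 => H; rewrite ?addn1 ?addn0 //; apply: ltnW.
Qed.

Lemma A1_index_bij : bijective A1_index.
Proof.
apply: inj_card_bij => [[i a] [j b] /(congr1 val)|].
  rewrite /= !A1_indexE /= => e.
  have ab : a = b by have := congr1 odd e; rewrite !oddD !odd_double !oddb.
  rewrite ab in e *; move/eqP: e; rewrite eqn_add2r => /eqP/double_inj/val_inj/enum_rank_inj.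
  by move->.
by rewrite card_ord nE card_prod card_bool muln2.
Qed.

Lemma ev_A1_poly (S : comNzRingType) (i : {rmorphism k -> S}) x :
  ev i (fun t => x (A1_index t)) (quadric k I) = ev i x (A1_poly k n).
Proof.
rewrite ev_quadric /A1_poly.
have -> : odd n.
  have := congr1 odd nE; rewrite odd_double /= => /negbFE //.
have e : n.+1./2 = #|I| by rewrite nE doubleK.
rewrite rmorph_sum /=.
transitivity (\sum_(j < n.+1./2) x (inord j.*2) * x (inord j.*2.+1)); last first.
  by apply: eq_bigr => j _; rewrite rmorphM /= /A1_var !ev_var.
rewrite e (reindex (@enum_val _ I)) /=; last by apply: onW_bij; apply: enum_val_bij.
apply: eq_bigr => j _; congr (x _ * x _); apply: val_inj.
  by rewrite /= A1_indexE /= enum_valK addn0 inordK // nE ltn_double.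
rewrite /= A1_indexE /= enum_valK addn1 inordK // nE.
by have := ltn_ord j; rewrite -leq_double doubleS.
Qed.

End A1.

Theorem split_cone_A1 (k : fieldType) (T I : finType) (E : polyring k T -> Prop)
    (h : polyring k T) (h' : polyring k (I * bool))
    (F : functor_iso (points E h) (points (eq (quadric k I)) h')) :
  (0 < #|I|)%N ->
  (forall (S : comNzRingType) (i : {rmorphism k -> S}) x, points E h i x ->
     (forall t, x t = 0) <-> (forall t, fw F i x t = 0)) ->
  Vpts E (@origin k T) -> ~ origin k T h -> A1_singularity E (@origin k T).
Proof.
move=> I0 F0 V0 h0; split; first exact: (split_cone_isolated (F := F)).
exists (#|I|.*2).-1; left.
have [th' thK th'K] := A1_index_bij I0.
pose G := functor_iso_comp F (reindex_iso thK th'K (ev_A1_poly I0) h').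
apply: (origin_local_iso V0 h0 (G := G)) => S i x /F0[H1 H2].
split=> [/H1 H t|H]; first exact: (H (th' t)).
apply: H2 => t; rewrite -[t]thK; exact: (H (A1_index t)).
Qed.

(** * Continuants *)

Section Continuant.
Variable S : comNzRingType.
Implicit Types z y : nat -> S.

Definition shift z : nat -> S := fun n => z n.+1.

Lemma continuantSS z n :
  continuant z n.+2 = z n.+2 * continuant z n.+1 - continuant z n.
Proof. by []. Qed.

Lemma eq_continuant z y n : (forall j, (0 < j <= n)%N -> z j = y j) ->
  continuant z n = continuant y n.
Proof.
elim/ltn_ind: n => -[|[|n]] IH H //; first exact: H.
rewrite !continuantSS H ?leqnn // (IH n.+1) // ?(IH n) // => j /andP[j0 jn]; apply: H;
  rewrite j0 /=; apply: leq_trans jn _; exact: ltnW.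
Qed.

(** The recursion at the left end: F_a is solved for z_1, whereas the definition peels off the last
    variable. *)
Lemma continuant_shift z n :
  continuant z n.+2 = z 1%N * continuant (shift z) n.+1 - continuant (shift (shift z)) n.
Proof.
elim/ltn_ind: n => -[|[|n]] IH; first by rewrite !continuantSS /= /shift; ring.
  by rewrite !continuantSS /= /shift; ring.
rewrite [LHS]continuantSS (IH n.+1) // (IH n) // [continuant (shift z) n.+3]continuantSS.
by rewrite [continuant (shift (shift z)) n.+2]continuantSS /shift; ring.
Qed.

(** By the recursion, the difference of the two products does not depend on n, and at n = 0 it is
    1. *)
Lemma continuant_euler z n :
  continuant z n.+1 * continuant (shift z) n.+1 =
  1 + continuant z n.+2 * continuant (shift z) n.
Proof.
elim: n => [|n IH]; first by rewrite /= /shift; ring.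
rewrite [continuant z n.+3]continuantSS [continuant (shift z) n.+2]continuantSS.
rewrite /shift -/(shift z) in IH *.
have -> : 1 = continuant z n.+1 * continuant (shift z) n.+1 -
  continuant z n.+2 * continuant (shift z) n by rewrite IH; ring.
by ring.
Qed.

(* Coordinates (a_j, b_j) in which (-1)^k P_2k becomes 1 + sum_(j < k) a_j b_j. *)
Definition even_cont z j := (-1) ^+ j * continuant z j.*2.
Definition odd_cont z j := (-1) ^+ j.+1 * continuant z j.*2.+1.
Definition even_var z j := z j.*2.+2.

Lemma even_cont0 z : even_cont z 0 = 1. Proof. by rewrite /even_cont expr0 mul1r. Qed.

Lemma even_contS z j : even_cont z j.+1 = even_cont z j + even_var z j * odd_cont z j.
Proof. by rewrite /even_cont /odd_cont doubleS continuantSS !exprS /even_var; ring. Qed.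

Lemma odd_cont0 z : odd_cont z 0 = - z 1%N.
Proof. by rewrite /odd_cont expr1 mulN1r. Qed.

Lemma odd_contS z j : odd_cont z j.+1 = odd_cont z j - z j.*2.+3 * even_cont z j.+1.
Proof.
by rewrite /even_cont /odd_cont doubleS [continuant z _.+3]continuantSS !exprS; ring.
Qed.

Lemma even_contE z k : even_cont z k = 1 + \sum_(j < k) even_var z j * odd_cont z j.
Proof.
elim: k => [|k IH]; first by rewrite even_cont0 big_ord0 addr0.
by rewrite even_contS IH big_ord_recr addrA.
Qed.

Implicit Types a b : nat -> S.

Definition chart_cont a b j := 1 + \sum_(i < j) a i * b i.

(** Inverse of the chart: with E_j = [chart_cont a b j], the recursion b_j = b_(j-1) - z_(2j+1) E_j,
    where b_(-1) = 0, is solved for z_(2j+1), and z_(2j+2) = a_j. *)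
Definition chart_z a b (n : nat) : S :=
  let j := n.-1./2 in
  if odd n then ((if j is j'.+1 then b j' else 0) - b j) * cinv (chart_cont a b j) else a j.

Lemma chart_z_odd a b j : chart_z a b j.*2.+1 =
  ((if j is j'.+1 then b j' else 0) - b j) * cinv (chart_cont a b j).
Proof. by rewrite /chart_z /= odd_double doubleK. Qed.

Lemma chart_z_even a b j : chart_z a b j.*2.+2 = a j.
Proof. by rewrite /chart_z /= odd_double /= uphalf_double. Qed.

Lemma chart_contS a b j : chart_cont a b j.+1 = chart_cont a b j + a j * b j.
Proof. by rewrite /chart_cont big_ord_recr addrA. Qed.

(** Both identities go through one induction: b_j is recovered by cancelling E_j, and E_(j+1) is
    built from b_j. *)
Lemma chart_zK a b k : (forall j, (j < k)%N -> invertible (chart_cont a b j)) ->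
  (forall j, (j < k)%N -> odd_cont (chart_z a b) j = b j) /\
  (forall j, (j <= k)%N -> even_cont (chart_z a b) j = chart_cont a b j).
Proof.
elim: k => [_|k IH H].
  split=> // -[|//] _; by rewrite even_cont0 /chart_cont big_ord0 addr0.
have [|Ho He] := IH; first by move=> j jk; apply: H; apply: ltnW.
have ok : odd_cont (chart_z a b) k = b k.
  have Hk := H k (leqnn _).
  case: k {IH} H Ho He Hk => [|k] H Ho He Hk.
    by rewrite odd_cont0 (chart_z_odd a b 0) /chart_cont big_ord0 addr0
      (@cinv_uniq _ 1 1) ?mulr1 // sub0r opprK.
  rewrite odd_contS -doubleS (chart_z_odd a b k.+1) Ho // He // -mulrA mulVcr //; ring.
split=> j; first by rewrite ltnS leq_eqVlt => /orP[/eqP->|/Ho].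
rewrite leq_eqVlt ltnS => /orP[/eqP->|/He //].
by rewrite even_contS chart_contS /even_var chart_z_even ok He.
Qed.

Lemma chart_zE z k : (forall j, (j < k)%N -> invertible (even_cont z j)) ->
  forall n, (0 < n <= k.*2)%N -> chart_z (even_var z) (odd_cont z) n = z n.
Proof.
move=> H [//|n] /=; rewrite -[n]odd_double_half; case: (odd n); rewrite ?add1n ?add0n.
  by rewrite chart_z_even.
rewrite ltn_double => nk; rewrite chart_z_odd /chart_cont -even_contE.
move: (H _ nk); case: (n./2) => [|j] Hj.
  by rewrite odd_cont0 sub0r opprK even_cont0 (@cinv_uniq _ 1 1) ?mulr1.
by rewrite odd_contS opprB addrC subrK -mulrA mulrcV // mulr1.
Qed.

Lemma chart_z_eq a b a' b' k n :
  (forall j, (j < k)%N -> a j = a' j) -> (forall j, (j < k)%N -> b j = b' j) ->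
  (0 < n <= k.*2)%N -> chart_z a b n = chart_z a' b' n.
Proof.
move=> Ha Hb; case: n => [//|n] /=.
rewrite -[n]odd_double_half; case: (odd n); rewrite ?add1n ?add0n.
  by rewrite ltn_Sdouble !chart_z_even => /Ha.
rewrite ltn_double !chart_z_odd => nk; rewrite /chart_cont Hb //.
have -> : \sum_(i < n./2) a i * b i = \sum_(i < n./2) a' i * b' i.
  by apply: eq_bigr => i _; have ik := ltn_trans (ltn_ord i) nk; rewrite Ha ?Hb.
congr (_ * _); congr (_ - _); case: (n./2) nk => // j jk; exact/Hb/ltnW.
Qed.

End Continuant.

Lemma continuant_morph (R S : comNzRingType) (f : {rmorphism R -> S}) (z : nat -> R) n :
  f (continuant z n) = continuant (fun j => f (z j)) n.
Proof.
elim/ltn_ind: n => -[|[|n]] IH //=; first exact: rmorph1.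
by rewrite -!/(continuant _ _.+1) rmorphB rmorphM !IH.
Qed.

(** * All lengths even *)

Section Extend.
Variables (S : comNzRingType) (n : nat).

(** Extension by 0 to all of nat, so that partial sums and products up to n are available for
    induction on n. *)
Definition ext (F : 'I_n -> S) (j : nat) : S := oapp F 0 (insub j).

Lemma ext_ord F (j : 'I_n) : ext F j = F j.
Proof. by rewrite /ext valK. Qed.

Lemma ext_lt F j (jn : (j < n)%N) : ext F j = F (Ordinal jn).
Proof. by rewrite /ext insubT. Qed.

End Extend.

Lemma ext_morph (R S : comNzRingType) (f : {rmorphism R -> S}) n (F : 'I_n -> R) j :
  f (ext F j) = ext (fun i => f (F i)) j.
Proof. by rewrite /ext; case: insub => //=; rewrite rmorph0. Qed.

Section Telescope.
Variables (S : comNzRingType) (u : S) (f : nat -> S).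

(** The product of the 1 + u f_i, minus 1, divided by u, but written without division. It serves
    with u the coordinate of that name and with u = 1. *)
Definition telescope n := \sum_(i < n) f i * \prod_(j < i) (1 + u * f j).

Lemma prod_telescope n : \prod_(i < n) (1 + u * f i) = 1 + u * telescope n.
Proof.
elim: n => [|n IH]; first by rewrite /telescope !big_ord0 mulr0 addr0.
by rewrite big_ord_recr /= IH /telescope [in RHS]big_ord_recr /= -/(telescope n) IH; ring.
Qed.

End Telescope.

Local Arguments continuant : simpl never.

(** * The equations of X on points *)

Section StarPoints.
Variables (K : fieldType) (m : nat) (l : 'I_m -> nat) (eta : closed_point K l).
Local Notation kappa := (residue eta).
Local Notation T := (star_coord l).

Section Coordinates.
Variables (S : comNzRingType) (x : T -> S).
(** z_n sits at the ordinal n - 1, as in [zvar]; outside 1 <= n <= l a + 1 the value is junk, hence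
    the bounds on n in later statements. *)
Definition zseq (a : 'I_m) (n : nat) : S := x (inl (existT _ a (inord n.-1))).
Definition ucoord : S := x (inr false).
Definition wcoord : S := x (inr true).
End Coordinates.

Lemma ev_continuant (S : comNzRingType) (i : {rmorphism kappa -> S}) x a n :
  ev i x (continuant (zvar eta a) n) = continuant (zseq x a) n.
Proof.
rewrite continuant_morph; congr (continuant _ n).
by apply: functional_extensionality_dep => j; apply: ev_var.
Qed.

Lemma points_X (S : comNzRingType) (i : {rmorphism kappa -> S}) x :
  (forall f, X eta f -> ev i x f = 0) <->
  (forall a, continuant (zseq x a) (l a).+1 = i (lambda eta a) * ucoord x) /\
  ucoord x * wcoord x - \prod_a continuant (zseq x a) (l a) - i (mu eta) = 0.
Proof.
have FE a : ev i x (Feq eta a) = continuant (zseq x a) (l a).+1 - i (lambda eta a) * ucoord x.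
  by rewrite /Feq /uvar rmorphB rmorphM /= ev_continuant evC ev_var.
have GE : ev i x (Geq eta) = ucoord x * wcoord x
    - \prod_a continuant (zseq x a) (l a) - i (mu eta).
  rewrite /Geq /uvar /wvar !rmorphB rmorphM rmorph_prod /= evC !ev_var; congr (_ - _ - _).
  by apply: eq_bigr => a _; apply: ev_continuant.
split=> [H|[H1 H2] f [[a ->]| ->]].
- split=> [a|]; last by rewrite -GE; apply: H; right.
  by apply/eqP; rewrite -subr_eq0 -FE; apply/eqP/H; left; exists a.
- by rewrite FE H1 subrr.
- by rewrite GE.
Qed.

Lemma zseq_mk (S : comNzRingType) (x : T -> S) a (z : nat -> S) n :
  (forall j, x (inl (existT _ a j)) = z (nat_of_ord j).+1) -> (0 < n <= (l a).+1)%N ->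
  zseq x a n = z n.
Proof. by case: n => // n H /= Hn; rewrite /zseq H /= inordK. Qed.

Lemma star_coord_ext (S : Type) (x y : T -> S) :
  (forall a j, x (inl (existT _ a j)) = y (inl (existT _ a j))) ->
  x (inr false) = y (inr false) -> x (inr true) = y (inr true) -> x = y.
Proof.
move=> H1 H2 H3; apply: functional_extensionality_dep => -[[a j]|[]] //.
Qed.

End StarPoints.

(** * The chart at the origin for even lengths *)

Section EvenStar.
Variables (K : fieldType) (m : nat) (l : 'I_m -> nat) (eta : closed_point K l).
Variables (k : 'I_m -> nat).
Hypotheses (lk : forall a, l a = (k a).*2) (k0 : forall a, (0 < k a)%N).
Hypothesis muE : mu eta = - (-1) ^+ (\sum_(a < m) k a)%N.
Local Notation kappa := (residue eta).
Local Notation T := (star_coord l).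
(** The summand ['I_1] indexes the pair (u, w'), the other one the pairs (a_j, b_j) of all
    blocks. *)
Definition even_index := ('I_1 + {a : 'I_m & 'I_(k a)})%type.
Local Notation T' := (even_index * bool)%type.

Section Forward.
Variables (S : comNzRingType) (i : {rmorphism kappa -> S}).

(** The block without z_1: F_a has degree one in z_1, with slope P_l(y). *)
Definition yseq (x : T -> S) a := shift (zseq x a).

Definition gval (y : 'I_m -> nat -> S) a := even_cont (y a) (k a) - 1.
Definition uprod y (n : nat) := \prod_(j < n) (1 + ext (gval y) j).
Definition qprod (y : 'I_m -> nat -> S) := \prod_a continuant (y a) (l a).
(** Euler's identity and F_a give P_l(z) P_l(y) = 1 + u lambda P_(l-1)(y) in each block, so over all
    blocks these products multiply to 1 + u [wshift]. The multiple of u is absorbed into w' = w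
    [qprod] - [wshift]. *)
Definition wshift u (y : 'I_m -> nat -> S) :=
  telescope u (ext (fun a => i (lambda eta a) * continuant (y a) (l a).-1)) m.

Definition even_fw (x : T -> S) (t : T') : S :=
  match t with
  | (inl _, false) => ucoord x
  | (inl _, true) => wcoord x * qprod (yseq x) - wshift (ucoord x) (yseq x)
  | (inr (existT a j), false) => even_var (yseq x a) j
  | (inr (existT a j), true) => odd_cont (yseq x a) j * uprod (yseq x) a
  end.

Definition tseq (t : T' -> S) b a : nat -> S := ext (fun j : 'I_(k a) => t (inr (existT _ a j), b)).
Definition gsum t a (j : nat) := \sum_(i < j) tseq t false a i * tseq t true a i.
(** Becomes [uprod] under the chart: the target coordinates b_j already contain the unit, so the
    telescoping expansion of the product of the 1 + g_b is an ordinary sum of block forms. Hence the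
    units can be computed on the target. *)
Definition vsum t (n : nat) := 1 + \sum_(j < n) ext (fun a => gsum t a (k a)) j.
Definition hval t a j := vsum t (nat_of_ord a) + gsum t a j.
Definition ychart t a := chart_z (tseq t false a) (fun j => tseq t true a j * cinv (vsum t a)).
Definition even_z t a (n : nat) : S :=
  match n with
  | n'.+2 => ychart t a n'.+1
  | _ => (i (lambda eta a) * t (inl ord0, false) + continuant (shift (ychart t a)) (l a).-1)
           * cinv (continuant (ychart t a) (l a))
  end.

Definition even_bw (t : T' -> S) (c : T) : S :=
  match c with
  | inl (existT a j) => even_z t a j.+1
  | inr false => t (inl ord0, false)
  | inr true => (t (inl ord0, true) + wshift (t (inl ord0, false)) (ychart t)) * cinv (qprod (ychart t))
  end.

(** The bound includes j = k a: the last term is P_l(y) up to sign, and the inverse chart divides by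
    it to recover z_1 and w. *)
Definition even_src (x : T -> S) :=
  forall a j, (j <= k a)%N -> invertible (even_cont (yseq x a) j).
Definition even_tgt (t : T' -> S) :=
  forall a j, (j <= k a)%N -> invertible (hval t a j).

Lemma continuant_even (y : 'I_m -> nat -> S) a : continuant (y a) (l a) = (-1) ^+ k a * even_cont (y a) (k a).
Proof. by rewrite /even_cont lk mulrA -expr2 sqrr_sign mul1r. Qed.

Lemma uprodE y n : uprod y n = telescope 1 (ext (gval y)) n + 1.
Proof.
rewrite addrC -[telescope _ _ _]mul1r -prod_telescope.
by apply: eq_bigr => j _; rewrite mul1r.
Qed.

(** Here the value of mu enters: its sign turns each P_l(y) into 1 + g_a, so that no constant term
    is left in the equation of the cone. *)
Lemma qprodE y : i (mu eta) * qprod y = - uprod y m.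
Proof.
rewrite muE rmorphN rmorphXn rmorphN rmorph1 /qprod /uprod -prodrXr mulNr -big_split /=.
congr (- _); apply: eq_bigr => a _.
by rewrite ext_ord continuant_even /gval addrC subrK mulrA -expr2 sqrr_sign mul1r.
Qed.

Lemma big_even_index (F : even_index -> S) :
  \sum_j F j = F (inl ord0) + \sum_a \sum_(j < k a) F (inr (existT _ a j)).
Proof.
rewrite big_sumType big_ord1 /=; congr (_ + _).
rewrite (sig_big_dep (fun _ => true) (fun _ _ => true)
  (fun a (j : 'I_(k a)) => F (inr (existT _ a j)))) /=.
by apply: eq_bigr => -[a j] _.
Qed.

Lemma tseq_ord t b a (j : 'I_(k a)) : tseq t b a j = t (inr (existT _ a j), b).
Proof. exact: ext_ord. Qed.

Lemma quadricE t : \sum_j t (j, false) * t (j, true) =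
  t (inl ord0, false) * t (inl ord0, true) + (vsum t m - 1).
Proof.
rewrite big_even_index; congr (_ + _); rewrite /vsum addrC addKr.
by apply: eq_bigr => a _; rewrite ext_ord; apply: eq_bigr => j _; rewrite !tseq_ord.
Qed.

Lemma even_fw_seq x a j : (j < k a)%N ->
  tseq (even_fw x) false a j = even_var (yseq x a) j /\
  tseq (even_fw x) true a j = odd_cont (yseq x a) j * uprod (yseq x) a.
Proof. by move=> jk; rewrite /tseq !(ext_lt _ jk). Qed.

Lemma even_fw_gsum x a j : (j <= k a)%N ->
  gsum (even_fw x) a j = (even_cont (yseq x a) j - 1) * uprod (yseq x) a.
Proof.
move=> jk; rewrite even_contE addrC addKr mulr_suml; apply: eq_bigr => c _.
by have [-> ->] := even_fw_seq x (leq_trans (ltn_ord c) jk); rewrite mulrA.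
Qed.

Lemma even_fw_vsum x n : vsum (even_fw x) n = uprod (yseq x) n.
Proof.
rewrite uprodE addrC /vsum; congr (_ + _); apply: eq_bigr => j _.
have -> : \prod_(j0 < j) (1 + 1 * ext (gval (yseq x)) j0) = uprod (yseq x) j.
  by apply: eq_bigr => c _; rewrite mul1r.
rewrite /ext; case: insubP => [a _ <-|_] /=; last by rewrite mul0r.
by rewrite even_fw_gsum.
Qed.

Lemma even_fw_hval x a j : (j <= k a)%N ->
  hval (even_fw x) a j = uprod (yseq x) a * even_cont (yseq x a) j.
Proof. by move=> jk; rewrite /hval even_fw_vsum even_fw_gsum //; ring. Qed.

Lemma uprod_inv x n : even_src x -> invertible (uprod (yseq x) n).
Proof.
move=> H; apply: invertible_prod => j _; rewrite /ext; case: insubP => [a _ _|_] /=.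
  by rewrite /gval addrC subrK; apply: H.
by rewrite addr0; apply: invertible1.
Qed.

Lemma even_fw_tgt x : even_src x -> even_tgt (even_fw x).
Proof.
move=> H a j jk; rewrite even_fw_hval //; apply/invertibleM.
by split; [apply: uprod_inv | apply: H].
Qed.

Lemma yseq_cont_inv x a : even_src x -> invertible (continuant (yseq x a) (l a)).
Proof.
move=> H; rewrite continuant_even; apply/invertibleM.
by split; [apply: invertible_sign | apply: H].
Qed.

Lemma qprod_inv x : even_src x -> invertible (qprod (yseq x)).
Proof. by move=> H; apply: invertible_prod => a _; apply: yseq_cont_inv. Qed.

Definition Feqs (x : T -> S) := forall a, continuant (zseq x a) (l a).+1 = i (lambda eta a) * ucoord x.

(** Multiplying G by [qprod] makes Euler's identity applicable in every block at once. *)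
Lemma even_fw_quadric x : Feqs x ->
  \sum_j even_fw x (j, false) * even_fw x (j, true) =
  qprod (yseq x) * (ucoord x * wcoord x - \prod_a continuant (zseq x a) (l a) - i (mu eta)).
Proof.
move=> HF; rewrite quadricE even_fw_vsum /=.
have -> : qprod (yseq x) * (ucoord x * wcoord x - \prod_a continuant (zseq x a) (l a) - i (mu eta)) =
    ucoord x * (wcoord x * qprod (yseq x))
     - \prod_a continuant (zseq x a) (l a) * qprod (yseq x)
     - i (mu eta) * qprod (yseq x) by ring.
rewrite qprodE /qprod -big_split /=.
have -> : \prod_a (continuant (zseq x a) (l a) * continuant (yseq x a) (l a)) =
    1 + ucoord x * wshift (ucoord x) (yseq x).
  rewrite -prod_telescope; apply: eq_bigr => a _; rewrite ext_ord.
  have l0 : (0 < l a)%N by rewrite lk double_gt0.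
  have := continuant_euler (zseq x a) (l a).-1; rewrite prednK // => ->.
  by rewrite HF; congr (1 + _); rewrite mulrA [i _ * _]mulrC -mulrA.
by ring.
Qed.

Section Backward.
Variable t : T' -> S.
Hypothesis Ht : even_tgt t.

Lemma vsum_inv (a : 'I_m) : invertible (vsum t a).
Proof. by have := @Ht a 0%N isT; rewrite /hval /gsum big_ord0 addr0. Qed.

Lemma ychart_cont a j : chart_cont (tseq t false a) (fun j => tseq t true a j * cinv (vsum t a)) j =
  hval t a j * cinv (vsum t a).
Proof.
rewrite /hval mulrDl mulrcV; last exact: vsum_inv.
by rewrite /gsum mulr_suml; congr (_ + _); apply: eq_bigr => c _; rewrite mulrA.
Qed.

Lemma invertible_cinv (x : S) : invertible x -> invertible (cinv x).
Proof. by move=> H; exists x; apply: mulVcr. Qed.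

Lemma ychart_inv a j : (j <= k a)%N ->
  invertible (chart_cont (tseq t false a) (fun j => tseq t true a j * cinv (vsum t a)) j).
Proof.
move=> jk; rewrite ychart_cont; apply/invertibleM.
by split; [apply: Ht | apply/invertible_cinv/vsum_inv].
Qed.

Lemma ychartK a :
  (forall j, (j < k a)%N -> odd_cont (ychart t a) j = tseq t true a j * cinv (vsum t a)) /\
  (forall j, (j <= k a)%N -> even_cont (ychart t a) j = hval t a j * cinv (vsum t a)).
Proof.
have [|H1 H2] := @chart_zK S (tseq t false a) (fun j => tseq t true a j * cinv (vsum t a)) (k a).
  by move=> j jk; apply/ychart_inv/ltnW.
by split=> // j jk; rewrite H2 // ychart_cont.
Qed.

Lemma zseq_bw a n : (0 < n <= (l a).+1)%N -> zseq (even_bw t) a n = even_z t a n.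
Proof. exact: zseq_mk. Qed.

Lemma yseq_bw a n : (0 < n <= l a)%N -> yseq (even_bw t) a n = ychart t a n.
Proof. by case: n => // n Hn; rewrite /yseq /shift zseq_bw. Qed.

Lemma continuant_bw a n : (n <= l a)%N ->
  continuant (yseq (even_bw t) a) n = continuant (ychart t a) n.
Proof.
move=> nl; apply: eq_continuant => j /andP[j0 jn].
by apply: yseq_bw; rewrite j0 (leq_trans jn).
Qed.

Lemma even_cont_bw a j : (j <= k a)%N ->
  even_cont (yseq (even_bw t) a) j = hval t a j * cinv (vsum t a).
Proof.
move=> jk; rewrite -(proj2 (ychartK a)) // /even_cont continuant_bw //.
by rewrite lk leq_double.
Qed.

Lemma odd_cont_bw a j : (j < k a)%N ->
  odd_cont (yseq (even_bw t) a) j = tseq t true a j * cinv (vsum t a).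
Proof.
move=> jk; rewrite -(proj1 (ychartK a)) // /odd_cont continuant_bw //.
by rewrite lk ltn_double.
Qed.

Lemma even_bw_src : even_src (even_bw t).
Proof.
move=> a j jk; rewrite even_cont_bw //; apply/invertibleM.
by split; [apply: Ht | apply/invertible_cinv/vsum_inv].
Qed.

Lemma uprod_bw n : (n <= m)%N -> uprod (yseq (even_bw t)) n = vsum t n.
Proof.
elim: n => [_|n IH nm]; first by rewrite /uprod /vsum !big_ord0 addr0.
rewrite /uprod big_ord_recr /= -/(uprod _ n) IH ?(ltnW nm) //.
rewrite /vsum big_ord_recr /= addrA -/(vsum t n) !(ext_lt _ nm).
rewrite /gval [1 + _]addrC subrK even_cont_bw // /hval /=.
by rewrite mulrCA mulrcV ?mulr1 //; apply: (vsum_inv (Ordinal nm)).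
Qed.

Lemma Feqs_bw : Feqs (even_bw t).
Proof.
move=> a; have l0 : (1 <= l a)%N by rewrite lk double_gt0.
rewrite -[in X in continuant _ X](prednK l0) continuant_shift (prednK l0).
rewrite -/(yseq _ a) continuant_bw // zseq_bw // [X in _ - X](@eq_continuant _ _ (shift (ychart t a))); last first.
  move=> j /andP[j0 jn]; apply: yseq_bw; rewrite /=.
  by apply: leq_ltn_trans jn _; rewrite prednK.
rewrite /= -mulrA mulVcr ?mulr1 ?addrK //.
by rewrite -continuant_bw //; apply: yseq_cont_inv even_bw_src.
Qed.

Lemma qprod_bw : qprod (yseq (even_bw t)) = qprod (ychart t).
Proof. by apply: eq_bigr => a _; apply: continuant_bw. Qed.

Lemma wshift_bw u : wshift u (yseq (even_bw t)) = wshift u (ychart t).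
Proof.
congr (telescope u _ m); apply: functional_extensionality_dep => j; congr (oapp _ _ _).
by apply: functional_extensionality_dep => a; rewrite continuant_bw // leq_pred.
Qed.

Lemma even_bwK : even_fw (even_bw t) = t.
Proof.
apply: functional_extensionality_dep => -[[c|[a j]] []] /=.
- rewrite (ord1 c) wshift_bw qprod_bw -mulrA mulVcr ?mulr1 ?addrK //.
  by rewrite -qprod_bw; apply: qprod_inv even_bw_src.
- by rewrite (ord1 c).
- rewrite odd_cont_bw // uprod_bw; last exact: ltnW.
  by rewrite -mulrA mulVcr ?mulr1 ?tseq_ord //; apply: vsum_inv.
- have Hj : (0 < j.*2.+2 <= l a)%N by rewrite lk /= ltn_Sdouble.
  by rewrite /even_var yseq_bw // /ychart chart_z_even tseq_ord.
Qed.

End Backward.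

Lemma even_fwK x : even_src x -> Feqs x -> even_bw (even_fw x) = x.
Proof.
move=> Hx HF; have Ht := even_fw_tgt Hx.
have yE a n : (0 < n <= l a)%N -> ychart (even_fw x) a n = yseq x a n.
  rewrite lk => Hn; rewrite -(@chart_zE _ (yseq x a) (k a)) //; last first.
    by move=> j jk; apply/Hx/ltnW.
  apply: (@chart_z_eq _ _ _ _ _ (k a)) => // j jk; have [e1 e2] := even_fw_seq x jk.
    exact: e1.
  by rewrite e2 even_fw_vsum -mulrA mulrcV ?mulr1 //; apply: uprod_inv.
have cE a n : (n <= l a)%N -> continuant (ychart (even_fw x) a) n = continuant (yseq x a) n.
  move=> nl; apply: eq_continuant => j /andP[j0 jn].
  by apply: yE; rewrite j0 (leq_trans jn).
apply: star_coord_ext => [a j||] //.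
  have zE n : (0 < n <= (l a).+1)%N -> even_z (even_fw x) a n = zseq x a n.
    case: n => [//|[_|n Hn]] /=; last by rewrite yE.
    have l0 : (1 <= l a)%N by rewrite lk double_gt0.
    rewrite -HF cE // -[in X in continuant _ X](prednK l0) continuant_shift (prednK l0).
    rewrite -/(yseq _ a) (@eq_continuant _ (shift (ychart _ _)) (shift (yseq x a))).
      by rewrite subrK -mulrA mulrcV ?mulr1 //; apply: yseq_cont_inv.
    move=> c /andP[c0 cn]; apply: yE; rewrite /=.
    by apply: leq_ltn_trans cn _; rewrite prednK.
  by rewrite [LHS]zE; [rewrite /zseq /= inord_val | exact: ltn_ord].
rewrite /=; have -> : wshift (ucoord x) (ychart (even_fw x)) = wshift (ucoord x) (yseq x).
  congr (telescope _ _ m); apply: functional_extensionality_dep => j; congr (oapp _ _ _).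
  by apply: functional_extensionality_dep => a; rewrite cE // leq_pred.
have -> : qprod (ychart (even_fw x)) = qprod (yseq x) by apply: eq_bigr => a _; apply: cE.
by rewrite subrK -mulrA mulrcV ?mulr1 //; apply: qprod_inv.
Qed.

Lemma continuant_odd0 (z : nat -> S) n : (forall j, (0 < j <= n.*2.+1)%N -> z j = 0) ->
  continuant z n.*2.+1 = 0.
Proof.
elim: n => [|n IH] H; first exact: H.
rewrite doubleS continuantSS IH ?subr0 ?H ?mul0r //= ?leqnn // => j /andP[j0 jn].
by apply: H; rewrite j0 doubleS; apply: leq_trans jn _; apply: leqW.
Qed.

Lemma wshift0 u (y : 'I_m -> nat -> S) :
  (forall a j, (0 < j <= l a)%N -> y a j = 0) -> wshift u y = 0.
Proof.
move=> H; rewrite /wshift /telescope big1 // => j _.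
rewrite /ext insubT //= => jm; rewrite lk; have := k0 (Sub (nat_of_ord j) jm).
case e: (k _) => [//|n] _; rewrite doubleS /= continuant_odd0 ?mulr0 ?mul0r // => c /andP[c0 cn].
apply: H; rewrite c0 lk /= ; move: e => /= ->; rewrite doubleS; exact: leqW.
Qed.

Lemma even_fw0 x : even_src x -> Feqs x ->
  (forall c, x c = 0) <-> (forall t, even_fw x t = 0).
Proof.
move=> Hx HF; split=> [x0|t0].
  have z0 a n : zseq x a n = 0 by apply: x0.
  case=> [[c|[a j]] []] /=.
  - by rewrite /wcoord x0 mul0r wshift0 ?subr0 // => a j _; apply: z0.
  - exact: x0.
  - by rewrite /odd_cont continuant_odd0 ?mulr0 ?mul0r // => n _; apply: z0.
  - exact: z0.
have y0 a n : (0 < n <= l a)%N -> yseq x a n = 0.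
  rewrite lk => Hn; rewrite -(@chart_zE _ (yseq x a) (k a)) //; last first.
    by move=> j jk; apply/Hx/ltnW.
  have odd0 j : (j < k a)%N -> odd_cont (yseq x a) j = 0.
    move=> jk; have := t0 (inr (existT _ a (Ordinal jk)), true) => /= e.
    by apply: (mulcI (uprod_inv a Hx)); rewrite mulr0 mulrC.
  have even0 j : (j < k a)%N -> even_var (yseq x a) j = 0.
    by move=> jk; apply: t0 (inr (existT _ a (Ordinal jk)), false).
  rewrite (@chart_z_eq _ _ _ (fun=> 0) (fun=> 0) (k a)) // /chart_z.
  by case: ifP => // _; case: (n.-1./2) => [|c]; rewrite subr0 mul0r.
have u0 : ucoord x = 0 := t0 (inl ord0, false).
have w0 : wcoord x = 0.
  have := t0 (inl ord0, true); rewrite /= wshift0 // subr0 mulrC => e.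
  by apply: (mulcI (qprod_inv Hx)); rewrite mulr0.
(* With u = 0 and y = 0 the equation F_a reduces to z_1 P_l(y) = 0, where P_l(y) is invertible. *)
have z0 a : x (inl (existT _ a ord0)) = 0.
  have -> : x (inl (existT _ a ord0)) = zseq x a 1.
    by rewrite /zseq /=; congr (x (inl (existT _ a _))); apply: val_inj; rewrite /= inordK.
  apply: (mulcI (yseq_cont_inv a Hx)); rewrite mulr0.
  have := HF a; rewrite u0 mulr0.
  have l0 : (1 <= l a)%N by rewrite lk double_gt0.
  rewrite -[in X in continuant _ X](prednK l0) continuant_shift (prednK l0) -/(yseq x a).
  have -> : continuant (shift (yseq x a)) (l a).-1 = 0; last by rewrite subr0 mulrC.
  rewrite lk; case e: (k a) (k0 a) => [//|n] _; rewrite doubleS /=.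
  apply: continuant_odd0 => j /andP[j0 jn]; apply: y0; rewrite lk e doubleS /=.
  by rewrite ltnS.
case=> [[a [[|j] jl]]|[]] //.
  by rewrite -[RHS](z0 a); congr (x (inl (existT _ a _))); apply: val_inj.
rewrite -[RHS](y0 a j.+1); last by rewrite /= -ltnS.
by rewrite /yseq /shift /zseq /=; congr (x (inl (existT _ a _))); apply: val_inj; rewrite /= inordK.
Qed.

End Forward.

Section Morph.
Variables (R S : comNzRingType) (f : {rmorphism R -> S}).

Lemma even_cont_morph (z : nat -> R) j :
  f (even_cont z j) = even_cont (fun n => f (z n)) j.
Proof. by rewrite /even_cont rmorphM rmorphXn rmorphN rmorph1 continuant_morph. Qed.

Lemma odd_cont_morph (z : nat -> R) j :
  f (odd_cont z j) = odd_cont (fun n => f (z n)) j.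
Proof. by rewrite /odd_cont rmorphM rmorphXn rmorphN rmorph1 continuant_morph. Qed.

Lemma uprod_morph (y : 'I_m -> nat -> R) n :
  f (uprod y n) = uprod (fun a j => f (y a j)) n.
Proof.
rewrite rmorph_prod; apply: eq_bigr => j _; rewrite rmorphD rmorph1 ext_morph.
congr (1 + oapp _ _ _); apply: functional_extensionality_dep => a.
by rewrite /gval rmorphB rmorph1 even_cont_morph.
Qed.

Lemma qprod_morph (y : 'I_m -> nat -> R) :
  f (qprod y) = qprod (fun a j => f (y a j)).
Proof. by rewrite rmorph_prod; apply: eq_bigr => a _; rewrite continuant_morph. Qed.

Lemma wshift_morph (i : {rmorphism kappa -> R}) (i' : {rmorphism kappa -> S}) u y :
  (forall a, i' a = f (i a)) ->
  f (wshift i u y) = wshift i' (f u) (fun a j => f (y a j)).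
Proof.
move=> Hi.
have E (j : nat) :
    f (ext (fun a => i (lambda eta a) * continuant (y a) (l a).-1) j) =
    ext (fun a => i' (lambda eta a) * continuant (fun n => f (y a n)) (l a).-1) j.
  rewrite ext_morph; congr (oapp _ _ _); apply: functional_extensionality_dep => a.
  by rewrite rmorphM continuant_morph Hi.
rewrite rmorph_sum; apply: eq_bigr => j _; rewrite rmorphM E rmorph_prod; congr (_ * _).
by apply: eq_bigr => c _; rewrite rmorphD rmorph1 rmorphM E.
Qed.

Lemma even_fw_morph (i : {rmorphism kappa -> R}) (i' : {rmorphism kappa -> S}) x :
  (forall a, i' a = f (i a)) ->
  even_fw i' (fun c => f (x c)) = fun t => f (even_fw i x t).
Proof.
move=> Hi; apply: functional_extensionality_dep => -[[c|[a j]] []] //=.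
  by rewrite rmorphB rmorphM qprod_morph (wshift_morph _ _ Hi).
by rewrite rmorphM odd_cont_morph uprod_morph.
Qed.

Lemma gsum_morph t a j : f (gsum t a j) = gsum (fun c => f (t c)) a j.
Proof.
rewrite rmorph_sum; apply: eq_bigr => c _; rewrite rmorphM.
by rewrite /tseq !ext_morph.
Qed.

Lemma hval_morph t a j : f (hval t a j) = hval (fun c => f (t c)) a j.
Proof.
rewrite rmorphD gsum_morph; congr (_ + _); rewrite rmorphD rmorph1 rmorph_sum; congr (_ + _).
apply: eq_bigr => c _; rewrite ext_morph; congr (oapp _ _ _).
by apply: functional_extensionality_dep => b; apply: gsum_morph.
Qed.

End Morph.

(** A basic open set is given by a single function, so all the invertibility conditions are gathered
    in one product. *)
Definition even_src_poly : polyring kappa T :=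
  \prod_a \prod_(j < (k a).+1) even_cont (yseq (fun c : T => var kappa c) a) j.
Definition even_tgt_poly : polyring kappa T' :=
  \prod_a \prod_(j < (k a).+1) hval (fun c : T' => var kappa c) a j.

Lemma ev_vars (U : finType) (S : comNzRingType) (i : {rmorphism kappa -> S}) (x : U -> S) :
  (fun c => ev i x (var kappa c)) = x.
Proof. by apply: functional_extensionality_dep => c; apply: ev_var. Qed.

Lemma even_src_polyP (S : comNzRingType) (i : {rmorphism kappa -> S}) x :
  invertible (ev i x even_src_poly) <-> even_src x.
Proof.
rewrite rmorph_prod invertible_prodP; split=> H a.
  move=> j jk; have jk' : (j < (k a).+1)%N by [].
  have := H a; rewrite rmorph_prod => /invertible_prodP/(_ (Ordinal jk')).
  rewrite even_cont_morph; congr (invertible (even_cont _ _)).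
  by apply: functional_extensionality_dep => n; apply: ev_var.
rewrite rmorph_prod; apply/invertible_prodP => j; rewrite even_cont_morph.
have := H a j (ltn_ord j); congr (invertible (even_cont _ _)).
by apply: functional_extensionality_dep => n; apply/esym/ev_var.
Qed.

Lemma even_tgt_polyP (S : comNzRingType) (i : {rmorphism kappa -> S}) t :
  invertible (ev i t even_tgt_poly) <-> even_tgt t.
Proof.
rewrite rmorph_prod invertible_prodP; split=> H a.
  move=> j jk; have jk' : (j < (k a).+1)%N by [].
  have := H a; rewrite rmorph_prod => /invertible_prodP/(_ (Ordinal jk')).
  by rewrite hval_morph ev_vars.
rewrite rmorph_prod; apply/invertible_prodP => j; rewrite hval_morph ev_vars.
exact: H (ltn_ord j).
Qed.

Lemma points_evenP (S : comNzRingType) (i : {rmorphism kappa -> S}) x :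
  points (X eta) even_src_poly i x <-> 
  [/\ Feqs i x, ucoord x * wcoord x - \prod_a continuant (zseq x a) (l a) - i (mu eta) = 0
    & even_src x].
Proof. by rewrite /points points_X even_src_polyP; split=> [[[]]|[]]. Qed.

Lemma points_quadricP (S : comNzRingType) (i : {rmorphism kappa -> S}) t :
  points (eq (quadric kappa even_index)) even_tgt_poly i t <->
  \sum_j t (j, false) * t (j, true) = 0 /\ even_tgt t.
Proof.
rewrite /points even_tgt_polyP -(ev_quadric i).
split=> -[H1 H2]; split=> //; first exact: (H1 _ erefl).
by move=> _ <-.
Qed.

Definition even_iso : functor_iso (points (X eta) even_src_poly)
  (points (eq (quadric kappa even_index)) even_tgt_poly).
Proof.
refine (@FunctorIso kappa T T' _ _ (fun S i x => even_fw i x) (fun S i t => even_bw i t) _ _ _ _ _).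
- move=> S i x /points_evenP[HF HG Hx]; apply/points_quadricP; split.
    by rewrite even_fw_quadric // HG mulr0.
  exact: even_fw_tgt.
- move=> S i t /points_quadricP[Hq Ht]; apply/points_evenP.
  have HF := Feqs_bw i Ht; have Hs := even_bw_src i Ht; split=> //.
  apply: (mulcI (qprod_inv Hs)).
  by rewrite -even_fw_quadric // even_bwK // Hq mulr0.
- by move=> S i x /points_evenP[HF _ Hx]; apply: even_fwK.
- by move=> S i t /points_quadricP[_ Ht]; apply: even_bwK.
- by move=> S S' f i i' x Hi _; apply: even_fw_morph.
Defined.

Lemma even_cont_zero (S : comNzRingType) j : even_cont (fun _ => 0 : S) j = 1.
Proof.
rewrite even_contE big1 ?addr0 // => c _; by rewrite /even_var mul0r.
Qed.

Theorem even_star_A1 : A1_singularity (X eta) (origin kappa T).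
Proof.
have ev0 f : origin kappa T f <-> ev (idfun : {rmorphism kappa -> kappa}) (fun=> 0) f = 0 by [].
have src0 : even_src (fun _ : T => 0 : kappa).
  by move=> a j _; rewrite [even_cont _ _]even_cont_zero; apply: invertible1.
apply: (split_cone_A1 (F := even_iso)).
- by rewrite card_sum card_ord.
- by move=> S i x /points_evenP[HF _ Hx]; apply: even_fw0.
- split; first exact: origin_prime.
  move=> f Xf; apply/ev0; move: f Xf; apply/points_X; split=> [a|].
    by rewrite lk continuant_odd0 ?mulr0.
  (* At the origin each P_l is (-1)^k_a, so the product in G is the sign that mu cancels. *)
  rewrite mul0r sub0r /= muE opprK addrC; apply/eqP; rewrite subr_eq0 -prodrXr; apply/eqP.
  apply: eq_bigr => a _; rewrite [RHS](continuant_even (fun a => zseq (fun=> 0) a)).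
  by rewrite [even_cont _ _]even_cont_zero mulr1.
move=> /ev0 H; have /even_src_polyP := src0.
by move=> /(_ (idfun : {rmorphism kappa -> kappa})); rewrite H => -[y]; rewrite mul0r => /esym/eqP; rewrite oner_eq0.
Qed.

End EvenStar.

(** * Compatible blocks *)

Section PartialContinuant.
Variable S : comNzRingType.
Implicit Types z : nat -> S.

Definition upd z (j : nat) (s : S) : nat -> S := fun n => if n == j then s else z n.

(* The partial derivative of the continuant, which is affine in each variable. *)
Definition dcont z n j := continuant (upd z j 1) n - continuant (upd z j 0) n.

Lemma upd_neq z j s n : n != j -> upd z j s n = z n.
Proof. by rewrite /upd => /negPf->. Qed.

Lemma continuant_upd_gt z n j s : (n < j)%N -> continuant (upd z j s) n = continuant z n.
Proof.
move=> nj; apply: eq_continuant => c /andP[_ cn]; apply: upd_neq.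
by rewrite neq_ltn (leq_ltn_trans cn nj).
Qed.

Lemma dcont_gt z n j : (n < j)%N -> dcont z n j = 0.
Proof. by move=> nj; rewrite /dcont !continuant_upd_gt // subrr. Qed.

Lemma dcont_last z n : dcont z n.+1 n.+1 = continuant z n.
Proof.
case: n => [|n]; first by rewrite /dcont /continuant /upd /= subr0.
rewrite /dcont !continuantSS !continuant_upd_gt // /upd eqxx; ring.
Qed.

Lemma dcontSS z n j : j != n.+2 ->
  dcont z n.+2 j = z n.+2 * dcont z n.+1 j - dcont z n j.
Proof. by move=> jn; rewrite /dcont !continuantSS !upd_neq 1?eq_sym //; ring. Qed.

Lemma continuant_affine z n j : (0 < j <= n)%N ->
  continuant z n = z j * dcont z n j + continuant (upd z j 0) n.
Proof.
elim/ltn_ind: n => -[|[|n]] IH.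
- by move=> /andP[]; case: ltngtP.
- move=> /andP[j0 j1]; have -> : j = 1%N by apply/eqP; rewrite eqn_leq j1 j0.
  by rewrite dcont_last /continuant /upd /= mulr1 addr0.
have [-> _|jn /andP[j0]] := eqVneq j n.+2.
  by rewrite dcont_last !continuantSS !continuant_upd_gt // /upd eqxx; ring.
rewrite leq_eqVlt (negPf jn) /= ltnS => jn1.
rewrite dcontSS // continuantSS (IH n.+1) ?j0 // (continuantSS (upd z j 0) n) upd_neq 1?eq_sym //.
move: jn1; rewrite leq_eqVlt => /orP[/eqP e|]; last first.
  by rewrite ltnS => jn1; rewrite (IH n) ?j0 //; ring.
by rewrite (@dcont_gt z n j) ?e // (@continuant_upd_gt z n) //; ring.
Qed.

Lemma eq_dcont z z' n j : (forall c, (0 < c <= n)%N -> c != j -> z c = z' c) ->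
  dcont z n j = dcont z' n j.
Proof.
move=> H; rewrite /dcont; congr (_ - _); apply: eq_continuant => c Hc;
  by rewrite /upd; case: eqP => // /eqP; apply: H.
Qed.

(** Used to see that a chart with a pivot never meets the zero block. *)
Lemma dcont_even0 n j : dcont (fun=> 0) n.*2 j = 0.
Proof.
elim: n => [|n IH]; first by rewrite /dcont /continuant subrr.
rewrite doubleS; have [->|jn] := eqVneq j n.*2.+2; last by rewrite dcontSS // mul0r IH subr0.
by rewrite dcont_last; apply: continuant_odd0.
Qed.

End PartialContinuant.

Lemma dcont_morph (R S : comNzRingType) (f : {rmorphism R -> S}) (z : nat -> R) n j :
  f (dcont z n j) = dcont (fun c => f (z c)) n j.
Proof.
rewrite /dcont rmorphB !continuant_morph; congr (continuant _ n - continuant _ n);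
  by apply: functional_extensionality_dep => c; rewrite /upd; case: ifP; rewrite ?rmorph1 ?rmorph0.
Qed.

(* The continuant is smooth away from the origin. *)
Lemma dcont_critical (L : fieldType) (z : nat -> L) n :
  (forall j, (0 < j <= n)%N -> dcont z n j = 0) ->
  ~~ odd n /\ forall j, (0 < j <= n)%N -> z j = 0.
Proof.
elim/ltn_ind: n => -[|[|n]] IH H.
- by split=> // -[].
- by have := H 1%N isT; rewrite dcont_last => /eqP; rewrite oner_eq0.
have e1 : continuant z n.+1 = 0 by rewrite -dcont_last; apply: H; rewrite leqnn.
(* Two consecutive continuants never vanish together: the recursion would carry the zero down to P_0
   = 1. *)
have e0 : continuant z n != 0.
  have nz c : (continuant z c.+1 == 0) && (continuant z c == 0) = false.
    elim: c => [|c IHc]; first by rewrite [continuant z 0]/continuant oner_eq0 andbF.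
    apply/negP => /andP[/eqP]; rewrite continuantSS => + /eqP e; rewrite e mulr0 sub0r.
    by move=> /eqP; rewrite oppr_eq0 => Hc; move: IHc; rewrite e eqxx Hc.
  by have := nz n; rewrite e1 eqxx => /= ->.
have zn : z n.+2 = 0.
  have := H n.+1; rewrite /= ltnS leqnSn => /(_ isT); rewrite dcontSS ?ltn_eqF //.
  by rewrite dcont_last dcont_gt // subr0 => /eqP; rewrite mulf_eq0 (negPf e0) orbF => /eqP.
(* With z_(n+2) = 0, the partial derivatives of P_(n+2) in the first n variables are minus those of
   P_n. *)
have [||on zj] := IH n; first exact: leqnSn.
  move=> j /andP[j0 jn]; have jn2 : (j < n.+2)%N by rewrite ltnS (leq_trans jn).
  have := H j; rewrite j0 ltnW // => /(_ isT).
  rewrite dcontSS ?ltn_eqF // zn mul0r sub0r => /eqP.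
  by rewrite oppr_eq0 => /eqP.
split; first by rewrite /= negbK.
(* As n is even and z_1, ..., z_n vanish, P_(n-1) = 0, so P_(n+1) = 0 reads z_(n+1) P_n = 0; for n =
   0 it is z_1 = 0 directly. *)
have zn1 : z n.+1 = 0.
  case: n {IH H zn} e1 e0 on zj => [|n] // e1 e0 on zj.
  move: e1; rewrite continuantSS.
  have -> : continuant z n = 0; last first.
    by rewrite subr0 => /eqP; rewrite mulf_eq0 (negPf e0) orbF => /eqP.
  have odn : odd n by move: on; rewrite /= negbK.
  have e : n./2.*2.+1 = n by rewrite -[RHS]odd_double_half odn add1n.
  have := @continuant_odd0 L z n./2; rewrite e; apply => j /andP[j0 jn].
  by apply: zj; rewrite j0 (leq_trans jn).
move=> j /andP[j0]; rewrite leq_eqVlt => /orP[/eqP->//|]; rewrite ltnS leq_eqVlt => /orP[/eqP->//|].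
by rewrite ltnS => jn; apply: zj; rewrite j0.
Qed.

Section Restrict.
Variables (k : fieldType) (T T' : finType).
Variables (P Q : functor k T) (P' Q' : functor k T') (F : functor_iso P P').
Hypothesis QP : forall (S : comNzRingType) (i : {rmorphism k -> S}) (x : T -> S), @Q S i x -> @P S i x.
Hypothesis QP' : forall (S : comNzRingType) (i : {rmorphism k -> S}) (x : T' -> S), @Q' S i x -> @P' S i x.
Hypothesis QQ' : forall (S : comNzRingType) (i : {rmorphism k -> S}) (x : T -> S), @P S i x -> (@Q S i x <-> @Q' S i (fw F i x)).

Definition functor_iso_restrict : functor_iso Q Q'.
Proof.
refine (@FunctorIso k T T' Q Q' (@fw _ _ _ _ _ F) (@bw _ _ _ _ _ F) _ _ _ _ _).
- by move=> S i x H; apply/(QQ' (QP H)).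
- by move=> S i x H; apply/(QQ' (bw_pt F (QP' H))); rewrite (bwK F (QP' H)).
- by move=> S i x H; exact: (fwK F (QP H)).
- by move=> S i x H; exact: (bwK F (QP' H)).
- by move=> S S' f i i' x Hi H; exact: (fw_nat F Hi (QP H)).
Defined.

End Restrict.

(** * A continuant as a coordinate *)

Section Pivot.
Variables (k : fieldType) (n : nat) (i0 : 'I_n.+1).

Definition seqf (S : comNzRingType) (z : 'I_n.+1 -> S) (c : nat) : S := z (inord c.-1).

Lemma seqf_ord (S : comNzRingType) (z : 'I_n.+1 -> S) (j : 'I_n.+1) : seqf z j.+1 = z j.
Proof. by rewrite /seqf /= inord_val. Qed.

Lemma seqf_mk (S : comNzRingType) (z : 'I_n.+1 -> S) (f : nat -> S) c :
  (forall j : 'I_n.+1, z j = f j.+1) -> (0 < c <= n.+1)%N -> seqf z c = f c.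
Proof. by case: c => // c H /= Hc; rewrite /seqf H /= inordK. Qed.

(** [None] holds the value of the continuant, which takes the place of the coordinate i0. The
    continuant is affine in that coordinate, with a slope free of it. *)
Definition pivot_fw (S : comNzRingType) (i : {rmorphism k -> S}) (z : 'I_n.+1 -> S)
  (c : option 'I_n) : S :=
  if c is Some j then z (lift i0 j) else continuant (seqf z) n.+1.

Definition pivot0 (S : comNzRingType) (y : option 'I_n -> S) (j : 'I_n.+1) : S :=
  oapp (fun j' => y (Some j')) 0 (unlift i0 j).

Definition pivot_bw (S : comNzRingType) (i : {rmorphism k -> S}) (y : option 'I_n -> S)
  (j : 'I_n.+1) : S :=
  if j == i0 then (y None - continuant (seqf (pivot0 y)) n.+1)
    * cinv (dcont (seqf (pivot0 y)) n.+1 i0.+1)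
  else pivot0 y j.

Definition pivot_src : functor k 'I_n.+1 :=
  fun S _ z => invertible (dcont (seqf z) n.+1 i0.+1).
Definition pivot_tgt : functor k (option 'I_n) :=
  fun S _ y => invertible (dcont (seqf (pivot0 y)) n.+1 i0.+1).

Lemma pivot0_i0 (S : comNzRingType) (y : option 'I_n -> S) : pivot0 y i0 = 0.
Proof. by rewrite /pivot0 unlift_none. Qed.

Lemma upd_pivot (S : comNzRingType) (z : 'I_n.+1 -> S) y :
  (forall j, j != i0 -> z j = pivot0 y j) ->
  forall c, (0 < c <= n.+1)%N -> upd (seqf z) i0.+1 0 c = seqf (pivot0 y) c.
Proof.
move=> H [//|c] /= Hc; rewrite /upd eqSS; case: eqP => [->|/eqP ci].
  by rewrite seqf_ord pivot0_i0.
rewrite /seqf /= H //; apply: contraNneq ci => /(congr1 val) /=.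
by rewrite inordK // => ->.
Qed.

Lemma dcont_pivot (S : comNzRingType) (z : 'I_n.+1 -> S) y :
  (forall j, j != i0 -> z j = pivot0 y j) ->
  dcont (seqf z) n.+1 i0.+1 = dcont (seqf (pivot0 y)) n.+1 i0.+1.
Proof.
move=> H; apply: eq_dcont => c Hc ci; rewrite -(upd_pivot H) //.
by rewrite upd_neq.
Qed.

Lemma continuant_pivot (S : comNzRingType) (z : 'I_n.+1 -> S) y :
  (forall j, j != i0 -> z j = pivot0 y j) ->
  continuant (seqf z) n.+1 =
  z i0 * dcont (seqf (pivot0 y)) n.+1 i0.+1 + continuant (seqf (pivot0 y)) n.+1.
Proof.
move=> H; rewrite (@continuant_affine _ _ _ i0.+1) ?seqf_ord ?(dcont_pivot H); last first.
  exact: ltn_ord.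
by congr (_ + _); apply: eq_continuant; apply: upd_pivot.
Qed.

Lemma pivot0_fw (S : comNzRingType) (i : {rmorphism k -> S}) (z : 'I_n.+1 -> S) j :
  j != i0 -> z j = pivot0 (pivot_fw i z) j.
Proof.
rewrite eq_sym => ji; have [j' -> _] := unlift_some ji.
by rewrite /pivot0 liftK.
Qed.

Lemma pivot_bw_neq (S : comNzRingType) (i : {rmorphism k -> S}) y j :
  j != i0 -> pivot_bw i y j = pivot0 y j.
Proof. by rewrite /pivot_bw => /negPf->. Qed.

Definition pivot_iso : functor_iso pivot_src pivot_tgt.
Proof.
refine (@FunctorIso k _ _ _ _ pivot_fw pivot_bw _ _ _ _ _).
- by move=> S i z; rewrite /pivot_src /pivot_tgt (dcont_pivot (pivot0_fw i z)).
- by move=> S i y; rewrite /pivot_src /pivot_tgt (dcont_pivot (@pivot_bw_neq S i y)).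
- move=> S i z H; apply: functional_extensionality_dep => j; rewrite /pivot_bw.
  case: eqP => [->|/eqP ji]; last by rewrite -pivot0_fw.
  have H' := H; rewrite /pivot_src (dcont_pivot (pivot0_fw i z)) in H'.
  by rewrite /= (continuant_pivot (pivot0_fw i z)) addrK -mulrA mulrcV // mulr1.
- move=> S i y H; apply: functional_extensionality_dep => -[j|] /=.
    by rewrite pivot_bw_neq 1?eq_sym ?neq_lift // /pivot0 liftK.
  rewrite (continuant_pivot (@pivot_bw_neq S i y)) /pivot_bw eqxx -mulrA mulVcr //.
  by rewrite mulr1 subrK.
- move=> S S' f i i' x Hi H; apply: functional_extensionality_dep => -[j|] //=.
  by rewrite continuant_morph.
Defined.

End Pivot.

Lemma not_invertible0 (S : comNzRingType) : ~ invertible (0 : S).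
Proof. by case=> y; rewrite mul0r => /esym/eqP; rewrite oner_eq0. Qed.

Section Subst.
Variables (k : fieldType) (T T' : finType).

Definition subst_poly (y : T -> polyring k T') (h : polyring k T) : polyring k T' :=
  ev (@mpolyC #|{: T'}| k) y h.

Lemma ev_subst (S : comNzRingType) (i : {rmorphism k -> S}) (x : T' -> S) y h :
  ev i x (subst_poly y h) = ev i (fun t => ev i x (y t)) h.
Proof. by rewrite (@ev_morph k T _ S (ev i x) (@mpolyC #|{: T'}| k) i) // => a; rewrite /= evC. Qed.

End Subst.

(** * Charts of a compatible block *)

Section OddBlock.
Variables (k : fieldType) (n q : nat).
Hypotheses (nq : n.+1 = q.*2).
Local Notation open h := (points (fun=> False) h).

Lemma points_affineP (T : finType) (h : polyring k T) (S : comNzRingType) (i : {rmorphism k -> S}) x :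
  open h i x <-> invertible (ev i x h).
Proof. by split=> [[]|]. Qed.

Definition split_form (S : comNzRingType) (t : 'I_q * bool -> S) := \sum_j t (j, false) * t (j, true).

(* Charts identifying (-1)^q P_2q - 1 with a split quadratic form. *)
Record odd_block := OddBlock {
  ob_src : polyring k 'I_n.+1;
  ob_tgt : polyring k ('I_q * bool)%type;
  ob_iso : functor_iso (open ob_src) (open ob_tgt);
  ob_val : forall (S : comNzRingType) (i : {rmorphism k -> S}) z, open ob_src i z ->
    split_form (fw ob_iso i z) = (-1) ^+ q * continuant (seqf z) n.+1 - 1;
  ob_zero : forall (S : comNzRingType) (i : {rmorphism k -> S}) z, open ob_src i z ->
    (forall j, z j = 0) <-> (forall s, fw ob_iso i z s = 0)
}.

Section Chart1.

Definition pair_part (S : comNzRingType) (t : 'I_q * bool -> S) b : nat -> S := ext (fun j => t (j, b)).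

Definition origin_chart_fw (S : comNzRingType) (i : {rmorphism k -> S}) (z : 'I_n.+1 -> S)
  (s : 'I_q * bool) : S := if s.2 then odd_cont (seqf z) s.1 else even_var (seqf z) s.1.
Definition origin_chart_bw (S : comNzRingType) (i : {rmorphism k -> S}) (t : 'I_q * bool -> S)
  (j : 'I_n.+1) : S := chart_z (pair_part t false) (pair_part t true) j.+1.

Definition origin_chart_src : polyring k 'I_n.+1 :=
  \prod_(j < q) even_cont (seqf (fun c : 'I_n.+1 => var k c)) j.
Definition origin_chart_tgt : polyring k ('I_q * bool)%type :=
  \prod_(j < q) chart_cont (pair_part (fun s : 'I_q * bool => var k s) false)
                           (pair_part (fun s : 'I_q * bool => var k s) true) j.

Lemma origin_chart_srcP (S : comNzRingType) (i : {rmorphism k -> S}) z :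
  open origin_chart_src i z <-> forall j, (j < q)%N -> invertible (even_cont (seqf z) j).
Proof.
have E j : ev i z (even_cont (seqf (fun c : 'I_n.+1 => var k c)) j) = even_cont (seqf z) j.
  rewrite even_cont_morph; congr (even_cont _ j).
  by apply: functional_extensionality_dep => c; apply: ev_var.
rewrite points_affineP rmorph_prod invertible_prodP; split=> H j.
  by move=> jq; have := H (Ordinal jq); rewrite [X in invertible X]E.
by rewrite [X in invertible X]E; apply: H.
Qed.

Lemma origin_chart_tgtP (S : comNzRingType) (i : {rmorphism k -> S}) t :
  open origin_chart_tgt i t <-> forall j, (j < q)%N -> invertible (chart_cont (pair_part t false) (pair_part t true) j).
Proof.
have E j : ev i t (chart_cont (pair_part (fun s : 'I_q * bool => var k s) false)
    (pair_part (fun s : 'I_q * bool => var k s) true) j) = chart_cont (pair_part t false) (pair_part t true) j.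
  rewrite rmorphD rmorph1 rmorph_sum; congr (_ + _); apply: eq_bigr => c _.
  by rewrite rmorphM /pair_part !ext_morph; congr (_ * _); congr (ext _ _);
    apply: functional_extensionality_dep => e; apply: ev_var.
rewrite points_affineP rmorph_prod invertible_prodP; split=> H j.
  by move=> jq; have := H (Ordinal jq); rewrite [X in invertible X]E.
by rewrite [X in invertible X]E; apply: H.
Qed.

Lemma tpart_fw1 (S : comNzRingType) (i : {rmorphism k -> S}) z j : (j < q)%N ->
  pair_part (origin_chart_fw i z) false j = even_var (seqf z) j /\
  pair_part (origin_chart_fw i z) true j = odd_cont (seqf z) j.
Proof. by move=> jq; rewrite /pair_part !(ext_lt _ jq). Qed.

Lemma chart_cont_fw1 (S : comNzRingType) (i : {rmorphism k -> S}) z j : (j <= q)%N ->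
  chart_cont (pair_part (origin_chart_fw i z) false) (pair_part (origin_chart_fw i z) true) j = even_cont (seqf z) j.
Proof.
move=> jq; rewrite even_contE; congr (_ + _); apply: eq_bigr => c _.
by have [-> ->] := tpart_fw1 i z (leq_trans (ltn_ord c) jq).
Qed.

Lemma seqf_bw1 (S : comNzRingType) (i : {rmorphism k -> S}) t c : (0 < c <= q.*2)%N ->
  seqf (origin_chart_bw i t) c = chart_z (pair_part t false) (pair_part t true) c.
Proof. by rewrite -nq; apply: seqf_mk. Qed.

Lemma origin_chart_bwK (S : comNzRingType) (i : {rmorphism k -> S}) t : open origin_chart_tgt i t ->
  (forall j, (j < q)%N -> odd_cont (seqf (origin_chart_bw i t)) j = pair_part t true j) /\
  (forall j, (j <= q)%N -> even_cont (seqf (origin_chart_bw i t)) j =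
     chart_cont (pair_part t false) (pair_part t true) j).
Proof.
move=> /origin_chart_tgtP/chart_zK[H1 H2].
split=> j jq; rewrite -?H1 -?H2 // /odd_cont /even_cont; congr (_ * _); apply: eq_continuant => c /andP[c0 cj];
  apply: seqf_bw1; rewrite c0 (leq_trans cj) //.
  by rewrite ltn_double.
by rewrite leq_double.
Qed.

Definition origin_chart_iso : functor_iso (open origin_chart_src) (open origin_chart_tgt).
Proof.
refine (@FunctorIso k _ _ _ _ origin_chart_fw origin_chart_bw _ _ _ _ _).
- move=> S i z /origin_chart_srcP H; apply/origin_chart_tgtP => j jq.
  by rewrite chart_cont_fw1 ?(ltnW jq) //; apply: H.
- move=> S i t Ht; apply/origin_chart_srcP => j jq.
  by rewrite (origin_chart_bwK Ht).2 ?(ltnW jq) //; apply: (origin_chart_tgtP i t).1.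
- move=> S i z /origin_chart_srcP H; apply: functional_extensionality_dep => j.
  rewrite /origin_chart_bw -[RHS](seqf_ord z).
  have Hj : (0 < j.+1 <= q.*2)%N by rewrite -nq ltn_ord.
  rewrite -[RHS](chart_zE H Hj); apply: chart_z_eq Hj => c cq; by have [] := tpart_fw1 i z cq.
- move=> S i t Ht; apply: functional_extensionality_dep => -[j []]; rewrite /origin_chart_fw /=.
    by rewrite (origin_chart_bwK Ht).1 // /pair_part ext_ord.
  have Hj : (0 < j.*2.+2 <= q.*2)%N by rewrite /= ltn_Sdouble.
  by rewrite /even_var seqf_bw1 // chart_z_even /pair_part ext_ord.
- move=> S S' f i i' x Hi H; apply: functional_extensionality_dep => -[j []] //.
  by rewrite /origin_chart_fw /= odd_cont_morph.
Defined.

Definition origin_chart : odd_block.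
Proof.
refine (@OddBlock _ _ origin_chart_iso _ _) => S i z Hz; rewrite /fw /=.
  rewrite nq -/(even_cont (seqf z) q) -(chart_cont_fw1 i z (leqnn q)) /chart_cont addrC addKr.
  by apply: eq_bigr => j _; rewrite /pair_part !ext_ord.
split=> z0.
  have s0 c : seqf z c = 0 by apply: z0.
  move=> [j []]; rewrite /origin_chart_fw /= ?/even_var ?s0 // /odd_cont continuant_odd0 ?mulr0 //.
move=> j; rewrite -(seqf_ord z); have Hj : (0 < j.+1 <= q.*2)%N by rewrite -nq ltn_ord.
rewrite -(chart_zE ((origin_chart_srcP i z).1 Hz) Hj).
rewrite (@chart_z_eq _ _ _ (fun=> 0) (fun=> 0) q) // => [|c cq|c cq].
- by rewrite /chart_z; case: ifP => // _; case: (_./2) => [|c]; rewrite subr0 mul0r.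
- by have [<- _] := tpart_fw1 i z cq; rewrite /pair_part (ext_lt _ cq); apply: z0.
- by have [_ <-] := tpart_fw1 i z cq; rewrite /pair_part (ext_lt _ cq); apply: z0.
Defined.

End Chart1.

Section Chart2.
Variables (i0 : 'I_n.+1) (delta : k).

Lemma q_gt0 : (0 < q)%N. Proof. by rewrite -double_gt0 -nq. Qed.
Definition first_pair : 'I_q := Ordinal q_gt0.

(** Once the continuant is a coordinate, n = 2q - 1 others remain. They fill all slots of the split
    form but one, which is solved for from the value of the form. *)
Definition pair_rest := {s : 'I_q * bool | s != (first_pair, true)}.

Lemma pair_rest_card : #|{: pair_rest}| = n.
Proof.
rewrite card_sig; have := cardC (pred1 ((first_pair, true) : 'I_q * bool)).
by rewrite card1 card_prod card_ord card_bool muln2 -nq add1n => -[<-]; apply: eq_card.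
Qed.

Definition pr_ord (s : pair_rest) : 'I_n := cast_ord pair_rest_card (enum_rank s).
Definition ord_pr (j : 'I_n) : pair_rest := enum_val (cast_ord (esym pair_rest_card) j).

Lemma pr_ordK : cancel pr_ord ord_pr.
Proof. by move=> s; rewrite /ord_pr /pr_ord cast_ordK enum_rankK. Qed.

Lemma ord_prK : cancel ord_pr pr_ord.
Proof. by move=> s; rewrite /ord_pr /pr_ord enum_valK cast_ordKV. Qed.

Definition unit_slot : 'I_q * bool := (first_pair, false).
Definition unit_slot_rest : pair_rest := Sub unit_slot isT.
Definition unit_slot_ord : 'I_n := pr_ord unit_slot_rest.

(** The constant delta can make the slot paired with the solved one invertible at a given point
    where the coordinate placed there vanishes. *)
Definition pair_shift (S : comNzRingType) (i : {rmorphism k -> S}) (s : 'I_q * bool) : S :=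
  if s == unit_slot then i delta else 0.

Definition pair_ext (S : comNzRingType) (i : {rmorphism k -> S}) (y : option 'I_n -> S)
  (s : 'I_q * bool) : S :=
  oapp (fun s' : pair_rest => y (Some (pr_ord s')) + pair_shift i s) 0 (insub s).

Definition pair_fw (S : comNzRingType) (i : {rmorphism k -> S}) (y : option 'I_n -> S)
  (s : 'I_q * bool) : S :=
  if s == (first_pair, true) then
    ((-1) ^+ q * y None - 1 - \sum_(j | j != first_pair) pair_ext i y (j, false) * pair_ext i y (j, true))
      * cinv (pair_ext i y unit_slot)
  else pair_ext i y s.

Definition pair_bw (S : comNzRingType) (i : {rmorphism k -> S}) (t : 'I_q * bool -> S)
  (c : option 'I_n) : S :=
  if c is Some j then t (val (ord_pr j)) - pair_shift i (val (ord_pr j))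
  else (-1) ^+ q * (1 + split_form t).

Definition pair_src : functor k (option 'I_n) := fun S i y => invertible (y (Some unit_slot_ord) + i delta).
Definition pair_tgt : functor k ('I_q * bool)%type := fun S i t => invertible (t unit_slot).

Lemma pair_ext_star (S : comNzRingType) (i : {rmorphism k -> S}) y :
  pair_ext i y unit_slot = y (Some unit_slot_ord) + i delta.
Proof. by rewrite /pair_ext (valK unit_slot_rest : insub unit_slot = _) /pair_shift eqxx. Qed.

Lemma split_form_split (S : comNzRingType) (t : 'I_q * bool -> S) :
  split_form t = t unit_slot * t (first_pair, true) + \sum_(j | j != first_pair) t (j, false) * t (j, true).
Proof. by rewrite /split_form (bigD1 first_pair). Qed.

Lemma pair_fw_neq (S : comNzRingType) (i : {rmorphism k -> S}) y s :
  s != (first_pair, true) -> pair_fw i y s = pair_ext i y s.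
Proof. by rewrite /pair_fw => /negPf->. Qed.

Lemma split_form_pair_fw (S : comNzRingType) (i : {rmorphism k -> S}) y : pair_src i y ->
  split_form (pair_fw i y) = (-1) ^+ q * y None - 1.
Proof.
move=> Hy; rewrite split_form_split pair_fw_neq // /pair_fw eqxx mulrCA mulrcV; last by rewrite pair_ext_star.
rewrite mulr1 [X in _ + X](eq_bigr (fun j => pair_ext i y (j, false) * pair_ext i y (j, true))).
  by rewrite subrK.
by move=> j jo; rewrite !xpair_eqE (negPf jo).
Qed.

Definition pair_iso : functor_iso pair_src pair_tgt.
Proof.
refine (@FunctorIso k _ _ _ _ pair_fw pair_bw _ _ _ _ _).
- by move=> S i y; rewrite /pair_src /pair_tgt pair_fw_neq // pair_ext_star.
- by move=> S i t; rewrite /pair_src /pair_tgt /= /unit_slot_ord pr_ordK /pair_shift /= ?eqxx subrK.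
- move=> S i y Hy; apply: functional_extensionality_dep => -[j|] /=.
    by rewrite pair_fw_neq ?(valP (ord_pr j)) // /pair_ext valK /= ord_prK addrK.
  by rewrite split_form_pair_fw // addrC subrK mulrA -expr2 sqrr_sign mul1r.
- move=> S i t Ht; have E s : s != (first_pair, true) -> pair_ext i (pair_bw i t) s = t s.
    by move=> Hs; rewrite /pair_ext insubT /= pr_ordK subrK.
  apply: functional_extensionality_dep => s; rewrite /pair_fw; case: eqP => [->|/eqP/E //].
  rewrite E //= mulrA -expr2 sqrr_sign mul1r [1 + _]addrC addrK split_form_split.
  rewrite [X in _ + X - _](eq_bigr (fun j => pair_ext i (pair_bw i t) (j, false) * pair_ext i (pair_bw i t) (j, true))).
    by rewrite addrK mulrAC mulrcV // mul1r.
  by move=> j jo; rewrite !E // xpair_eqE negb_and jo.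
- move=> S S' f i i' y Hi Hy.
  have E s : pair_ext i' (fun c => f (y c)) s = f (pair_ext i y s).
    rewrite /pair_ext; case: insub => [s'|] /=; last by rewrite rmorph0.
    by rewrite rmorphD /pair_shift Hi; case: ifP => _; rewrite ?rmorph0.
  apply: functional_extensionality_dep => s; rewrite /pair_fw; case: ifP => _ //.
  rewrite rmorphM !rmorphB rmorphM rmorphXn rmorphN rmorph1 rmorph_sum cinv_morph ?E; last first.
    by rewrite pair_ext_star.
  by congr ((_ - _ - _) * _); apply: eq_bigr => j _; rewrite rmorphM !E.
Defined.

(** Q1, Q2 and Q3 express the same two invertibility conditions before, between and after the two
    substitutions, so that the restricted isomorphisms compose. *)
Definition smooth_chart_Q1 : functor k 'I_n.+1 :=
  fun S i z => pivot_src i0 i z /\ invertible (z (lift i0 unit_slot_ord) + i delta).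
Definition smooth_chart_Q2 : functor k (option 'I_n) :=
  fun S i y => pivot_tgt i0 i y /\ pair_src i y.
Definition smooth_chart_Q3 : functor k ('I_q * bool)%type :=
  fun S i t => pivot_tgt i0 i (pair_bw i t) /\ pair_tgt i t.

Definition smooth_chart_src : polyring k 'I_n.+1 :=
  dcont (seqf (fun c : 'I_n.+1 => var k c)) n.+1 i0.+1 * (var k (lift i0 unit_slot_ord) + delta%:MP).
Definition smooth_chart_tgt : polyring k ('I_q * bool)%type :=
  dcont (seqf (pivot0 i0 (pair_bw (@mpolyC _ k) (fun s : 'I_q * bool => var k s)))) n.+1 i0.+1
   * var k unit_slot.

Definition smooth_chart_iso0 : functor_iso smooth_chart_Q1 smooth_chart_Q3.
Proof.
apply: (@functor_iso_comp _ _ _ _ smooth_chart_Q1 smooth_chart_Q2 smooth_chart_Q3).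
  apply: (@functor_iso_restrict _ _ _ _ _ _ _ (pivot_iso k i0)).
  - by move=> S i x [].
  - by move=> S i x [].
  - move=> S i x Hx; split=> -[H1 H2]; split=> //.
    exact: (fw_pt (pivot_iso k i0) Hx).
apply: (@functor_iso_restrict _ _ _ _ _ _ _ pair_iso).
- by move=> S i x [].
- by move=> S i x [].
- move=> S i x Hx; have e : pair_bw i (pair_fw i x) = x := fwK pair_iso Hx.
  rewrite /smooth_chart_Q2 /smooth_chart_Q3 [fw _ _ _]/(pair_fw i x) e.
  split=> -[H1 H2]; split=> //; exact: (fw_pt pair_iso Hx).
Defined.

Lemma smooth_chart_srcP (S : comNzRingType) (i : {rmorphism k -> S}) z :
  open smooth_chart_src i z <-> smooth_chart_Q1 i z.
Proof.
rewrite points_affineP rmorphM invertibleM dcont_morph [X in _ /\ invertible X]rmorphD /= evC ev_var.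
have -> : (fun c => ev i z (seqf (fun c : 'I_n.+1 => var k c) c)) = seqf z by
  apply: functional_extensionality_dep => c; apply: ev_var.
by [].
Qed.

Lemma smooth_chart_tgtP (S : comNzRingType) (i : {rmorphism k -> S}) t :
  open smooth_chart_tgt i t <-> smooth_chart_Q3 i t.
Proof.
rewrite points_affineP rmorphM invertibleM dcont_morph [X in _ /\ invertible X]ev_var.
have E c : ev i t (pair_bw (@mpolyC _ k) (fun s : 'I_q * bool => var k s) c) = pair_bw i t c.
  case: c => [j|] /=.
    rewrite rmorphB /= ev_var /pair_shift; case: ifP => _; by rewrite ?rmorph0 ?evC.
  rewrite rmorphM rmorphXn rmorphN rmorphD !rmorph1 rmorph_sum; congr (_ * (_ + _)).
  by apply: eq_bigr => j _; rewrite rmorphM /= !ev_var.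
have -> : (fun c => ev i t (seqf (pivot0 i0 (pair_bw (@mpolyC _ k) (fun s : 'I_q * bool => var k s))) c)) =
    seqf (pivot0 i0 (pair_bw i t)).
  apply: functional_extensionality_dep => c; rewrite /seqf /pivot0.
  by case: unlift => [j|]; [exact: (E (Some j)) | exact: rmorph0].
by [].
Qed.

Definition smooth_chart_iso : functor_iso (open smooth_chart_src) (open smooth_chart_tgt).
Proof.
apply: (@functor_iso_restrict _ _ _ _ _ _ _ smooth_chart_iso0) => S i x.
- by move/smooth_chart_srcP.
- by move/smooth_chart_tgtP.
- by move=> Hx; split=> [_|_]; [apply/smooth_chart_tgtP; apply: (fw_pt smooth_chart_iso0 Hx) | apply/smooth_chart_srcP].
Defined.

Definition smooth_chart : odd_block.
Proof.
refine (@OddBlock _ _ smooth_chart_iso _ _) => S i z /smooth_chart_srcP Hz.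
  exact: (split_form_pair_fw (y := pivot_fw i0 i z)) (Hz.2).
(* Neither side can hold on this chart: at z = 0 the slope at the pivot would be 0, and the unit
   slot is invertible. *)
split=> H.
  exfalso; apply: (@not_invertible0 S); have [+ _] := Hz.
  rewrite /pivot_src; have -> : seqf z = fun=> 0.
    by apply: functional_extensionality_dep => c; apply: H.
  by have := @dcont_even0 S q i0.+1; rewrite -nq => ->.
exfalso; apply: (@not_invertible0 S); rewrite -(H unit_slot).
by have [] := fw_pt smooth_chart_iso0 Hz.
Defined.

End Chart2.

Lemma pivot_exists (L : fieldType) (z : 'I_n.+1 -> L) :
  (forall j, z j = 0) \/ exists i0 : 'I_n.+1, dcont (seqf z) n.+1 i0.+1 != 0.
Proof.
case: (boolP [exists i0 : 'I_n.+1, dcont (seqf z) n.+1 i0.+1 != 0]) => [/existsP|H]; first by right.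
left=> j; rewrite -(seqf_ord z).
apply: (dcont_critical (n := n.+1) _).2; last exact: ltn_ord.
case=> // c /= Hc; apply/eqP; move: H; rewrite negb_exists => /forallP/(_ (Ordinal Hc)).
by rewrite negbK.
Qed.

(** A zero block lies in the chart at the origin; a nonzero one has a pivot, because it is not a
    critical point of the continuant. *)
Lemma odd_block_exists (L : fieldType) (i : {rmorphism k -> L}) (z : 'I_n.+1 -> L) :
  exists B : odd_block, ev i z (ob_src B) != 0.
Proof.
have inv (x : L) : invertible x -> x != 0.
  by move=> Hx; apply/eqP => x0; apply: (@not_invertible0 L); rewrite -x0.
have unit (x : L) : x != 0 -> invertible x by move=> x0; exists x^-1; rewrite mulfV.
have [z0|[i0 Hi]] := pivot_exists z.
  have [_ Hs] : open origin_chart_src i z.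
    apply/origin_chart_srcP => j _.
    have -> : seqf z = fun=> 0 by apply: functional_extensionality_dep => c; apply: z0.
    by rewrite even_cont_zero; apply: invertible1.
  by exists origin_chart; exact: (inv _ Hs).
(* The constant is 1 if the coordinate vanishes and 0 otherwise. *)
have [delta Hd] : exists delta, z (lift i0 unit_slot_ord) + i delta != 0.
  have [z0|z0] := eqVneq (z (lift i0 unit_slot_ord)) 0.
    by exists 1; rewrite z0 rmorph1 add0r oner_neq0.
  by exists 0; rewrite rmorph0 addr0.
have [_ Hs] : open (smooth_chart_src i0 delta) i z by apply/smooth_chart_srcP; split; apply: unit.
by exists (smooth_chart i0 delta); exact: (inv _ Hs).
Qed.

End OddBlock.

(** * The chart along C *)

Section OddStar.
Variables (K : fieldType) (m : nat) (l : 'I_m -> nat) (eta : closed_point K l).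
Variables (J : {set 'I_m}) (cc : residue eta).
Local Notation kappa := (residue eta).
Local Notation T := (star_coord l).
Definition in_block := {b : 'I_m | b \in J}.
Definition out_block := {b : 'I_m | b \notin J}.
Definition qdim (b : in_block) : nat := halfk l (val b).
Hypothesis lq : forall b : in_block, (l (val b)).+1 = (qdim b).*2.
Hypothesis cc0 : cc != 0.
Hypothesis ccE : forall b : in_block, lambda eta (val b) * (-1) ^+ qdim b = cc.
Variable a0 : in_block.
Variable BA : forall b : in_block, odd_block kappa (l (val b)) (qdim b).
Variable piv : forall g : out_block, 'I_(l (val g)).+1.
(** An incompatible block loses its pivot coordinate; its l remaining ones are directions of the
    cylinder. *)
Definition free_index := {g : out_block & 'I_(l (val g))}.
Local Notation T' := (cA1_coord qdim + 'I_#|{: free_index}|)%type.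
Local Notation open h := (points (fun=> False) h).

Section Maps.
Variables (S : comNzRingType) (i : {rmorphism kappa -> S}).

Definition zblk (x : T -> S) a (j : 'I_(l a).+1) : S := x (inl (existT _ a j)).
Definition tblk (t : T' -> S) (b : in_block) (s : 'I_(qdim b) * bool) : S :=
  t (inl (existT _ b s)).

Definition odd_fw (x : T -> S) (t : T') : S :=
  match t with
  | inl (existT b s) => fw (ob_iso (BA b)) i (@zblk x (val b)) s
  | inr e => let: existT g j := enum_val e in zblk x (lift (piv g) j)
  end.

(** Recovers u from 1 + g = cc u in the reference block a0; on the target all the forms g agree. *)
Definition ubw (t : T' -> S) : S := i cc^-1 * (1 + split_form (@tblk t a0)).
(** The value of the continuant, at [None], is not free: F prescribes it as lambda u. *)
Definition yblk (t : T' -> S) (g : out_block) (c : option 'I_(l (val g))) : S :=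
  if c is Some j then t (inr (enum_rank (existT _ g j : free_index)))
  else i (lambda eta (val g)) * ubw t.

(* Sequences indexed by nat avoid transporting along val b = a. *)
Definition seqbw (t : T' -> S) (a : 'I_m) : nat -> S :=
  match insub a : option in_block with
  | Some b => seqf (bw (ob_iso (BA b)) i (@tblk t b))
  | None => if (insub a : option out_block) is Some g
            then seqf (pivot_bw (piv g) i (@yblk t g)) else fun=> 0
  end.

Definition odd_bw (t : T' -> S) (c : T) : S :=
  match c with
  | inl (existT a j) => seqbw t a j.+1
  | inr false => ubw t
  | inr true => (\prod_a continuant (seqbw t a) (l a) + i (mu eta)) * cinv (ubw t)
  end.

Definition odd_src (x : T -> S) :=
  [/\ invertible (ucoord x), forall b, open (ob_src (BA b)) i (@zblk x (val b)) &
     forall g, pivot_src (piv g) i (@zblk x (val g))].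
Definition odd_tgt (t : T' -> S) :=
  [/\ invertible (ubw t), forall b, open (ob_tgt (BA b)) i (@tblk t b) &
     forall g, pivot_tgt (piv g) i (@yblk t g)].

Lemma in_or_out (P : 'I_m -> Prop) :
  (forall b : in_block, P (val b)) -> (forall g : out_block, P (val g)) -> forall a, P a.
Proof.
move=> H1 H2 a; case: (boolP (a \in J)) => aJ; first exact: (H1 (Sub a aJ)).
exact: (H2 (Sub a aJ)).
Qed.

Lemma seqbw_in t (b : in_block) : seqbw t (val b) = seqf (bw (ob_iso (BA b)) i (@tblk t b)).
Proof. by rewrite /seqbw valK. Qed.

Lemma seqbw_out t (g : out_block) : seqbw t (val g) = seqf (pivot_bw (piv g) i (@yblk t g)).
Proof. by rewrite /seqbw insubF ?valK //; apply/negbTE/(valP g). Qed.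

Lemma zblk_bw_in t (b : in_block) : @zblk (odd_bw t) (val b) = bw (ob_iso (BA b)) i (@tblk t b).
Proof.
by apply: functional_extensionality_dep => j; rewrite /zblk /= seqbw_in seqf_ord.
Qed.

Lemma zblk_bw_out t (g : out_block) :
  @zblk (odd_bw t) (val g) = pivot_bw (piv g) i (@yblk t g).
Proof.
by apply: functional_extensionality_dep => j; rewrite /zblk /= seqbw_out seqf_ord.
Qed.

Lemma zseq_seqf x a : zseq x a = seqf (@zblk x a). Proof. by []. Qed.

(** Multiplied by (-1)^q, F_b becomes 1 + g_b = cc u; compatibility is what makes cc the same for
    all blocks of J. *)
Lemma cc_val (x : T -> S) b : open (ob_src (BA b)) i (@zblk x (val b)) ->
  (continuant (zseq x (val b)) (l (val b)).+1 = i (lambda eta (val b)) * ucoord x <->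
   split_form (fw (ob_iso (BA b)) i (@zblk x (val b))) = i cc * ucoord x - 1).
Proof.
move=> Hb; rewrite (ob_val Hb) zseq_seqf -(ccE b) rmorphM rmorphXn rmorphN rmorph1.
split=> [->|/eqP]; first by ring.
rewrite subr_eq subrK => /eqP e; apply: (mulcI (invertible_sign S (qdim b))).
by rewrite e; ring.
Qed.

Lemma ubw_fw x : odd_src x -> Feqs i x -> ubw (odd_fw x) = ucoord x.
Proof.
move=> [_ Hb _] HF; rewrite /ubw.
have /(cc_val (Hb a0)) := HF (val a0).
rewrite -[split_form _]/(split_form (@tblk (odd_fw x) a0)) => ->.
by rewrite addrC subrK mulrA -rmorphM mulVf // rmorph1 mul1r.
Qed.

Lemma yblk_fw x g : odd_src x -> Feqs i x ->
  @yblk (odd_fw x) g = pivot_fw (piv g) i (@zblk x (val g)).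
Proof.
move=> Hx HF; apply: functional_extensionality_dep => -[j|] /=; first by rewrite enum_rankK.
by rewrite ubw_fw // -HF.
Qed.

Lemma odd_fw_tgt x : odd_src x -> Feqs i x -> odd_tgt (odd_fw x).
Proof.
move=> Hx HF; have [Hu Hb Hg] := Hx; split=> [|b|g].
- by rewrite ubw_fw.
- exact: (fw_pt (ob_iso (BA b)) (Hb b)).
- by rewrite yblk_fw //; apply: (fw_pt (pivot_iso kappa (piv g)) (Hg g)).
Qed.

Lemma odd_fw_split_form x b b' : odd_src x -> Feqs i x ->
  split_form (@tblk (odd_fw x) b) = split_form (@tblk (odd_fw x) b').
Proof.
move=> [_ Hb _] HF.
by rewrite [LHS]((cc_val (Hb b)).1 (HF _)) [RHS]((cc_val (Hb b')).1 (HF _)).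
Qed.

Lemma odd_bw_src t : odd_tgt t -> odd_src (odd_bw t).
Proof.
move=> [Hu Hb Hg]; split=> [//|b|g].
- by rewrite zblk_bw_in; apply: (bw_pt (ob_iso (BA b)) (Hb b)).
- by rewrite zblk_bw_out; apply: (bw_pt (pivot_iso kappa (piv g)) (Hg g)).
Qed.

Lemma Feqs_odd_bw t : odd_tgt t -> (forall b, split_form (@tblk t b) = split_form (@tblk t a0)) -> Feqs i (odd_bw t).
Proof.
move=> Ht He; have [Hu Hb Hg] := odd_bw_src Ht; have [_ Tb Tg] := Ht.
apply: in_or_out => [b|g].
  apply/(cc_val (Hb b)); rewrite zblk_bw_in (bwK (ob_iso (BA b)) (Tb b)) He /ucoord /= /ubw.
  by rewrite mulrA -rmorphM mulfV // rmorph1 mul1r addrC addKr.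
rewrite zseq_seqf zblk_bw_out.
exact: (congr1 (fun f => f None) (bwK (pivot_iso kappa (piv g)) (Tg g))).
Qed.

Lemma zseq_odd_bw t a n : (0 < n <= (l a).+1)%N -> zseq (odd_bw t) a n = seqbw t a n.
Proof. exact: zseq_mk. Qed.

Lemma prod_odd_bw t : \prod_a continuant (zseq (odd_bw t) a) (l a) =
  \prod_a continuant (seqbw t a) (l a).
Proof.
apply: eq_bigr => a _; apply: eq_continuant => j /andP[j0 jl].
by apply: zseq_odd_bw; rewrite j0 (leq_trans jl).
Qed.

Lemma Geq_odd_bw t : odd_tgt t ->
  ucoord (odd_bw t) * wcoord (odd_bw t) - \prod_a continuant (zseq (odd_bw t) a) (l a) - i (mu eta) = 0.
Proof.
move=> [Hu _ _]; rewrite prod_odd_bw /ucoord /wcoord /= mulrCA mulrcV // mulr1.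
by rewrite addrAC addrK subrr.
Qed.

Lemma odd_bwK t : odd_tgt t -> odd_fw (odd_bw t) = t.
Proof.
move=> Ht; have [Hu Tb Tg] := Ht; apply: functional_extensionality_dep => -[[b s]|e].
  by rewrite /odd_fw zblk_bw_in (bwK (ob_iso (BA b)) (Tb b)).
rewrite /odd_fw -{2}[e]enum_valK; case: (enum_val e) => g j.
rewrite zblk_bw_out.
exact: (congr1 (fun f => f (Some j)) (bwK (pivot_iso kappa (piv g)) (Tg g))).
Qed.

Lemma odd_fwK x : odd_src x -> Feqs i x ->
  ucoord x * wcoord x - \prod_a continuant (zseq x a) (l a) - i (mu eta) = 0 ->
  odd_bw (odd_fw x) = x.
Proof.
move=> Hx HF HG; have [Hu Hb Hg] := Hx.
have E a : seqbw (odd_fw x) a = zseq x a.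
  move: a; apply: in_or_out => [b|g].
    by rewrite seqbw_in zseq_seqf (fwK (ob_iso (BA b)) (Hb b)).
  have e : pivot_bw (piv g) i (pivot_fw (piv g) i (@zblk x (val g))) = @zblk x (val g) :=
    fwK (pivot_iso kappa (piv g)) (Hg g).
  by rewrite seqbw_out yblk_fw // zseq_seqf e.
apply: star_coord_ext => [a j||].
- by rewrite /= E zseq_seqf seqf_ord.
- exact: ubw_fw.
rewrite /= ubw_fw // (eq_bigr (fun a => continuant (zseq x a) (l a))); last by move=> a _; rewrite E.
move/eqP: HG; rewrite subr_eq add0r subr_eq => /eqP e.
by rewrite addrC -e mulrAC mulrcV // mul1r.
Qed.

Lemma odd_zero x b : odd_src x ->
  (forall j, @zblk x (val b) j = 0) <-> (forall s, @tblk (odd_fw x) b s = 0).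
Proof. by move=> [_ Hb _]; apply: ob_zero. Qed.

End Maps.
Section Morph.
Variables (R S : comNzRingType) (f : {rmorphism R -> S}).
Variables (i : {rmorphism kappa -> R}) (i' : {rmorphism kappa -> S}).
Hypothesis fi : forall a, i' a = f (i a).

Lemma split_form_morph n (t : 'I_n * bool -> R) : f (split_form t) = split_form (fun s => f (t s)).
Proof. by rewrite rmorph_sum; apply: eq_bigr => j _; rewrite rmorphM. Qed.

Lemma ubw_morph t : f (ubw i t) = ubw i' (fun c => f (t c)).
Proof. by rewrite rmorphM rmorphD rmorph1 split_form_morph /ubw fi. Qed.

Lemma yblk_morph t g c : f (@yblk R i t g c) = @yblk S i' (fun c => f (t c)) g c.
Proof. by case: c => [j|] //=; rewrite rmorphM ubw_morph fi. Qed.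

Lemma odd_fw_morph x : odd_src i x ->
  odd_fw i' (fun c => f (x c)) = fun t => f (odd_fw i x t).
Proof.
move=> [_ Hb _]; apply: functional_extensionality_dep => -[[b s]|e] /=.
  exact: (congr1 (fun h => h s) (fw_nat (ob_iso (BA b)) fi (Hb b))).
by case: (enum_val e).
Qed.

Lemma seqf_pivot0_morph n (i0 : 'I_n.+1) (y : option 'I_n -> R) c :
  f (seqf (pivot0 i0 y) c) = seqf (pivot0 i0 (fun c => f (y c))) c.
Proof. by rewrite /seqf /pivot0; case: unlift => //=; rewrite rmorph0. Qed.

End Morph.

Definition odd_src_poly : polyring kappa T := uvar eta *
  ((\prod_(b : in_block) subst_poly (@zblk _ (fun c : T => var kappa c) (val b)) (ob_src (BA b))) *
  (\prod_(g : out_block)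
    dcont (seqf (@zblk _ (fun c : T => var kappa c) (val g))) (l (val g)).+1 (piv g).+1)).
Definition odd_tgt_poly : polyring kappa T' := ubw (@mpolyC _ kappa) (fun c : T' => var kappa c) *
  ((\prod_(b : in_block) subst_poly (@tblk _ (fun c : T' => var kappa c) b) (ob_tgt (BA b))) *
  (\prod_(g : out_block)
    dcont (seqf (pivot0 (piv g) (@yblk _ (@mpolyC _ kappa) (fun c : T' => var kappa c) g)))
      (l (val g)).+1 (piv g).+1)).

Lemma odd_src_polyP (S : comNzRingType) (i : {rmorphism kappa -> S}) x :
  invertible (ev i x odd_src_poly) <-> odd_src i x.
Proof.
rewrite rmorphM invertibleM [X in invertible X /\ _]ev_var rmorphM invertibleM !rmorph_prod !invertible_prodP.
have E1 b : ev i x (subst_poly (@zblk _ (fun c : T => var kappa c) (val b)) (ob_src (BA b))) =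
    ev i (@zblk _ x (val b)) (ob_src (BA b)).
  rewrite ev_subst; congr (ev i _ _); apply: functional_extensionality_dep => j.
  exact: ev_var.
have E2 g : ev i x (dcont (seqf (@zblk _ (fun c : T => var kappa c) (val g))) (l (val g)).+1 (piv g).+1) =
    dcont (seqf (@zblk _ x (val g))) (l (val g)).+1 (piv g).+1.
  rewrite dcont_morph; congr (dcont _ _ _); apply: functional_extensionality_dep => c.
  exact: ev_var.
split=> [[Hu [Hb Hg]]|[Hu Hb Hg]].
  split=> [//|b|g].
  - by have := Hb b; rewrite [X in invertible X]E1 => H; apply/points_affineP.
  - by have := Hg g; rewrite [X in invertible X]E2.
split=> //; split=> [b|g].
- by rewrite [X in invertible X]E1; apply/points_affineP.
- by rewrite [X in invertible X]E2; apply: Hg.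
Qed.

Lemma odd_tgt_polyP (S : comNzRingType) (i : {rmorphism kappa -> S}) t :
  invertible (ev i t odd_tgt_poly) <-> odd_tgt i t.
Proof.
have ci a : i a = ev i t a%:MP by rewrite evC.
have tE : (fun c => ev i t (var kappa c)) = t by apply: functional_extensionality_dep => c; apply: ev_var.
rewrite rmorphM invertibleM rmorphM invertibleM !rmorph_prod !invertible_prodP.
have E0 : ev i t (ubw (@mpolyC _ kappa) (fun c : T' => var kappa c)) = ubw i t.
  by rewrite (ubw_morph ci) tE.
have E1 b : ev i t (subst_poly (@tblk _ (fun c : T' => var kappa c) b) (ob_tgt (BA b))) =
    ev i (@tblk _ t b) (ob_tgt (BA b)).
  rewrite ev_subst; congr (ev i _ _); apply: functional_extensionality_dep => j.
  exact: ev_var.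
have E2 g : ev i t (dcont (seqf (pivot0 (piv g) (@yblk _ (@mpolyC _ kappa) (fun c : T' => var kappa c) g)))
      (l (val g)).+1 (piv g).+1) = dcont (seqf (pivot0 (piv g) (@yblk _ i t g))) (l (val g)).+1 (piv g).+1.
  rewrite dcont_morph; congr (dcont _ _ _); apply: functional_extensionality_dep => c.
  rewrite seqf_pivot0_morph; congr (seqf (pivot0 _ _) c).
  by apply: functional_extensionality_dep => e; rewrite (yblk_morph ci) tE.
split=> [[Hu [Hb Hg]]|[Hu Hb Hg]].
  split=> [|b|g]; first by rewrite -E0.
  - by have := Hb b; rewrite [X in invertible X]E1 => H; apply/points_affineP.
  - by have := Hg g; rewrite [X in invertible X]E2.
split; first by rewrite [X in invertible X]E0.
split=> [b|g].
- by rewrite [X in invertible X]E1; apply/points_affineP.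
- by rewrite [X in invertible X]E2; apply: Hg.
Qed.

Lemma cylinder_eqsP (S : comNzRingType) (i : {rmorphism kappa -> S}) (t : T' -> S) :
  (forall f, cylinder #|{: free_index}| (cA1_eqs kappa qdim) f -> ev i t f = 0) <->
  forall b b', split_form (@tblk _ t b) = split_form (@tblk _ t b').
Proof.
have E b : ev i t (pullback #|{: free_index}| (gA1 kappa qdim b)) = split_form (@tblk _ t b).
  rewrite -[pullback _ _]/(subst_poly (fun c : cA1_coord qdim => var kappa (inl c : T')) _) ev_subst rmorph_sum.
  by apply: eq_bigr => j _; rewrite rmorphM /tvar /= !ev_var.
have PB : pullback (T := cA1_coord qdim) (k := kappa) #|{: free_index}| =1 subst_poly (fun c : cA1_coord qdim => var kappa (inl c : T')) by [].
split=> [H b b'|H f [_ [b [b' ->]] ->]].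
  apply/eqP; rewrite -subr_eq0 -!E -rmorphB; apply/eqP/H.
  exists (gA1 kappa qdim b - gA1 kappa qdim b'); first by exists b, b'.
  by rewrite !PB /subst_poly rmorphB.
by rewrite PB /subst_poly rmorphB rmorphB; apply/eqP; rewrite subr_eq0; apply/eqP; rewrite [LHS]E [RHS]E.
Qed.

Lemma points_oddP (S : comNzRingType) (i : {rmorphism kappa -> S}) x :
  points (X eta) odd_src_poly i x <->
  [/\ Feqs i x, ucoord x * wcoord x - \prod_a continuant (zseq x a) (l a) - i (mu eta) = 0
    & odd_src i x].
Proof. by rewrite /points points_X odd_src_polyP; split=> [[[]]|[]]. Qed.

Lemma points_cylP (S : comNzRingType) (i : {rmorphism kappa -> S}) t :
  points (cylinder #|{: free_index}| (cA1_eqs kappa qdim)) odd_tgt_poly i t <->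
  (forall b b', split_form (@tblk _ t b) = split_form (@tblk _ t b')) /\ odd_tgt i t.
Proof. by rewrite /points cylinder_eqsP odd_tgt_polyP. Qed.

Definition odd_iso : functor_iso (points (X eta) odd_src_poly)
  (points (cylinder #|{: free_index}| (cA1_eqs kappa qdim)) odd_tgt_poly).
Proof.
refine (@FunctorIso kappa T T' _ _ odd_fw odd_bw _ _ _ _ _).
- move=> S i x /points_oddP[HF HG Hx]; apply/points_cylP.
  by split=> [b b'|]; [apply: odd_fw_split_form | apply: odd_fw_tgt].
- move=> S i t /points_cylP[He Ht]; apply/points_oddP; split.
  + by apply: Feqs_odd_bw => // b; apply: He.
  + exact: Geq_odd_bw.
  + exact: odd_bw_src.
- by move=> S i x /points_oddP[HF HG Hx]; apply: odd_fwK.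
- by move=> S i t /points_cylP[_ Ht]; apply: odd_bwK.
- by move=> S S' f i i' x Hi /points_oddP[_ _ Hx]; apply: odd_fw_morph.
Defined.

End OddStar.

(** * Compatibility classes and the loci C *)

Section Compatibility.
Variables (K : fieldType) (m : nat) (l : 'I_m -> nat) (eta : closed_point K l).
Local Notation kappa := (residue eta).

Lemma lambda_neq0 a : (1 <= l a)%N -> lambda eta a != 0.
Proof.
move=> l0; rewrite invr_neq0 // /rho subSS subn0.
have H j : (j <= l a)%N -> rev_rho eta a j != 0.
  elim/ltn_ind: j => -[|[|j]] IH jl; first exact: oner_neq0.
    by apply: pt_c_neq0; rewrite leqnn l0.
  rewrite [rev_rho _ _ _]/(_ * _) mulf_neq0 //; last by apply: IH; rewrite // ltnW // ltnW.
  by apply: pt_c_neq0; rewrite subn_gt0 ltnS jl /= subSS leq_subr.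
exact: H.
Qed.

Definition csign a : kappa := lambda eta a * (-1) ^+ halfk l a.

(** A class with a second element consists of odd lengths, and there compatibility is equality of
    [csign], hence transitive; so the class of the least element [sigma] is the original class. *)
Lemma alphas_compatible ai : ai \in alphas eta -> forall b, b \in Iset eta ai <->
  odd (l b) /\ csign b = csign ai.
Proof.
case/imsetP => a; rewrite inE => ha ->.
have aa : a \in Iset eta a by rewrite inE /compatible eqxx.
have oa : odd (l a).
  move: ha; rewrite (cardsD1 a) aa ltnS => /card_gt0P[b]; rewrite !inE => /andP[ba].
  by rewrite /compatible eq_sym (negPf ba) /= => /and3P[].
have Ia b : b \in Iset eta a <-> odd (l b) /\ csign b = csign a.
  rewrite inE /compatible; case: eqVneq => [<-|_] /=; first by split.
  rewrite oa /=; split=> [/andP[ob /eqP e]|[-> e]]; first by split=> //; apply: esym.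
  exact/eqP/esym.
have /Ia[os cs] : sigma eta a \in Iset eta a by rewrite /sigma; case: arg_minnP.
move=> b; rewrite cs -Ia [in X in X <-> _]inE /compatible; case: eqVneq => [<-|_] /=.
  by split=> // _; apply/Ia.
rewrite os -!/(csign _) cs /=; split=> [/andP[ob /eqP cb]|/Ia[-> ->]]; last by rewrite eqxx.
by apply/Ia; split=> //; apply: esym.
Qed.

End Compatibility.

Lemma continuant_zero (S : comNzRingType) n : continuant (fun=> 0 : S) n.*2 = (-1) ^+ n.
Proof.
have e : (-1) ^+ n * continuant (fun=> 0 : S) n.*2 = 1 := even_cont_zero S n.
set t := (-1) ^+ n in e *; set c := continuant _ _ in e *.
by transitivity (t * (t * c)); [rewrite mulrA -expr2 sqrr_sign mul1r | rewrite e mulr1].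
Qed.

Section Loci.
Variables (K : fieldType) (m : nat) (l : 'I_m -> nat) (eta : closed_point K l).
Local Notation kappa := (residue eta).
Local Notation T := (star_coord l).

Definition zcoord (a : 'I_m) (c : T) : Prop := exists j, c = inl (existT _ a j).

Lemma Vpts_zblock a r : is_prime r ->
  Vpts (zblock eta a) r <-> forall c, zcoord a c -> r (var kappa c).
Proof.
move=> pr; split=> [[_ H] c [j ->]|H].
  apply: H; exists j.+1; first exact: ltn_ord.
  by rewrite /zvar /= inord_val.
split=> // f [j Hj ->]; apply: H; by exists (inord j.-1).
Qed.

Lemma odd_halfk a : odd (l a) -> (l a).+1 = (halfk l a).*2.
Proof. by move=> oa; rewrite /halfk -[LHS]odd_double_half /= oa. Qed.

(** On X the remaining equations of C follow: P_(l+1)(0) = (-1)^k in block a fixes u through F_a,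
    the odd continuant P_l(0) = 0 kills the product in G and leaves u w = mu, and F_c then fixes
    every other continuant. *)
Lemma Cpair_points r a b : odd (l a) -> odd (l b) -> (1 <= l a)%N -> Vpts (X eta) r ->
  Vpts (zblock eta a) r -> Vpts (zblock eta b) r -> Cpair eta a b r.
Proof.
move=> oa ob l0 [pr Xr] [_ za] [_ zb]; split=> //.
have [L [g gr]] := prime_field_point pr.
pose i : {rmorphism kappa -> L} := (g \o @mpolyC _ kappa)%FUN.
pose z := fun c => g (var kappa c).
have gE f : g f = ev i z f by apply: poly_morphE.
have [HF HG] : _ /\ _ := (points_X i z).1 (fun f Xf => etrans (esym (gE f)) ((gr f).2 (Xr f Xf))).
have zseq0 c n : Vpts (zblock eta c) r -> zseq z c n = 0.
  by move=> /(Vpts_zblock _ pr) H; apply/gr/H; exists (inord n.-1).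
have za0 n := zseq0 a n (conj pr za).
have zae : zseq z a = fun=> 0 by apply: functional_extensionality_dep.
have lam0 := lambda_neq0 eta l0.
have uE : ucoord z = i ((-1) ^+ halfk l a * (lambda eta a)^-1).
  have := HF a; rewrite zae (odd_halfk oa) => e.
  have ilam : i (lambda eta a) != 0 by rewrite fmorph_eq0.
  apply: (mulfI ilam); rewrite -e -rmorphM mulrCA mulfV // mulr1.
  by rewrite rmorphXn rmorphN rmorph1 continuant_zero.
have wE : wcoord z = i ((-1) ^+ halfk l a * lambda eta a * mu eta).
  have : \prod_c continuant (zseq z c) (l c) = 0.
    rewrite (bigD1 a) //= zae; have -> : l a = (l a)./2.*2.+1.
      by rewrite -[LHS]odd_double_half oa.
    by rewrite continuant_odd0 ?mul0r.
  move=> e; move/eqP: HG; rewrite e subr0 subr_eq0 uE => /eqP h.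
  rewrite rmorphM -h mulrA -rmorphM.
  have -> : (-1) ^+ halfk l a * lambda eta a * ((-1) ^+ halfk l a * (lambda eta a)^-1) = 1.
    rewrite mulrACA -expr2 sqrr_sign mul1r mulfV //.
  by rewrite rmorph1 mul1r.
move=> f [/za//|[/zb//|[->|[->|[c _ ->]]]]]; apply/gr; rewrite rmorphB.
- by rewrite -[g _%:MP]/(i _) -uE subrr.
- by rewrite -[g _%:MP]/(i _) -wE subrr.
rewrite -[g _%:MP]/(i _) gE ev_continuant HF uE -rmorphM.
rewrite [X in i X - _](_ : _ = (-1) ^+ halfk l a * lambda eta c * (lambda eta a)^-1) ?subrr //.
by ring.
Qed.

End Loci.

Lemma pullback_prime (k : fieldType) (T : finType) d (r : polyring k (T + 'I_d)%type -> Prop) :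
  is_prime r -> is_prime (fun f : polyring k T => r (pullback d f)).
Proof.
exact: (is_prime_preim (ev (@mpolyC _ k) (fun t => var k (inl t : T + 'I_d)))).
Qed.

Lemma Vpts_tblock (k : fieldType) (A : finType) (q : A -> nat) d b
    (r : polyring k (cA1_coord q + 'I_d)%type -> Prop) : is_prime r ->
  cylinder_locus d (Vpts (tblock k q b)) r <->
  forall c, (exists s, c = inl (existT _ b s)) -> r (var k c).
Proof.
move=> pr; have pE s : pullback d (@tvar k A q b s) = var k (inl (existT _ b s)).
  exact: (@ev_var k _ _ (@mpolyC _ k) (fun t => var k (inl t : cA1_coord q + 'I_d))).
split=> [[_ H] c [s ->]|H]; first by rewrite -pE; apply: H; exists s.
split=> [|f [s ->]]; first exact: pullback_prime.
by rewrite pE; apply: H; exists s.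
Qed.

Theorem odd_star_compatible (K : fieldType) (m : nat) (l : 'I_m -> nat)
    (hl : forall a, (1 <= l a)%N) (eta : closed_point K l) ai :
  ai \in alphas eta -> (forall p, Cunion eta ai p -> Sing (X eta) p) ->
  let A := {b : 'I_m | b \in Iset eta ai} in
  exists (q : A -> nat) (d : nat),
    (forall b, (1 <= q b)%N /\ (2 * q b)%N = (l (val b)).+1) /\
    forall p, Cunion eta ai p ->
      exists p' (e : local_iso (X eta) p (cylinder d (cA1_eqs (residue eta) q)) p'),
        (forall b : A, loci_correspond e (Vpts (zblock eta (val b)))
                         (cylinder_locus d (Vpts (tblock (residue eta) q b)))) /\
        loci_correspond e (Cunion eta ai)
          (cylinder_locus d (cA1_Y (residue eta) q (#|Iset eta ai| - 2))).
Proof.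
move=> /alphas_compatible compat sing A.
pose J := Iset eta ai.
have oJ (b : A) : odd (l (val b)) by have [] := (compat _).1 (valP b).
have lq (b : in_block J) : (l (val b)).+1 = (qdim l b).*2 by apply: odd_halfk.
have q0 b : (1 <= qdim (J := J) l b)%N /\ (2 * qdim l b)%N = (l (val b)).+1.
  by rewrite mul2n lq; split=> //; rewrite -double_gt0 -lq.
exists (@qdim m l J), #|{: free_index l J}|; split=> // p Cp.
have [Vp _] := sing p Cp; have [pp Xp] := Vp.
(* p becomes a point z over its residue field, and the chart of each block is chosen by looking at
   z. *)
have [L [g gp]] := prime_field_point pp.
pose i : {rmorphism residue eta -> L} := (g \o @mpolyC _ (residue eta))%FUN.
pose z := fun c => g (var (residue eta) c).
have gE f : g f = ev i z f by apply: poly_morphE.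
have unit (x : L) : x != 0 -> invertible x by move=> x0; exists x^-1; rewrite mulfV.
have lam0 a := lambda_neq0 eta (hl a).
have ccE (b : in_block J) : lambda eta (val b) * (-1) ^+ qdim l b = csign eta ai.
  by have [_] := (compat _).1 (valP b).
have cc0 : csign eta ai != 0 by rewrite mulf_neq0 // signr_eq0.
have [a [a' [aJ a'J aa' [_ Cz]]]] := Cp.
have uE : g (uvar eta) = i ((-1) ^+ halfk l a * (lambda eta a)^-1).
  apply/eqP; rewrite -subr_eq0 -[i _]/(g _) -rmorphB; apply/eqP/gp/Cz.
  by right; right; left.
have ha : csign eta a = csign eta ai by have [] := (compat _).1 aJ.
(* An incompatible block cannot vanish on C, where its continuant is a nonzero constant xi. At z = 0
   an even length would give the value 0, and an odd one (-1)^k, which equals xi only if the block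
   is compatible. *)
have pivH (h : out_block J) : exists i0 : 'I_(l (val h)).+1,
    dcont (seqf (@zblk _ _ _ z (val h))) (l (val h)).+1 i0.+1 != 0.
  have [z0|//] := pivot_exists (@zblk _ _ _ z (val h)); exfalso.
  have zs0 : zseq z (val h) = fun=> 0 by apply: functional_extensionality_dep => c; apply: z0.
  have hJ b : b \in J -> val h != b.
    by move=> bJ; apply: contraNneq (valP h) => ->.
  have hE : continuant (zseq z (val h)) (l (val h)).+1 =
      i ((-1) ^+ halfk l a * lambda eta (val h) * (lambda eta a)^-1).
    rewrite -(ev_continuant i) -gE; apply/eqP; rewrite -subr_eq0 -[i _]/(g _) -rmorphB.
    apply/eqP/gp/Cz; right; right; right; right; exists (val h) => //.
    by rewrite !hJ.
  have xi0 : (-1) ^+ halfk l a * lambda eta (val h) * (lambda eta a)^-1 != 0.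
    apply: mulf_neq0; last exact: invr_neq0 (lam0 a).
    by apply: mulf_neq0 => //; rewrite signr_eq0.
  have oh : odd (l (val h)).
    apply: contraT => eh; move/eqP: hE; rewrite zs0 -[l (val h)]odd_double_half (negPf eh) add0n.
    rewrite continuant_odd0 // eq_sym fmorph_eq0 => /eqP H.
    by have := xi0; rewrite H eqxx.
  move: hE; rewrite zs0 (odd_halfk oh) continuant_zero.
  rewrite -(rmorph1 i) -rmorphN -rmorphXn => /fmorph_inj hE.
  case/negP: (valP h); apply/compat; split=> //; rewrite -ha /csign.
  have -> : lambda eta (val h) = (-1) ^+ halfk l a * (-1) ^+ halfk l (val h) * lambda eta a.
    rewrite hE !mulrA -expr2 sqrr_sign mul1r mulrAC -mulrA mulfV ?mulr1 //; exact: lam0.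
  by rewrite mulrAC -[X in X * _]mulrA -expr2 sqrr_sign mulr1 mulrC.
pose piv h := sval (cid (pivH h)).
pose BA (b : in_block J) := sval (cid (odd_block_exists (lq b) i (@zblk _ _ _ z (val b)))).
have a0 : in_block J := Sub a aJ.
have zsrc : odd_src BA piv i z.
  split=> [|b|h].
  - apply: unit; rewrite -[ucoord z]/(g (uvar eta)) uE fmorph_eq0.
    by apply: mulf_neq0; [rewrite signr_eq0 | exact: invr_neq0 (lam0 a)].
  - by apply/points_affineP/unit; rewrite /BA; case: cid.
  - by apply: unit; rewrite /piv; case: cid.
have nsrc : ~ p (odd_src_poly BA piv).
  move=> /gp; rewrite gE => e; apply: (@not_invertible0 L); rewrite -e.
  exact/odd_src_polyP.
have [p' [e [_ _ Lc]]] := functor_iso_local_iso (odd_iso cc0 ccE a0 BA piv) Vp nsrc.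
have blk (b : A) r r' : Vpts (X eta) r -> ~ r (src e) ->
    Vpts (cylinder #|{: free_index l J}| (cA1_eqs (residue eta) (@qdim m l J))) r' -> ~ r' (tgt e) ->
    (forall x, extension r x <-> extension r' (comorph e x)) ->
    Vpts (zblock eta (val b)) r <->
    cylinder_locus #|{: free_index l J}| (Vpts (tblock (residue eta) (@qdim m l J) b)) r'.
  move=> Vr nr Vr' nr' rr'.
  have [pr _] := Vr; have [pr' _] := Vr'.
  rewrite (Vpts_zblock _ pr) (Vpts_tblock _ pr').
  apply: Lc => // S j x /points_oddP[HF _ Hx].
  have [H1 H2] := odd_zero b Hx.
  split=> H c [s ->]; first by apply: H1 => s'; exact: (H _ (ex_intro _ s' erefl)).
  by apply: H2 => s'; exact: (H _ (ex_intro _ s' erefl)).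
exists p', e; split; first by move=> b r r' *; apply: blk.
move=> r r' Vr nr Vr' nr' rr'.
have {}blk b := blk b r r' Vr nr Vr' nr' rr'.
have [pr' Er'] := Vr'.
have cA : #|{: A}| = #|J| by rewrite card_sig; apply: eq_card => b; rewrite inE.
have cJ : (1 < #|J|)%N by apply/card_gt1P; exists a, a'.
(* Y_(n-2) is indexed by sets of n - (n - 2) = 2 blocks, that is by pairs, as C is. *)
have cB : (#|{: A}| - (#|J| - 2))%N = 2%N by rewrite cA subKn.
split=> [[b [b' [bJ b'J bb' [pr Cr]]]]|[_ [B]]].
  split.
    split; first exact: pullback_prime.
    by move=> f Ef; apply: Er'; exists f.
  exists [set (Sub b bJ : A); Sub b' b'J].
    by rewrite cB cards2 -val_eqE bb'.
  split; first exact: pullback_prime.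
  have zb : Vpts (zblock eta (val (Sub b bJ : A))) r by split=> // f Hf; apply: Cr; left.
  have zb' : Vpts (zblock eta (val (Sub b' b'J : A))) r.
    by split=> // f Hf; apply: Cr; right; left.
  move=> f [c]; rewrite !inE => /orP[]/eqP-> tf.
    by have [_] := (blk _).1 zb; apply.
  by have [_] := (blk _).1 zb'; apply.
rewrite cB => /eqP/cards2P[x [y [xy ->]]] [_ HB].
have zx : Vpts (zblock eta (val x)) r.
  apply/blk; split; first exact: pullback_prime.
  by move=> f tf; apply: HB; exists x => //; rewrite !inE eqxx.
have zy : Vpts (zblock eta (val y)) r.
  apply/blk; split; first exact: pullback_prime.
  by move=> f tf; apply: HB; exists y => //; rewrite !inE eqxx orbT.
exists (val x), (val y); split=> //; try exact: valP.
exact: Cpair_points.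
Qed.

Theorem theorem3p9 (K : fieldType) (m : nat) (l : 'I_m -> nat)
    (hm : (1 <= m)%N) (hl : forall a, (1 <= l a)%N) (eta : closed_point K l) :
  (forall k : 'I_m -> nat,
     (forall a, l a = (2 * k a)%N) ->
     (-1) ^+ (\sum_(a < m) k a)%N + mu eta = 0 ->
     A1_singularity (X eta) (origin (residue eta) (star_coord l)))
  /\
  (forall ai, ai \in alphas eta ->
     (forall p, Cunion eta ai p -> Sing (X eta) p) ->
     let A := {b : 'I_m | b \in Iset eta ai} in
     exists (q : A -> nat) (d : nat),
       (forall b, (1 <= q b)%N /\ (2 * q b)%N = (l (val b)).+1) /\
       forall p, Cunion eta ai p ->
         exists p' (e : local_iso (X eta) p (cylinder d (cA1_eqs (residue eta) q)) p'),
           (forall b : A, loci_correspond e (Vpts (zblock eta (val b)))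
                            (cylinder_locus d (Vpts (tblock (residue eta) q b)))) /\
           loci_correspond e (Cunion eta ai)
             (cylinder_locus d (cA1_Y (residue eta) q (#|Iset eta ai| - 2)))).
Proof.
split=> [k lk muE|ai]; last exact: odd_star_compatible.
have lk2 a : l a = (k a).*2 by rewrite lk mul2n.
apply: (even_star_A1 lk2) => [a|]; first by rewrite -double_gt0 -lk2.
by apply/eqP; rewrite -addr_eq0 addrC; apply/eqP.
Qed.
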